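(* Let $m\ge 1$ be a natural number and let $\mathcal{T}$ be the set of trees with at most $m$ offspring per vertex. Consider on $\mathcal{T}$ the distance $$d(x,y)=\sum_{v\in\widetilde V}|x(v)-y(v)|\,\phi(v),\qquad \phi(v)=z^{\mathrm{gen}(v)},\quad 0<z<m^{-3/2}.$$ Let $\{T_i: i\ge 1\}$ be a sequence of i.i.d. random trees on $\mathcal{T}$ with the same law as a random tree $T$, and let $$g_n(t)=\frac1n\sum_{i=1}^n d(T_i,t),\qquad g(t)=\mathbb{E}(d(T,t)),\qquad t\in\mathcal{T}.$$ Then the process $(\sqrt n\,(g_n(t)-g(t)),\ t\in\mathcal{T})$ converges weakly as $n\to\infty$ to a Gaussian process $W$ with zero mean and the same covariance function as the process $X=(X(t),\,t\in\mathcal{T})$ defined by $X(t)=d(T,t)-\mathbb{E}(d(T,t))$.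
   Context: Let $A=\{1,\dots,m\}$ and let $\widetilde V$ be the set of nonempty finite sequences of elements of $A$ starting with $1$ (the vertices; the sequence $1$ is the root). For $v\in\widetilde V$ and $a\in A$, $va$ denotes the sequence obtained by appending $a$ to $v$. The generation of $v=a_1\dots a_k$ is its length, $\mathrm{gen}(v)=k$, so the root has generation $1$. A tree is a function $x:\widetilde V\to\{0,1\}$ satisfying $x(v)\ge x(va)$ for all $v\in\widetilde V$, $a\in A$; $\mathcal{T}$ is the set of all trees (trees may have infinitely many vertices). It is equipped with the Borel $\sigma$-field, generated by the sets $\{x\in\mathcal{T}:x(v)=1\}$, $v\in\widetilde V$; the metric space $(\mathcal{T},d)$ is compact. A random tree is a measurable map from a probability space to $\mathcal{T}$. Weak convergence of the process is understood as convergence in distribution of random elements of $C(\mathcal{T})$, the separable Banach space of continuous real functions on $(\mathcal{T},d)$ with the sup norm; the limit $W$ is a Gaussian random element of $C(\mathcal{T})$. *)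

(* Defs.v *)
From HB Require Import structures.
From mathcomp Require Import all_boot all_order all_algebra finmap.
From mathcomp Require Import all_classical all_reals all_analysis.
From mathcomp Require Import ring lra.

Set Implicit Arguments.
Unset Strict Implicit.
Unset Printing Implicit Defensive.
Import Order.TTheory GRing.Theory Num.Theory.
Import numFieldNormedType.Exports.

Local Open Scope classical_set_scope.
Local Open Scope ring_scope.

(* The alphabet {1, ..., m} is 'I_m, so that the letter 1 is the ordinal of   *)
(* value 0.                                                                   *)
Definition is_vertex m (s : seq 'I_m) : bool :=
  if s is a :: _ then a == 0 :> nat else false.

Definition vertex m := {s : seq 'I_m | is_vertex s}.

Lemma child_subproof m (v : vertex m) (a : 'I_m) : is_vertex (rcons (val v) a).
Proof. by case: v => -[]. Qed.

Definition child m (v : vertex m) (a : 'I_m) : vertex m :=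
  exist _ (rcons (val v) a) (child_subproof v a).

Definition gen m (v : vertex m) : nat := size (val v).

Record tree m := Tree {
  tree_fun :> vertex m -> bool ;
  tree_child : forall v a, (tree_fun (child v a) <= tree_fun v)%N }.

HB.instance Definition _ m := gen_eqMixin (tree m).
HB.instance Definition _ m := gen_choiceMixin (tree m).

Lemma treeP m (x y : tree m) : x =1 y -> x = y.
Proof.
case: x y => [x hx] [y hy] /= /funext xy; move: hx hy; rewrite xy => hx hy.
by congr Tree; exact: Prop_irrelevance.
Qed.

Definition empty_tree m : tree m := @Tree m (fun=> false) (fun _ _ => isT).

HB.instance Definition _ m := isPointed.Build (tree m) (empty_tree m).

Definition cylinders m : set (set (tree m)) :=
  [set [set x : tree m | x v] | v in [set: vertex m]].

HB.instance Definition _ m :=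
  Measurable.copy (tree m) (g_sigma_algebraType (@cylinders m)).

Definition tree_dist (R : realType) m (z : R) (x y : tree m) : R :=
  fine (\esum_(v in [set: vertex m])
    (`|(x v)%:R - (y v)%:R| * z ^+ gen v)%:E).

Section tree_metric.
Context (R : realType) (m : nat) (z : R).
Hypothesis hz : 0 < z < m%:R `^ (- (3 / 2)).
Implicit Types x y w : tree m.

Let z0 : 0 <= z. Proof. by case/andP: hz => /ltW. Qed.

Let mz_lt1 : m%:R * z < 1.
Proof.
case/andP: hz => _; case: m => [|k]; first by rewrite mul0r ltr01.
move=> h; have k0 : (0 : R) < k.+1%:R by rewrite ltr0n.
rewrite mulrC -ltr_pdivlMr// div1r; apply: lt_le_trans h _.
have -> : k.+1%:R^-1 = k.+1%:R `^ (-1) :> R by rewrite powR_inv1// ltW.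
by apply: ler_powR; [rewrite ler1n|lra].
Qed.

Let phi (v : vertex m) : \bar R := (z ^+ gen v)%:E.

Let phi_ge0 v : (0 <= phi v)%E.
Proof. by rewrite lee_fin exprn_ge0. Qed.

Let phi_fin : (\esum_(v in [set: vertex m]) phi v < +oo)%E.
Proof.
apply: (@le_lt_trans _ _ ((1 - m%:R * z)^-1)%:E); last exact: ltry.
apply: ge_ereal_sup => _ [A [finA _] <-].
rewrite fsbig_finite//= sumEFin lee_fin.
set s := fset_set A.
pose N := \max_(v <- s) gen v.
pose L (k : nat) : seq (seq 'I_m) := [seq val t | t : k.-tuple 'I_m].
apply: (@le_trans _ _ (\sum_(k < N.+1) (m%:R * z) ^+ k)); last first.
  have mz0 : 0 <= m%:R * z by rewrite mulr_ge0.
  rewrite -(@ler_pM2l _ (1 - m%:R * z)) ?subr_gt0// divff; last first.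
    by rewrite gt_eqF// subr_gt0.
  by rewrite -[X in X <= _]opprK -mulNr opprB -subrX1 opprB gerBl exprn_ge0.
have -> : \sum_(v <- s) z ^+ gen v =
    \sum_(k < N.+1) \sum_(v <- s | gen v == k) z ^+ gen v.
  under [RHS]eq_bigr do rewrite big_mkcond /=.
  rewrite exchange_big /= big_seq [RHS]big_seq; apply: eq_bigr => v vs.
  have vN : (gen v < N.+1)%N by rewrite ltnS /N leq_bigmax_seq.
  by rewrite -big_mkcond /= (big_pred1 (Ordinal vN)).
apply: ler_sum => k _.
rewrite (eq_bigr (fun=> z ^+ k)); last by move=> v /eqP ->.
rewrite big_const_seq iter_addr_0 -[leLHS]mulr_natl exprMn.
rewrite ler_wpM2r ?exprn_ge0// -natrX ler_nat.
rewrite -size_filter -(size_map val).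
have <- : size (L k) = (m ^ k)%N.
  by rewrite size_map -cardE card_tuple card_ord.
apply: uniq_leq_size.
  by rewrite map_inj_uniq ?filter_uniq ?fset_uniq//; exact: val_inj.
move=> _ /mapP[v] /[!mem_filter] /andP[/eqP vk _] ->.
apply/mapP; exists (Tuple (introT eqP vk)) => //.
by rewrite mem_enum.
Qed.

Definition dist_term (x y : tree m) (v : vertex m) : \bar R :=
  (`|(x v)%:R - (y v)%:R| * z ^+ gen v)%:E.

Let term_ge0 x y v : (0 <= dist_term x y v)%E.
Proof. by rewrite lee_fin mulr_ge0// exprn_ge0. Qed.

Let term_le x y v : (dist_term x y v <= phi v)%E.
Proof.
rewrite lee_fin ler_piMl ?exprn_ge0//.
by case: (x v); case: (y v); 
  rewrite ?subrr ?subr0 ?sub0r ?normrN ?normr1 ?normr0.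
Qed.

Let dist_fin x y : \esum_(v in [set: vertex m]) dist_term x y v \is a fin_num.
Proof.
rewrite ge0_fin_numE; last by apply: esum_ge0 => v _; exact: term_ge0.
by apply: le_lt_trans phi_fin; apply: le_esum => v _; exact: term_le.
Qed.

Lemma tree_distE x y :
  (tree_dist z x y)%:E = \esum_(v in [set: vertex m]) dist_term x y v.
Proof. by rewrite -[RHS](fineK (dist_fin x y)). Qed.

Lemma tree_distxx x : tree_dist z x x = 0.
Proof.
by apply: EFin_inj; rewrite tree_distE esum1// => v _;
   rewrite /dist_term subrr normr0 mul0r.
Qed.

Lemma tree_dist_positivity x y : tree_dist z x y = 0 -> x = y.
Proof.
move=> xy0; apply: treeP => v; apply/eqP; apply: contraT => xyv.
have : (dist_term x y v <= 0)%E.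
  rewrite -[X in (_ <= X)%E]/(0%:E) -xy0 tree_distE.
  apply: esum_ge; exists [set v]; first by split.
  by rewrite fsbig_set1.
rewrite lee_fin leNgt mulr_gt0 ?exprn_gt0//; last by case/andP: hz.
rewrite normr_gt0 subr_eq0; apply: contra xyv.
by case: (x v); case: (y v); rewrite // ?oner_eq0// eq_sym oner_eq0.
Qed.

Lemma tree_dist_sym x y : tree_dist z x y = tree_dist z y x.
Proof.
apply: EFin_inj; rewrite !tree_distE; apply: eq_esum => v _.
by rewrite /dist_term distrC.
Qed.

Lemma tree_dist_triangle y x w :
  tree_dist z x w <= tree_dist z x y + tree_dist z y w.
Proof.
rewrite -lee_fin EFinD !tree_distE -esumD//; apply: le_esum => v _.
by rewrite -EFinD lee_fin -mulrDl ler_wpM2r ?exprn_ge0// ler_distD.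
Qed.

Lemma tree_dist_small (x : tree m) (e : R) : 0 < e ->
  exists2 A : set (vertex m), finite_set A &
    forall y : tree m, (forall v, A v -> x v = y v) -> tree_dist z x y < e.
Proof.
move=> e0.
have phi0 : (0 <= \esum_(v in [set: vertex m]) phi v)%E.
  by apply: esum_ge0 => v _; exact: phi_ge0.
have phif : \esum_(v in [set: vertex m]) phi v \is a fin_num.
  by rewrite ge0_fin_numE.
have : (\esum_(v in [set: vertex m]) phi v - e%:E
        < \esum_(v in [set: vertex m]) phi v)%E.
  by rewrite lteBlDr// lteDl// lte_fin.
move=> /ereal_sup_gt[_ [A [finA _] <-]] ltA.
exists A => // y xy; rewrite -lte_fin tree_distE.
rewrite (esumID A); last by move=> v _; exact: term_ge0.
rewrite !setTI esum1 ?add0e; last first.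
  by move=> v /xy Av; rewrite /dist_term Av subrr normr0 mul0r.
apply: (@le_lt_trans _ _ (\esum_(v in ~` A) phi v)).
  by apply: le_esum => v _; exact: term_le.
have SA : (\esum_(v in A) phi v)%E = (\sum_(v \in A) phi v)%E.
  by rewrite esum_fset.
move: ltA phif; rewrite (esumID A) ?setTI; last by move=> v _; exact: phi_ge0.
rewrite -SA fin_numD => ltA /andP[fA fA'].
move: ltA; rewrite lteBlDr// lteD2lE//.
Qed.

End tree_metric.

(* The trees with the distance tree_dist z. The proof hz is an argument of    *)
(* the type because tree_dist is a metric only if the sum defining it         *)
(* converges.                                                                 *)
Definition tree_space (R : realType) m (z : R)
    (hz : 0 < z < m%:R `^ (- (3 / 2))) : Type := tree m.

HB.instance Definition _ (R : realType) m (z : R)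
    (hz : 0 < z < m%:R `^ (- (3 / 2))) := Pointed.copy (tree_space hz) (tree m).

HB.instance Definition _ (R : realType) m (z : R)
    (hz : 0 < z < m%:R `^ (- (3 / 2))) :=
  @isMetric.Build R (tree_space hz) (tree_dist z) (tree_distxx hz)
    (tree_dist_positivity hz) (tree_dist_sym hz) (tree_dist_triangle hz).

Lemma tree_space_compact (R : realType) m (z : R)
    (hz : 0 < z < m%:R `^ (- (3 / 2))) : compact [set: tree_space hz].
Proof.
rewrite compact_ultra => F UF _.
pose x0 (v : vertex m) : bool :=
  `[< F [set y : tree_space hz | (y : tree m) v] >].
have x0P v : F [set y : tree_space hz | x0 v = (y : tree m) v].
  rewrite /x0; case: asboolP => Fv; first by apply: filterS Fv => y /= ->.
  case: (in_ultra_setVsetC [set y : tree_space hz | (y : tree m) v] UF)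
    => // FC.
  by apply: filterS FC => y /= /negP/negbTE ->.
have x0_child v a : (x0 (child v a) <= x0 v)%N.
  rewrite /x0; case: asboolP => // Fa; rewrite asboolT//.
  apply: filterS Fa => y /= ya.
  by have := tree_child y v a; rewrite ya; case: (_ v).
pose x : tree_space hz := Tree x0_child.
exists x; split=> // B /nbhs_ballP[e /= e0] xB.
suff Fx : F (ball x e) by exact: filterS xB Fx.
have [A finA HA] := tree_dist_small hz (x : tree m) e0.
suff : F (\bigcap_(v in A) [set y : tree_space hz | x0 v = (y : tree m) v]).
  apply: filterS => y yA; rewrite ballEmdist /=; apply: HA => v Av; exact: yA.
rewrite -(fset_setK finA).
by apply: filter_bigI => v _; exact: x0P.
Qed.

Arguments tree_space_compact {R m z} hz _ _ _.

(* C(K) with the sup norm, which is finite by the compactness proof cK.       *)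
Definition continuous_space (R : realType) (K : ptopologicalType)
  (cK : compact [set: K]) : Type := continuousType K R.

Section continuous_space.
Context (R : realType) (K : ptopologicalType) (cK : compact [set: K]).
Local Notation C := (continuous_space R cK).
Implicit Types f g h : C.

HB.instance Definition _ := Choice.copy C (continuousType K R).

Definition csfun f : K -> R := f : continuousType K R.

Lemma csfun_continuous f : continuous (csfun f).
Proof. exact: cts_fun. Qed.

Definition mkcs (u : K -> R) (cu : continuous u) : C :=
  (mkcts cu : continuousType K R).

Lemma csfunP f g : csfun f =1 csfun g -> f = g.
Proof. by move=> fg; exact/continuousEP. Qed.

Let add_cts f g : continuous (fun t => csfun f t + csfun g t).
Proof. by move=> t; apply: cvgD; exact: csfun_continuous. Qed.

Let opp_cts f : continuous (fun t => - csfun f t).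
Proof. by move=> t; apply: cvgN; exact: csfun_continuous. Qed.

Let scale_cts (a : R) f : continuous (fun t => a * csfun f t).
Proof. by move=> t; apply: cvgMr; exact: csfun_continuous. Qed.

Let zero_cts : continuous (fun _ : K => 0 : R).
Proof. by move=> t; exact: cvg_cst. Qed.

Definition cs_zero : C := mkcs zero_cts.
Definition cs_add f g : C := mkcs (@add_cts f g).
Definition cs_opp f : C := mkcs (@opp_cts f).
Definition cs_scale (a : R) f : C := mkcs (@scale_cts a f).

Let addA : associative cs_add.
Proof. by move=> f g h; apply: csfunP => t; exact: addrA. Qed.
Let addC : commutative cs_add.
Proof. by move=> f g; apply: csfunP => t; exact: addrC. Qed.
Let add0 : left_id cs_zero cs_add.
Proof. by move=> f; apply: csfunP => t; exact: add0r. Qed.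
Let addN : left_inverse cs_zero cs_opp cs_add.
Proof. by move=> f; apply: csfunP => t; exact: addNr. Qed.

HB.instance Definition _ := GRing.isZmodule.Build C addA addC add0 addN.

Let scaleA (a b : R) f : cs_scale a (cs_scale b f) = cs_scale (a * b) f.
Proof. by apply: csfunP => t; exact: mulrA. Qed.
Let scale1 : left_id 1 cs_scale.
Proof. by move=> f; apply: csfunP => t; exact: mul1r. Qed.
Let scaleDr : right_distributive cs_scale +%R.
Proof. by move=> a f g; apply: csfunP => t; exact: mulrDr. Qed.
Let scaleDl f : {morph cs_scale^~ f : a b / a + b}.
Proof. by move=> a b; apply: csfunP => t; exact: mulrDl. Qed.

HB.instance Definition _ :=
  GRing.Zmodule_isLmodule.Build R C scaleA scale1 scaleDr scaleDl.

Definition supnorm f : R := sup [set `|csfun f t| | t in [set: K]].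

Let has_sup_abs f : has_sup [set `|csfun f t| | t in [set: K]].
Proof.
split; first by exists `|csfun f point|, point.
have : compact (csfun f @` [set: K]).
  apply: continuous_compact => //; apply: continuous_subspaceT.
  exact: csfun_continuous.
move=> /compact_bounded[M [_ MP]]; exists (M + 1) => _ [t _ <-].
by apply: (MP (M + 1)); rewrite ?ltrDl//; exists t.
Qed.

Lemma le_supnorm f t : `|csfun f t| <= supnorm f.
Proof. by apply: sup_upper_bound; [exact: has_sup_abs|exists t]. Qed.

Lemma supnorm_le f (M : R) : (forall t, `|csfun f t| <= M) -> supnorm f <= M.
Proof.
move=> fM; apply: sup_le_ub; first by exists `|csfun f point|, point.
by move=> _ [t _ <-].
Qed.

Let supnormD f g : supnorm (f + g) <= supnorm f + supnorm g.
Proof.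
apply: supnorm_le => t; apply: le_trans (ler_normD _ _) _.
by rewrite lerD ?le_supnorm.
Qed.

Let supnormZ_le (a : R) f : supnorm (a *: f) <= `|a| * supnorm f.
Proof.
by apply: supnorm_le => t; rewrite normrM ler_wpM2l ?le_supnorm.
Qed.

Let supnormZ (a : R) f : supnorm (a *: f) = `|a| * supnorm f.
Proof.
apply/eqP; rewrite eq_le supnormZ_le/=; have [->|a0] := eqVneq a 0.
  rewrite normr0 mul0r; apply: le_trans (le_supnorm _ point).
  exact: normr_ge0.
rewrite -ler_pdivlMl ?normr_gt0// -normfV.
by apply: le_trans (supnormZ_le _ _); rewrite scalerA mulVf// scale1r.
Qed.

Let supnorm_eq0 f : supnorm f = 0 -> f = 0.
Proof.
move=> f0; apply: csfunP => t; apply/eqP.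
by rewrite -[csfun 0 t]/0 -normr_le0 -f0 le_supnorm.
Qed.

HB.instance Definition _ :=
  Lmodule_isNormed.Build R C supnormD supnormZ supnorm_eq0.

End continuous_space.

Definition borel (X : ptopologicalType) := g_sigma_algebraType (@open X).

Section probability_notions.
Local Open Scope ereal_scope.
Context (R : realType).

Definition mutually_independent (d d' : measure_display)
    (Omega : measurableType d) (E : measurableType d')
    (P : probability Omega R)
    (X : nat -> {RV P >-> E}) : Prop :=
  forall (J : {fset nat}) (B : nat -> set E), (forall i, measurable (B i)) ->
    P (\bigcap_(i in [set` J]) (X i @^-1` B i)) =
    \prod_(i <- J) P (X i @^-1` B i).

Definition same_law (d1 d2 d' : measure_display) (Omega1 : measurableType d1)
    (Omega2 : measurableType d2) (E : measurableType d')
    (P1 : probability Omega1 R) (P2 : probability Omega2 R)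
    (X1 : {RV P1 >-> E}) (X2 : {RV P2 >-> E}) : Prop :=
  forall B : set E, measurable B -> distribution P1 X1 B = distribution P2 X2 B.

(* The library's normal_prob is not a Dirac mass for the standard deviation   *)
(* 0, so the degenerate Gaussian laws are added here.                         *)
Definition gaussian_law (a s : R) (B : set R) : \bar R :=
  if s == 0%R then \d_a B else normal_prob a s B.

Definition gaussian_variable (d : measure_display) (S : measurableType d)
    (Q : probability S R) (X : S -> R) : Prop :=
  measurable_fun [set: S] X /\
  exists a s : R,
    forall B : set R, measurable B -> Q (X @^-1` B) = gaussian_law a s B.

Definition gaussian_process (d : measure_display) (S : measurableType d)
    (Q : probability S R) (I : Type) (X : I -> S -> R) : Prop :=
  forall (k : nat) (t : 'I_k -> I) (c : 'I_k -> R),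
    gaussian_variable Q (fun w => \sum_(i < k) c i * X (t i) w)%R.

Definition gaussian_element (d : measure_display) (S : measurableType d)
    (Q : probability S R) (V : normedModType R) (W : S -> V) : Prop :=
  measurable_fun [set: S] (W : S -> borel V) /\
  forall l : {linear V -> R^o}, continuous l -> gaussian_variable Q (l \o W).

Definition cvg_in_distribution (d d' : measure_display)
    (Omega : measurableType d) (P : probability Omega R)
    (S : measurableType d') (Q : probability S R) (V : normedModType R)
    (Y : nat -> Omega -> V) (W : S -> V) : Prop :=
  [/\ forall n, measurable_fun [set: Omega] (Y n : Omega -> borel V),
      measurable_fun [set: S] (W : S -> borel V) &
      forall F : V -> R, continuous F ->
        (exists M : R, forall f, `|F f| <= M)%R ->
        'E_P[F \o Y n] @[n --> \oo] --> 'E_Q[F \o W]].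

End probability_notions.

Section mean_distances.
Context (R : realType) (m : nat) (z : R) (d : measure_display).
Context (Omega : measurableType d) (P : probability Omega R).

(* The sample T_1, T_2, ... is indexed from 0.                                *)
Definition empirical_dist (T_ : nat -> {RV P >-> tree m}) (n : nat) (w : Omega)
    (t : tree m) : R :=
  n%:R^-1 * \sum_(i < n) tree_dist z (T_ i w) t.

Definition mean_dist (T : {RV P >-> tree m}) (t : tree m) : R :=
  fine 'E_P[fun w => tree_dist z (T w) t].

Definition centered_dist (T : {RV P >-> tree m}) (t : tree m) (w : Omega) : R :=
  tree_dist z (T w) t - mean_dist T t.

End mean_distances.

(* Main.v *)
From HB Require Import structures.
Require Import Defs.
From mathcomp Require Import all_boot all_order all_algebra finmap.
From mathcomp Require Import all_classical all_reals all_analysis.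
From mathcomp Require Import measurable_realfun ring lra.

Set Implicit Arguments.
Unset Strict Implicit.
Unset Printing Implicit Defensive.
Import Order.TTheory GRing.Theory Num.Theory.
Import numFieldNormedType.Exports.

Local Open Scope classical_set_scope.
Local Open Scope ring_scope.

(* Number the vertices v_0, v_1, ... For x, t in {0, 1} one has               *)
(* |x - t| = x (1 - 2 t) + t, hence d(T, t) - E d(T, t) is the sum over i of  *)
(* tau_i psi_i(t), where tau_i = T(v_i) - E T(v_i) and where                  *)
(* psi_i(t) = z^gen(v_i) (1 - 2 t(v_i)) is an element of norm at most         *)
(* z^gen(v_i) of C(T). So sqrt n (g_n - g) is the sum of the X_(n,i) psi_i,   *)
(* where X_(n,i) is a normalized sum of copies of tau_i. Since the norms of   *)
(* the psi_i are summable and E X_(n,i)^2 <= 1, the tails of this series are  *)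
(* small in mean uniformly in n, which replaces the tightness argument: the   *)
(* central limit theorem for finitely many coordinates, with the limit        *)
(* W = sum of the Z_i psi_i for a centered Gaussian family Z with the         *)
(* covariances of tau, yields E F(Y_n) -> E F(W) for bounded Lipschitz F, and *)
(* inf-convolutions extend this to bounded continuous F.                      *)
(* The family Z is a Cholesky transform of a sequence of independent normal   *)
(* variables, themselves quantile transforms of independent uniform variables *)
(* read off the binary digits of one uniform variable.                        *)

(** * Trigonometric approximation *)

(** For bits, |x - t| = x (1 - 2 t) + t is affine in x, so d(T, .) - E d(T, .) is a series U of
    centered bits times fixed elements of C(T) whose norms are summable ([centered_bit_series],
    [norm_coordinate]). The process sqrt n (g_n - g) is the same series with the bits replaced by
    normalized sums. The theorem thus reduces to a central limit theorem for real coefficients,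
    carried into C(T) by a series.

    Convergence. Laws of coefficients are handled through the integrals of cos ([lin] + b): b = 0
    and b = - pi / 2 give the real and imaginary parts of the characteristic function. By
    independence E exp (i S_n) is an n-th power, and [clt_cos] compares it with the n-th power of a
    Gaussian factor. Approximation by trigonometric polynomials with a quadratic error
    ([lipschitz_trig_approx]) and bounds on second moments give the convergence for Lipschitz
    functions of finitely many coefficients ([cvg_lipschitz_of_cos]). Truncating the series costs at
    most a tail of the weights, whatever n is ([random_series_tail]), and envelopes from below lead
    to all bounded continuous functions ([random_series_cvg_in_distribution]).

    The limit. [gaussian_family_summable] provides coefficients Z with the covariances of the
    centered bits, for which the series converges at every sample point; W is its sum. If l is
    linear and bounded, l (W) is a limit of centered Gaussian sums, hence centered Gaussian with E
    l(W)^2 = E l(U)^2 ([gaussian_functional]). Continuous functionals, combinations of evaluations,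
    and f s + f t give in turn the Gaussian element, the Gaussian process and, by
    [covariance_polarization], the covariances. *)

Section elementary_bounds.
Context {R : realType}.
Implicit Types x y : R.

Lemma sin_le_norm x : `|sin x| <= `|x|.
Proof.
wlog x0 : x / 0 <= x.
  move=> H; have [/H//|/ltW x0] := leP 0 x.
  by rewrite -normrN -sinN -(normrN x) H// oppr_ge0.
have [|c _] := @MVT_segment R sin cos 0 x x0 (fun y _ => is_derive_sin y).
  by apply: continuous_subspaceT; exact: continuous_sin.
rewrite sin0 !subr0 => ->; rewrite normrM -[leRHS]mul1r.
by rewrite ler_wpM2r// cos_max.
Qed.

Lemma cosB1_le x : `|cos x - 1| <= x ^+ 2 / 2.
Proof.
have -> : cos x - 1 = - (sin (x / 2) ^+ 2 *+ 2).
  have -> : cos x = cos ((x / 2) *+ 2) by congr cos; rewrite -mulr_natr; field.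
  rewrite cos_mulr2n cos2sin2; ring.
rewrite normrN ger0_norm ?mulrn_wge0 ?sqr_ge0//.
have := sin_le_norm (x / 2); rewrite -ler_sqr ?nnegrE// !real_normK ?num_real//.
by rewrite -[_ *+ 2]mulr_natr; lra.
Qed.

(** By the mean value theorem for sin y - y, whose derivative cos c - 1 is at most c^2 / 2 with c
    between 0 and x. This yields the constant 1/2 instead of the optimal 1/6. *)
Lemma sinB_le3 x : `|sin x - x| <= `|x| ^+ 3 / 2.
Proof.
wlog x0 : x / 0 <= x.
  move=> H; have [/H//|/ltW x0] := leP 0 x.
  have := H (- x); rewrite sinN normrN oppr_ge0 -opprD normrN.
  exact.
have dsin y : y \in `]0, x[ -> is_derive y 1 (fun y => sin y - y) (cos y - 1).
  by move=> _; apply: is_deriveB.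
have [|c] := @MVT_segment R (fun y => sin y - y) _ 0 x x0 dsin.
  by apply: continuous_subspaceT => y; apply: cvgB;
    [exact: continuous_sin|exact: cvg_id].
rewrite in_itv/= => /andP[c0 cx]; rewrite sin0 !subr0 => ->; rewrite normrM exprSr.
rewrite mulrAC ler_wpM2r//; apply: le_trans (cosB1_le c) _.
by rewrite real_normK ?num_real// ler_pM2r ?invr_gt0// ler_sqr ?nnegrE.
Qed.

Lemma sinB_le2 x : `|sin x - x| <= x ^+ 2.
Proof.
(* For |x| at most 2 the cubic bound is below x^2; beyond, |sin x - x| is at most 2 |x|, hence at
   most x^2. *)
have [x2|x2] := leP `|x| 2.
  apply: le_trans (sinB_le3 x) _; rewrite -real_normK ?num_real//.
  by rewrite exprSr; have := sqr_ge0 `|x|; have := normr_ge0 x; nra.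
apply: le_trans (ler_normB _ _) _; have := sin_le_norm x.
by rewrite -[x ^+ 2]real_normK ?num_real// expr2; nra.
Qed.

Lemma expRN_le2 y : 0 <= y -> `|expR (- y) - (1 - y)| <= y ^+ 2.
Proof.
move=> y0; have y1 := expR_ge1Dx (- y).
rewrite ger0_norm; last by lra.
have yp : expR (- y) <= (1 + y)^-1.
  rewrite expRN lef_pV2 ?posrE ?expR_gt0 ?expR_ge1Dx//; lra.
(* Because (1 + y) (1 - y + y^2) = 1 + y^3. *)
have : (1 + y)^-1 <= 1 - y + y ^+ 2.
  rewrite -div1r ler_pdivrMr; last by lra.
  have : 0 <= y ^+ 3 by rewrite exprn_ge0.
  by rewrite !exprSr expr0; nra.
by lra.
Qed.

End elementary_bounds.

(** * Bernstein approximation on the whole line *)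

Section bernstein.
Context {R : realType}.
Implicit Types (s : R) (f g : nat -> R).

(* The expectation of f at a binomial variable of parameters p and s; the     *)
(* recursion conditions on the first trial.                                   *)
Fixpoint bern s p f : R :=
  if p is q.+1 then s * bern s q (f \o succn) + (1 - s) * bern s q f else f 0%N.

Lemma bern_le s p f g : 0 <= s <= 1 -> (forall k, f k <= g k) ->
  bern s p f <= bern s p g.
Proof.
move=> /andP[s0 s1]; elim: p f g => [|p IH] f g fg //=.
by apply: lerD; rewrite ler_wpM2l ?subr_ge0//; apply: IH => k; exact: fg.
Qed.

Lemma bern_affine s p a b f : bern s p (fun k => a * f k + b) = a * bern s p f + b.
Proof.
by elim: p f => [|p IH] f //=; rewrite /comp (IH (fun k => f k.+1)) IH; ring.
Qed.

Lemma bern_norm s p f : 0 <= s <= 1 -> `|bern s p f| <= bern s p (fun k => `|f k|).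
Proof.
move=> s01; rewrite ler_norml; apply/andP; split; last first.
  by apply: bern_le => // k; exact: ler_norm.
have := bern_affine s p (-1) 0 (fun k => `|f k|); rewrite addr0 mulN1r => <-.
by apply: bern_le => // k; rewrite addr0 mulN1r lerNl -normrN ler_norm.
Qed.

(** Squared bias plus variance of a binomial variable. In the induction, a success in the first
    trial replaces a by a - 1. *)
Lemma bern_sqr s p a :
  bern s p (fun k => (k%:R - a) ^+ 2) =
  (p%:R * s - a) ^+ 2 + p%:R * (s * (1 - s)).
Proof.
elim: p a => [|p IH] a /=; first by rewrite !mul0r addr0.
rewrite IH (_ : _ \o _ = fun k => (k%:R - (a - 1)) ^+ 2); last first.
  by apply/funext => k /=; rewrite -natr1; ring.
by rewrite IH -natr1; ring.
Qed.

(** The number of trials is a square so that the order of the standard deviation is the integer q.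
    The second moment is used through |a| <= a^2 / q + q, which avoids Cauchy-Schwarz. *)
Lemma bern_dev s q : 0 <= s <= 1 -> (0 < q)%N ->
  bern s (q ^ 2)%N (fun k => `|k%:R - (q ^ 2)%:R * s|) <= 2 * q%:R.
Proof.
move=> s01 q0; have q0R : 0 < q%:R :> R by rewrite ltr0n.
have Hk k : `|k%:R - (q ^ 2)%:R * s| <=
    q%:R^-1 * (k%:R - (q ^ 2)%:R * s) ^+ 2 + q%:R.
  move: (k%:R - _) => a; rewrite -(real_normK (num_real a)).
  rewrite -(@ler_pM2l _ q%:R)// mulrDr mulrA divff ?gt_eqF// mul1r.
  by move: `|a| => b; nra.
apply: (le_trans (bern_le _ s01 Hk)); rewrite bern_affine bern_sqr subrr expr0n/= add0r.
have -> : q%:R^-1 * ((q ^ 2)%:R * (s * (1 - s))) = q%:R * (s * (1 - s)).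
  by rewrite natrX; field; rewrite gt_eqF.
by case/andP: s01 => s0 s1; nra.
Qed.

(* Bernstein operator in the variable s = (1 + sin (y / M)) / 2, with nodes   *)
(* M (2k/q^2 - 1): as M sin (y / M) is y up to y^2 / M, it approximates the   *)
(* identity of the whole line with an error at most eps (1 + y^2).            *)
Lemma bern_sin (eps : R) : 0 < eps ->
  exists M p (c : nat -> R), 0 < M /\
    forall y, bern ((1 + sin (y / M)) / 2) p (fun k => `|y - c k|)
              <= eps * (1 + y ^+ 2).
Proof.
(* M = 1 / eps makes the bias y^2 / M equal to eps y^2; q is chosen so that the sampling error (2 M
   / q^2) (2 q) = 4 M / q is at most eps. *)
move=> e0; pose M := eps^-1; have M0 : 0 < M by rewrite invr_gt0.
pose q := (Num.truncn (4 * M / eps)).+1.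
have q0 : 0 < q%:R :> R by rewrite ltr0n.
have Mq : 4 * M / q%:R <= eps.
  rewrite ler_pdivrMr// [eps * _]mulrC -ler_pdivrMr//; apply/ltW; rewrite /q.
  by rewrite truncnS_gt.
exists M, (q ^ 2)%N, (fun k => M * (2 * k%:R / (q ^ 2)%:R - 1)); split=> // y.
set s := (1 + _) / 2.
have s01 : 0 <= s <= 1.
  by have := sin_geN1 (y / M); have := sin_le1 (y / M); rewrite /s; lra.
have Hk k : `|y - M * (2 * k%:R / (q ^ 2)%:R - 1)| <=
   (2 * M / (q ^ 2)%:R) * `|k%:R - (q ^ 2)%:R * s| + y ^+ 2 / M.
  have -> : y - M * (2 * k%:R / (q ^ 2)%:R - 1) =
      - ((2 * M / (q ^ 2)%:R) * (k%:R - (q ^ 2)%:R * s))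
      - M * (sin (y / M) - y / M).
    by rewrite /s natrX; field; rewrite !gt_eqF.
  apply: le_trans (ler_normB _ _) _; rewrite normrN lerD//.
    by rewrite normrM ger0_norm// divr_ge0// mulr_ge0// ltW.
  rewrite normrM ger0_norm ?(ltW M0)//.
  have -> : y ^+ 2 / M = M * (y / M) ^+ 2 by field; rewrite gt_eqF.
  by rewrite ler_pM2l// sinB_le2.
apply: (le_trans (bern_le _ s01 Hk)); rewrite bern_affine.
have -> : y ^+ 2 / M = eps * y ^+ 2 by rewrite /M invrK mulrC.
rewrite [eps * (1 + _)]mulrDr mulr1 lerD2r; apply: le_trans Mq.
have -> : 4 * M / q%:R = (2 * M / (q ^ 2)%:R) * (2 * q%:R).
  by rewrite natrX; field; rewrite gt_eqF.
rewrite ler_wpM2l ?bern_dev// divr_ge0// mulr_ge0// ltW//.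
Qed.

End bernstein.

(** * Trigonometric polynomials in finitely many coordinates *)

Section trigonometric_polynomials.
Context {R : realType}.
Implicit Types (u x : nat -> R) (h : (nat -> R) -> R).

Definition lin N u x : R := \sum_(i < N) u i * x i.

Lemma linD N u v x : lin N (fun i => u i + v i) x = lin N u x + lin N v x.
Proof. by rewrite /lin -big_split/=; apply: eq_bigr => i _; rewrite mulrDl. Qed.

Lemma linN N u x : lin N (fun i => - u i) x = - lin N u x.
Proof. by rewrite /lin -sumrN; apply: eq_bigr => i _; rewrite mulNr. Qed.

(** A term is an amplitude, a frequency vector and a phase. The phase covers sines as well as
    cosines, so that real functions suffice and products stay in the class. *)
Definition trig_poly N h := exists s : seq (R * (nat -> R) * R),
  forall x, h x = \sum_(t <- s) t.1.1 * cos (lin N t.1.2 x + t.2).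

Lemma trig_cos N a u b : trig_poly N (fun x => a * cos (lin N u x + b)).
Proof. by exists [:: (a, u, b)] => x; rewrite big_seq1. Qed.

Lemma trig_cst N a : trig_poly N (fun=> a).
Proof.
exists [:: (a, fun=> 0, 0)] => x; rewrite big_seq1/= /lin.
by rewrite big1 ?addr0 ?cos0 ?mulr1// => i _; rewrite mul0r.
Qed.

Lemma trigD N h1 h2 : trig_poly N h1 -> trig_poly N h2 ->
  trig_poly N (fun x => h1 x + h2 x).
Proof.
by move=> [s1 h1E] [s2 h2E]; exists (s1 ++ s2) => x; rewrite big_cat h1E h2E.
Qed.

Lemma trig_sum N (I : Type) (s : seq I) (h : I -> (nat -> R) -> R) :
  (forall i, trig_poly N (h i)) -> trig_poly N (fun x => \sum_(i <- s) h i x).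
Proof.
move=> Hh; elim: s => [|i s IH].
  by under eq_fun do rewrite big_nil; exact: trig_cst.
by under eq_fun do rewrite big_cons; exact: trigD.
Qed.

Lemma trigM N h1 h2 : trig_poly N h1 -> trig_poly N h2 ->
  trig_poly N (fun x => h1 x * h2 x).
Proof.
move=> [s1 h1E] [s2 h2E].
under eq_fun do rewrite h1E h2E big_distrl/=.
apply: trig_sum => -[[a u] b] /=.
under eq_fun do rewrite big_distrr/=.
apply: trig_sum => -[[a' u'] b'] /=.
rewrite (_ : (fun x => _) = (fun x =>
   (a * a' / 2) * cos (lin N (fun i => u i + u' i) x + (b + b')) +
   (a * a' / 2) * cos (lin N (fun i => u i - u' i) x + (b - b')))).
  by apply: trigD; exact: trig_cos.
apply/funext => x; rewrite linD (linD N u (fun i => - u' i)) linN.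
have -> : lin N u x + lin N u' x + (b + b') = (lin N u x + b) + (lin N u' x + b').
  by rewrite addrACA.
have -> : lin N u x - lin N u' x + (b - b') = (lin N u x + b) - (lin N u' x + b').
  by rewrite addrACA opprD.
by move: (lin N u x + b) (lin N u' x + b') => A B; rewrite cosD cosB; field.
Qed.

Lemma trig_widen N h : trig_poly N h -> trig_poly N.+1 h.
Proof.
move=> [s hE].
exists [seq (t.1.1, (fun i => if (i < N)%N then t.1.2 i else 0), t.2) | t <- s].
move=> x; rewrite big_map hE; apply: eq_bigr => -[[a u] b] _ /=.
congr (_ * cos (_ + _)); rewrite /lin big_ord_recr/= ltnn mul0r addr0.
by apply: eq_bigr => i _; rewrite ltn_ord.
Qed.

Lemma trig_coord N (M : R) : trig_poly N.+1 (fun x => sin (x N / M)).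
Proof.
rewrite (_ : (fun x => _) = (fun x =>
   1 * cos (lin N.+1 (fun i => (i == N)%:R / M) x + - (pi / 2)))).
  exact: trig_cos.
apply/funext => x; rewrite mul1r cosBpihalf; congr sin; rewrite /lin.
rewrite big_ord_recr/= eqxx mul1r big1 ?add0r 1?mulrC// => i _.
by rewrite ltn_eqF ?mul0r.
Qed.

Lemma trig_bern N (s : (nat -> R) -> R) p (h : nat -> (nat -> R) -> R) :
  trig_poly N s -> (forall k, trig_poly N (h k)) ->
  trig_poly N (fun x => bern (s x) p (h^~ x)).
Proof.
move=> ts; elim: p h => [|p IH] h th /=; first exact: th.
have t1s : trig_poly N (fun x => 1 - s x).
  under eq_fun do rewrite -mulN1r.
  by apply: trigD; [exact: trig_cst|apply: trigM => //; exact: trig_cst].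
apply: trigD; apply: trigM => //; last exact: IH.
by apply: (IH (fun k => h k.+1)).
Qed.

Definition upd x N a : nat -> R := fun i => if i == N then a else x i.

(** Induction on the number of coordinates: freeze the last coordinate at the nodes of [bern_sin],
    approximate each frozen function by the induction hypothesis, and recombine with the Bernstein
    weights, which are polynomials in the sine of the last coordinate. The domain is not compact, so
    the error is allowed to grow quadratically; second moments absorb it later. *)
Lemma lipschitz_trig_approx N F (L : R) :
  (forall x y, `|F x - F y| <= L * \sum_(i < N) `|x i - y i|) ->
  forall eps, 0 < eps -> exists h, trig_poly N h /\
    forall x, `|F x - h x| <= eps * (1 + \sum_(i < N) x i ^+ 2).
Proof.
elim: N F L => [|N IH] F L FL eps e0.
  exists (fun=> F (fun=> 0)); split; first exact: trig_cst.
  move=> x; apply: le_trans (FL _ _) _.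
  by rewrite !big_ord0 mulr0 addr0 mulr1 ltW.
wlog L0 : L FL / 0 < L.
  move=> /(_ (Num.max L 1)); apply; last by rewrite lt_max ltr01 orbT.
  move=> x y; apply: le_trans (FL x y) _.
  by rewrite ler_wpM2r ?sumr_ge0// le_max lexx.
have [M [p [c [M0 Hc]]]] : exists M p (c : nat -> R), 0 < M /\
    forall y, bern ((1 + sin (y / M)) / 2) p (fun k => `|y - c k|)
              <= (eps / 2 / L) * (1 + y ^+ 2).
  by apply: bern_sin; rewrite divr_gt0// divr_gt0.
have FkL k : forall x y, `|F (upd x N (c k)) - F (upd y N (c k))| <=
    L * \sum_(i < N) `|x i - y i|.
  move=> x y; apply: le_trans (FL _ _) _; rewrite ler_pM2l//.
  rewrite big_ord_recr/= /upd eqxx subrr normr0 addr0.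
  by apply: ler_sum => i _; rewrite ltn_eqF.
have /choice[h Hh] k : exists h, trig_poly N h /\ forall x,
    `|F (upd x N (c k)) - h x| <= eps / 2 * (1 + \sum_(i < N) x i ^+ 2).
  by apply: (IH (fun x => F (upd x N (c k))) L (FkL k)); rewrite divr_gt0.
pose s x := (1 + sin (x N / M)) / 2.
exists (fun x => bern (s x) p (h^~ x)); split.
  apply: trig_bern => [|k]; last by apply: trig_widen; have [] := Hh k.
  apply: trigM (trig_cst _ _); apply: trigD (trig_cst _ _) _.
  exact: trig_coord.
move=> x; have s01 : 0 <= s x <= 1.
  by have := sin_geN1 (x N / M); have := sin_le1 (x N / M); rewrite /s; lra.
have -> : F x - bern (s x) p (h^~ x) = bern (s x) p (fun k => F x - h k x).
  have := bern_affine (s x) p (-1) (F x) (h^~ x).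
  rewrite mulN1r addrC => <-; congr bern; apply/funext => k.
  by rewrite mulN1r addrC.
apply: (le_trans (bern_norm _ _ s01)).
have Hk k : `|F x - h k x| <= L * `|x N - c k| +
    eps / 2 * (1 + \sum_(i < N) x i ^+ 2).
  rewrite -(subrK (F (upd x N (c k))) (F x)) -addrA.
  apply: le_trans (ler_normD _ _) _; apply: lerD; last by have [_] := Hh k.
  apply: le_trans (FL _ _) _; rewrite ler_pM2l// big_ord_recr/=.
  rewrite /upd eqxx big1 ?add0r// => i _.
  by rewrite ltn_eqF// subrr normr0.
apply: (le_trans (bern_le _ s01 Hk)); rewrite bern_affine.
have := Hc (x N); rewrite -(ler_pM2l L0).
have -> : L * (eps / 2 / L * (1 + x N ^+ 2)) = eps / 2 * (1 + x N ^+ 2).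
  by field; rewrite gt_eqF.
move=> Hx; apply: (le_trans (lerD Hx (lexx _))); rewrite big_ord_recr/=.
have S0 : 0 <= \sum_(i < N) x i ^+ 2 by apply: sumr_ge0 => i _; exact: sqr_ge0.
by have := sqr_ge0 (x N); move: (\sum_(i < N) _) S0 => S S0; nra.
Qed.

End trigonometric_polynomials.

(** * Convergence of characteristic functions *)

Lemma cvg_sum_seq {K : numFieldType} {V : normedModType K} {T I : Type}
    (F : set_system T) {FF : Filter F} (r : seq I) (f : I -> T -> V) (l : I -> V) :
  (forall i, f i x @[x --> F] --> l i) ->
  \sum_(i <- r) f i x @[x --> F] --> \sum_(i <- r) l i.
Proof. by move=> fl; apply: cvg_big => // x; exact: add_continuous. Qed.

Section expectation.
Context {d : measure_display} {Omega : measurableType d} {R : realType}.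
Variable P : probability Omega R.
Implicit Types X Y : Omega -> R.

Lemma bounded_integrable X (M : R) : measurable_fun setT X ->
  (forall w, `|X w| <= M) -> P.-integrable setT (EFin \o X).
Proof.
move=> mX XM; apply: measurable_bounded_integrable => //.
  by rewrite (le_lt_trans (probability_le1 P measurableT))// ltry.
exists M; split; first exact: num_real.
by move=> N MN w _; apply: le_trans (XM w) (ltW MN).
Qed.

Lemma expect_cst (a : R) : \int[P]_w a = a.
Proof. by rewrite Rintegral_cst// [X in fine X]probability_setT mulr1. Qed.

Lemma dominated_Rintegral (X_ : nat -> Omega -> R) X (G : Omega -> R) :
  (forall n, measurable_fun setT (X_ n)) ->
  P.-integrable setT (EFin \o G) ->
  (forall n w, `|X_ n w| <= G w) ->
  (forall w, X_ n w @[n --> \oo] --> X w) ->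
  \int[P]_w X_ n w @[n --> \oo] --> \int[P]_w X w.
Proof.
move=> mX iG XG Xcvg.
have mXX : measurable_fun setT X by apply: (measurable_fun_cvg mX) => w _; exact: Xcvg.
have [||||iX _ Hcvg] := @dominated_convergence _ _ _ P setT measurableT
   (fun n => EFin \o X_ n) (EFin \o X) (EFin \o G) _ _ _ iG.
- by move=> n; exact/measurable_EFinP.
- exact/measurable_EFinP.
- by apply: aeW => w _; apply: cvg_EFin; [exact: nearW|exact: Xcvg].
- by apply: aeW => w n _; rewrite /= lee_fin.
by apply: fine_cvg; rewrite fineK//; exact: integrable_fin_num.
Qed.

Lemma bounded_cvg_Rintegral (X_ : nat -> Omega -> R) X (M : R) :
  (forall n, measurable_fun setT (X_ n)) ->
  (forall n w, `|X_ n w| <= M) ->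
  (forall w, X_ n w @[n --> \oo] --> X w) ->
  \int[P]_w X_ n w @[n --> \oo] --> \int[P]_w X w.
Proof.
move=> mX XM; apply: dominated_Rintegral (mX) _ XM.
apply: (@bounded_integrable (fun=> M) `|M|) => //.
Qed.

Lemma expect_dist_le X Y (G : Omega -> R) :
  P.-integrable setT (EFin \o X) -> P.-integrable setT (EFin \o Y) ->
  P.-integrable setT (EFin \o G) -> (forall w, `|X w - Y w| <= G w) ->
  `|\int[P]_w X w - \int[P]_w Y w| <= \int[P]_w G w.
Proof.
move=> iX iY iG XYG; rewrite -RintegralB//.
have iXY : P.-integrable setT (EFin \o (fun w => X w - Y w)).
  exact: (integrableB _ iX iY).
apply: le_trans (le_normr_Rintegral _ _) _ => //.
apply: le_Rintegral => //.
exact: (integrable_abse iXY).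
Qed.

Lemma integrable_sumR I (s : seq I) (f : I -> Omega -> R) :
  (forall i, P.-integrable setT (EFin \o f i)) ->
  P.-integrable setT (EFin \o (fun w => \sum_(i <- s) f i w)).
Proof.
move=> fi; rewrite (_ : _ \o _ = (fun w => \sum_(i <- s) (f i w)%:E)%E).
  by apply: integrable_sum => // i _; exact: fi.
by apply/funext => w /=; rewrite sumEFin.
Qed.

Lemma integrableZlR (a : R) X : P.-integrable setT (EFin \o X) ->
  P.-integrable setT (EFin \o (fun w => a * X w)).
Proof. by move=> iX; exact: (integrableZl _ a iX). Qed.

Lemma integrableDR X Y : P.-integrable setT (EFin \o X) ->
  P.-integrable setT (EFin \o Y) ->
  P.-integrable setT (EFin \o (fun w => X w + Y w)).
Proof. by move=> iX iY; exact: (integrableD _ iX iY). Qed.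

Lemma expect_sum I (s : seq I) (f : I -> Omega -> R) :
  (forall i, P.-integrable setT (EFin \o f i)) ->
  \int[P]_w (\sum_(i <- s) f i w) = \sum_(i <- s) \int[P]_w f i w.
Proof.
move=> fi; elim: s => [|i s IH].
  by under eq_Rintegral do rewrite big_nil; rewrite big_nil expect_cst.
under eq_Rintegral do rewrite big_cons.
by rewrite big_cons RintegralD ?IH//; exact: integrable_sumR.
Qed.

End expectation.

Section square_integrable.
Context {R : realType} {d : measure_display} {S : measurableType d}.
Variables (Q : probability S R) (X : S -> R).
Hypothesis mX : measurable_fun setT X.
Hypothesis iX : Q.-integrable setT (EFin \o (fun w => X w ^+ 2)).

Let norm_le w : `|X w| <= 2^-1 * (1 + X w ^+ 2).
Proof.
rewrite -(real_normK (num_real (X w))).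
by have := sqr_ge0 (`|X w| - 1); rewrite sqrrB expr1n; move: `|_| => a; lra.
Qed.

Let i1 : Q.-integrable setT (EFin \o (fun=> 1 : R)).
Proof. by apply: (@bounded_integrable _ _ _ _ _ 1) => // w; rewrite normr1. Qed.

Let ibound : Q.-integrable setT (EFin \o (fun w => 2^-1 * (1 + X w ^+ 2))).
Proof. by apply: integrableZlR; exact: integrableDR. Qed.

Lemma integrable_of_sqr : Q.-integrable setT (EFin \o X).
Proof.
apply: le_integrable ibound => //; first exact/measurable_EFinP.
by move=> w _; rewrite /= lee_fin; apply: le_trans (norm_le w) (ler_norm _).
Qed.

Lemma integrable_norm_of_sqr : Q.-integrable setT (EFin \o (fun w => `|X w|)).
Proof. exact: (integrable_abse integrable_of_sqr). Qed.

Lemma expect_norm_le1 : \int[Q]_w (X w ^+ 2) <= 1 -> \int[Q]_w `|X w| <= 1.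
Proof.
move=> X1; apply: (@le_trans _ _ (\int[Q]_w (2^-1 * (1 + X w ^+ 2)))).
  by apply: le_Rintegral => //; exact: integrable_norm_of_sqr.
rewrite RintegralZl//; last exact: integrableDR.
by rewrite RintegralD// expect_cst; lra.
Qed.

Lemma expectation_of_sqr : ('E_Q[X] = (\int[Q]_w X w)%:E)%E.
Proof.
rewrite unlock /Rintegral fineK//.
exact: (integrable_fin_num measurableT integrable_of_sqr).
Qed.

End square_integrable.

Section trigonometric_polynomials_of_random_sequences.
Context {d : measure_display} {Omega : measurableType d} {R : realType}.
Variables (P : probability Omega R) (X : Omega -> nat -> R).
Hypothesis mX : forall i, measurable_fun setT (fun w => X w i).

Lemma measurable_cos (f : Omega -> R) : measurable_fun setT f ->
  measurable_fun setT (fun w => cos (f w)).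
Proof.
move=> mf; apply: measurableT_comp mf.
exact: continuous_measurable_fun (@continuous_cos R).
Qed.

Lemma measurable_lin N u : measurable_fun setT (fun w => lin N u (X w)).
Proof.
by apply: measurable_sum => i; apply: measurable_funM.
Qed.

Lemma measurable_cos_lin N u b :
  measurable_fun setT (fun w => cos (lin N u (X w) + b)).
Proof.
by apply/measurable_cos/measurable_funD => //; exact: measurable_lin.
Qed.

Lemma integrable_cos_lin N u b :
  P.-integrable setT (EFin \o (fun w => cos (lin N u (X w) + b))).
Proof.
apply: (@bounded_integrable _ _ _ _ _ 1) => [|w]; last exact: cos_max.
exact: measurable_cos_lin.
Qed.

Lemma measurable_trig N h : trig_poly N h -> measurable_fun setT (h \o X).
Proof.
move=> [s hE]; rewrite (_ : h \o X = fun w => \sum_(t <- s) t.1.1 *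
    cos (lin N t.1.2 (X w) + t.2)); last by apply/funext => w; rewrite -hE.
apply: measurable_sum => t; apply: measurable_funM => //.
exact: measurable_cos_lin.
Qed.

Lemma integrable_trig N h : trig_poly N h ->
  P.-integrable setT (EFin \o (fun w => h (X w))).
Proof.
move=> [s hE]; rewrite (_ : _ \o _ = EFin \o (fun w => \sum_(t <- s) t.1.1 *
    cos (lin N t.1.2 (X w) + t.2))); last by apply/funext => w /=; rewrite -hE.
by apply: integrable_sumR => t; apply: integrableZlR; exact: integrable_cos_lin.
Qed.

Lemma expect_trig N (s : seq (R * (nat -> R) * R)) :
  \int[P]_w (\sum_(t <- s) t.1.1 * cos (lin N t.1.2 (X w) + t.2)) =
  \sum_(t <- s) t.1.1 * \int[P]_w cos (lin N t.1.2 (X w) + t.2).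
Proof.
rewrite expect_sum; last by move=> t; apply: integrableZlR; exact: integrable_cos_lin.
by apply: eq_bigr => t _; rewrite RintegralZl//; exact: integrable_cos_lin.
Qed.

(** F is the pointwise limit of the trigonometric polynomials given by [lipschitz_trig_approx], each
    of which is measurable along X; no sigma-field on the space of sequences enters. *)
Lemma measurable_lipschitz N (F : (nat -> R) -> R) (L : R) :
  (forall x y, `|F x - F y| <= L * \sum_(i < N) `|x i - y i|) ->
  measurable_fun setT (fun w => F (X w)).
Proof.
move=> FL; have /choice[h Hh] k : exists h, trig_poly N h /\
    forall x, `|F x - h x| <= k.+1%:R^-1 * (1 + \sum_(i < N) x i ^+ 2).
  by apply: lipschitz_trig_approx FL _ _; rewrite invr_gt0.
apply: (@measurable_fun_cvg _ _ _ _ (fun k => h k \o X)) => [k|w _].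
  by have [+ _] := Hh k; exact: measurable_trig.
apply/cvgrPdist_le => e e0; set C := 1 + \sum_(i < N) X w i ^+ 2.
have C0 : 0 < C by rewrite ltr_pwDl// sumr_ge0// => i _; exact: sqr_ge0.
near=> k; have [_ Hk] := Hh k; apply: le_trans (Hk (X w)) _.
rewrite -ler_pdivlMr//; apply/ltW; near: k.
exact: (near_infty_natSinv_lt (PosNum (divr_gt0 e0 C0))).
Unshelve. all: by end_near. Qed.

End trigonometric_polynomials_of_random_sequences.

Lemma expect_approx_le {d : measure_display} {Omega : measurableType d}
    {R : realType} (P : probability Omega R) (X : Omega -> nat -> R) N
    (F h : (nat -> R) -> R) (e L M C : R) :
  (forall i, measurable_fun setT (fun w => X w i)) ->
  (forall i, P.-integrable setT (EFin \o (fun w => X w i ^+ 2))) ->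
  (forall i, (i < N)%N -> \int[P]_w (X w i ^+ 2) <= C) ->
  (forall x y, `|F x - F y| <= L * \sum_(i < N) `|x i - y i|) ->
  (forall x, `|F x| <= M) -> 0 <= e -> trig_poly N h ->
  (forall x, `|F x - h x| <= e * (1 + \sum_(i < N) x i ^+ 2)) ->
  `|\int[P]_w F (X w) - \int[P]_w h (X w)| <= e * (1 + N%:R * `|C|).
Proof.
move=> mX iX XC FL FM e0 th Fh.
have iS : P.-integrable setT (EFin \o (fun w => 1 + \sum_(i < N) X w i ^+ 2)).
  apply: integrableDR; last exact: integrable_sumR.
  by apply: (@bounded_integrable _ _ _ _ _ 1) => // w; rewrite normr1.
have iF : P.-integrable setT (EFin \o (fun w => F (X w))).
  apply: (@bounded_integrable _ _ _ _ _ M) => [|w]; last exact: FM.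
  exact: (measurable_lipschitz mX FL).
have ih := integrable_trig P mX th.
apply: le_trans (expect_dist_le iF ih (integrableZlR e iS) (fun w => Fh (X w))) _.
rewrite RintegralZl// ler_wpM2l// RintegralD//; last 2 first.
- by apply: (@bounded_integrable _ _ _ _ _ 1) => // w; rewrite normr1.
- exact: integrable_sumR.
rewrite expect_cst expect_sum// lerD2l.
apply: (@le_trans _ _ (\sum_(i < N) C)); first by apply: ler_sum => i _; exact: XC.
by rewrite sumr_const card_ord -[leLHS]mulr_natl ler_wpM2l// ler_norm.
Qed.

(* The error made in replacing the test function by a trigonometric polynomial *)
(* is bounded by the second moments, uniformly in n.                           *)
Lemma cvg_lipschitz_of_cos (R : realType) (d d' : measure_display)
    (Omega : measurableType d) (P : probability Omega R)
    (S : measurableType d') (Q : probability S R) (N : nat)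
    (X : nat -> Omega -> nat -> R) (Z : S -> nat -> R) (C : R) :
  (forall n i, measurable_fun setT (fun w => X n w i)) ->
  (forall i, measurable_fun setT (fun w => Z w i)) ->
  (forall n i, P.-integrable setT (EFin \o (fun w => X n w i ^+ 2))) ->
  (forall i, Q.-integrable setT (EFin \o (fun w => Z w i ^+ 2))) ->
  (forall n i, (i < N)%N -> \int[P]_w (X n w i ^+ 2) <= C) ->
  (forall i, (i < N)%N -> \int[Q]_w (Z w i ^+ 2) <= C) ->
  (forall u b, \int[P]_w cos (lin N u (X n w) + b) @[n --> \oo] -->
               \int[Q]_w cos (lin N u (Z w) + b)) ->
  forall (F : (nat -> R) -> R) (L M : R),
  (forall x y, `|F x - F y| <= L * \sum_(i < N) `|x i - y i|) ->
  (forall x, `|F x| <= M) ->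
  \int[P]_w F (X n w) @[n --> \oo] --> \int[Q]_w F (Z w).
Proof.
move=> mX mZ iX iZ XC ZC cvg_cos F L M FL FM.
apply/cvgrPdist_le => e e0; set K := 1 + N%:R * `|C|.
have K0 : 0 < K by rewrite ltr_pwDl// mulr_ge0.
have d0 : 0 < e / 3 / K by rewrite !divr_gt0.
have [h [th Fh]] := lipschitz_trig_approx FL d0.
have cvg_h : \int[P]_w h (X n w) @[n --> \oo] --> \int[Q]_w h (Z w).
  have [s hE] := th.
  under eq_Rintegral do rewrite hE; rewrite expect_trig//.
  rewrite (_ : (fun n => _) = fun n => \sum_(t <- s) t.1.1 *
      \int[P]_w cos (lin N t.1.2 (X n w) + t.2)); last first.
    by apply/funext => n; under eq_Rintegral do rewrite hE; rewrite expect_trig.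
  apply: (@cvg_sum_seq _ R^o _ _ _ _ _ (fun t n => t.1.1 *
      \int[P]_w cos (lin N t.1.2 (X n w) + t.2))) => t.
  by apply: cvgMr; exact: cvg_cos.
have e3 : 0 < e / 3 by rewrite divr_gt0.
move/cvgrPdist_le : cvg_h => /(_ _ e3); apply: filterS => n Hn.
have HP := expect_approx_le (mX n) (iX n) (XC n) FL FM (ltW d0) th Fh.
have HQ := expect_approx_le mZ iZ ZC FL FM (ltW d0) th Fh.
rewrite divfK ?gt_eqF// in HP; rewrite divfK ?gt_eqF// in HQ.
move: HP HQ Hn; rewrite !ler_norml => /andP[p1 p2] /andP[q1 q2] /andP[h1 h2].
by apply/andP; split; lra.
Qed.

(** * Comparison of laws on the line *)

Section laws_on_the_line.
Context {R : realType}.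

(** Lipschitz substitute for the indicator of the open ray ]a, +oo[. It vanishes at a, hence
    converges to that indicator at every point, a included. *)
Definition ramp (a : R) (k : nat) (x : R) : R := Num.max 0 (Num.min 1 (k%:R * (x - a))).

Lemma ramp_itv a k x : 0 <= ramp a k x <= 1.
Proof.
rewrite /ramp; case: (lerP 1 (k%:R * (x - a))) => h1; first by rewrite max_r ?ler01// lexx.
by case: (lerP 0 (k%:R * (x - a))) => h2; rewrite ?lexx ?ler01// h2 ltW.
Qed.

Lemma ramp_lipschitz a k x y : `|ramp a k x - ramp a k y| <= k%:R * `|x - y|.
Proof.
have -> : k%:R * `|x - y| = `|k%:R * (x - a) - k%:R * (y - a)|.
  by rewrite -mulrBr normrM ger0_norm//; congr (_ * `|_|); ring.
rewrite /ramp; move: (k%:R * _) (k%:R * _) => u v.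
have H (w : R) : w <= Num.max 0 (Num.min 1 w) /\ Num.max 0 (Num.min 1 w) = 0 \/
   Num.max 0 (Num.min 1 w) <= w /\ Num.max 0 (Num.min 1 w) = 1 \/
   Num.max 0 (Num.min 1 w) = w /\ 0 <= w <= 1.
  case: (lerP 1 w) => h1; first by right; left; rewrite max_r ?ler01.
  case: (lerP 0 w) => h2; last by left; rewrite ltW.
  by right; right; split=> //; rewrite ?h2 ?(ltW h1).
rewrite ler_norml; have := H u; have := H v.
have := ler_norm (u - v); have := ler_norm (v - u); rewrite (distrC v u).
move: (Num.max 0 (Num.min 1 u)) (Num.max 0 (Num.min 1 v)) `|u - v| => p q r.
move=> ? ? [[? ?]|[[? ?]|[? /andP[? ?]]]] [[? ?]|[[? ?]|[? /andP[? ?]]]];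
  by apply/andP; split; lra.
Qed.

Lemma ramp_cvg (a x : R) : ramp a k x @[k --> \oo] --> (\1_(`]a, +oo[) x : R).
Proof.
rewrite indicE; have [ax|xa] := ltP a x; last first.
  rewrite memNset/=; last by rewrite in_itv/= andbT; apply/negP; rewrite -leNgt.
  apply: cvg_near_cst; apply: nearW => k; rewrite /ramp min_r ?max_l//.
    by rewrite mulr_ge0_le0// subr_le0.
  by rewrite (@le_trans _ _ 0)// mulr_ge0_le0// subr_le0.
rewrite mem_set/= ?in_itv/= ?andbT//; apply: cvg_near_cst.
near=> k; rewrite /ramp min_l ?max_r// -ler_pdivrMr ?subr_gt0// div1r.
by near: k; exact: nbhs_infty_ger.
Unshelve. all: by end_near. Qed.

Lemma measurable_ramp a k : measurable_fun setT (ramp a k).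
Proof.
apply: measurable_maxr => //; apply: measurable_minr => //.
by apply: measurable_funM => //; exact: measurable_funB.
Qed.

Section comparison_of_laws.
Context {d d' : measure_display} {Omega : measurableType d} {Omega' : measurableType d'}.
Variables (P : probability Omega R) (P' : probability Omega' R).
Variables (A : Omega -> R) (A' : Omega' -> R) (E : set Omega) (c : R).
Hypotheses (mA : measurable_fun setT A) (mA' : measurable_fun setT A').
Hypotheses (mE : measurable E) (c0 : 0 <= c).

Let mpre d1 (T1 : measurableType d1) (X : T1 -> R) (B : set R) :
  measurable_fun setT X -> measurable B -> measurable (X @^-1` B).
Proof. by move=> mX mB; rewrite -[X in measurable X]setTI; exact: mX. Qed.

(** Both sides are finite measures in B, and the rays generate the Borel sets and are stable under
    intersection. With E the whole space and c = 1 this identifies a law; with c the probability of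
    E it expresses that A is independent of E. *)
Lemma law_rays :
  (forall a, P (A @^-1` `]a, +oo[ `&` E) = (c%:E * P' (A' @^-1` `]a, +oo[))%E) ->
  forall B, measurable B -> P (A @^-1` B `&` E) = (c%:E * P' (A' @^-1` B))%E.
Proof.
move=> H; pose m1 : {measure set _ -> \bar R} := pushforward (mrestr P mE) A.
pose m2 : {measure set _ -> \bar R} := mscale (NngNum c0) (pushforward P' A').
suff: forall B : set R, measurable B -> m1 mA B = m2 mA' B by [].
apply: (@measure_unique _ R R (@RGenOInfty.G R)
  (fun n => `](- n%:R), +oo[%classic) (RGenOInfty.measurableE R)).
- move=> _ _ [x ->] [y ->]; exists (Num.max x y).
  by apply/seteqP; split => z /=; rewrite !in_itv/= !andbT gt_max => /andP.
- by move=> n; exists (- n%:R).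
- apply/seteqP; split => // x _; exists (Num.truncn (- x)).+1 => //=.
  by rewrite in_itv/= andbT ltrNl truncnS_gt.
- by move=> _ [a ->]; exact: H.
- move=> k; rewrite /m1/= /pushforward /mrestr.
  apply: (@le_lt_trans _ _ 1%E); last exact: ltry.
  by apply: probability_le1; apply: measurableI => //; apply: mpre => //; exact: measurable_itv.
Qed.

(** The ramps are admissible test functions and tend boundedly to indicators of rays, which reduces
    the claim to [law_rays]. *)
Lemma law_determined :
  (forall (f : R -> R) L, (forall x, 0 <= f x <= 1) -> measurable_fun setT f ->
    (forall x y, `|f x - f y| <= L * `|x - y|) ->
    \int[P]_w (f (A w) * \1_E w) = c * \int[P']_w f (A' w)) ->
  forall B, measurable B -> P (A @^-1` B `&` E) = (c%:E * P' (A' @^-1` B))%E.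
Proof.
move=> H; apply: law_rays => a; set B := `]a, +oo[%classic.
have mB : measurable B by exact: measurable_itv.
have indE (w : Omega) : \1_(A @^-1` B `&` E) w = \1_B (A w) * \1_E w :> R.
  by rewrite !indicE in_setI -natrM mulnb; congr (nat_of_bool (_ && _))%:R;
    apply/idP/idP => /[!inE].
have L1 : \int[P]_w (ramp a k (A w) * \1_E w) @[k --> \oo] -->
          \int[P]_w (\1_B (A w) * \1_E w).
  apply: (@bounded_cvg_Rintegral _ _ _ P _ _ 1) => [k|k w|w].
  - apply: measurable_funM; last exact: measurable_indic.
    exact: measurableT_comp (measurable_ramp a k) mA.
  - have /andP[r0 r1] := ramp_itv a k (A w).
    rewrite ger0_norm ?mulr_ge0// -[leRHS]mulr1.
    by apply: ler_pM => //; rewrite indicE; case: (_ \in _); rewrite ?ler01.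
  - by apply: cvgMl; exact: ramp_cvg.
have L2 : c * \int[P']_w ramp a k (A' w) @[k --> \oo] -->
          c * \int[P']_w \1_B (A' w).
  apply: cvgMr; apply: (@bounded_cvg_Rintegral _ _ _ P' _ _ 1) => [k|k w|w].
  - exact: measurableT_comp (measurable_ramp a k) mA'.
  - by have /andP[r0 r1] := ramp_itv a k (A' w); rewrite ger0_norm.
  - exact: ramp_cvg.
have L12 : \int[P]_w (\1_B (A w) * \1_E w) = c * \int[P']_w \1_B (A' w).
  suff EL : (fun k => \int[P]_w (ramp a k (A w) * \1_E w)) =
           (fun k => c * \int[P']_w ramp a k (A' w)).
    by rewrite EL in L1; exact: (cvg_unique (@Rhausdorff R) L1 L2).
  apply/funext => k; apply: (H (ramp a k) k%:R).
  - exact: ramp_itv.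
  - exact: measurable_ramp.
  - exact: ramp_lipschitz.
have -> : P (A @^-1` B `&` E) = (\int[P]_w (\1_B (A w) * \1_E w))%:E.
  under eq_Rintegral do rewrite -indE.
  rewrite /Rintegral integral_indic ?setIT//; last by apply: measurableI => //; exact: mpre.
  by rewrite fineK// fin_num_measure//; apply: measurableI => //; exact: mpre.
rewrite L12 EFinM; congr (_ * _)%E.
rewrite /Rintegral (_ : (fun w => (\1_B (A' w))%:E) = (fun w => (\1_(A' @^-1` B) w)%:E))//.
by rewrite integral_indic ?setIT ?fineK// ?fin_num_measure//; exact: mpre.
Qed.

End comparison_of_laws.

End laws_on_the_line.

(** * Sums of independent copies *)

(** With h = x / 2, the left-hand side is 2 (h^2 - sin^2 h) = 2 (h - sin h) (h + sin h); the factors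
    are at most h^2 and |x|. *)
Lemma cosB_le3 {R : realType} (x : R) : `|cos x - (1 - x ^+ 2 / 2)| <= `|x| ^+ 3 / 2.
Proof.
have -> : cos x - (1 - x ^+ 2 / 2) =
    2 * ((x / 2 - sin (x / 2)) * (x / 2 + sin (x / 2))).
  have -> : cos x = cos ((x / 2) *+ 2) by congr cos; rewrite -mulr_natr; field.
  by rewrite cos_mulr2n cos2sin2; field.
have := sinB_le2 (x / 2); rewrite distrC => H1.
have H2 : `|x / 2 + sin (x / 2)| <= `|x|.
  apply: le_trans (ler_normD _ _) _; have := sin_le_norm (x / 2).
  by rewrite normrM (@ger0_norm _ 2^-1) ?invr_ge0//; lra.
rewrite !normrM ger0_norm//.
apply: le_trans (ler_wpM2l _ (ler_pM _ _ H1 H2)) _ => //.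
have -> : (x / 2) ^+ 2 = `|x| ^+ 2 / 4 by rewrite real_normK ?num_real//; field.
by rewrite [in leRHS]exprSr; lra.
Qed.

Section rotation_recursion.
Context {R : realType}.
Variables (a b : nat -> R) (c s q : R).
Hypotheses (a0 : a 0%N = 1) (b0 : b 0%N = 0).
Hypotheses (aS : forall k, a k.+1 = a k * c - b k * s).
Hypotheses (bS : forall k, b k.+1 = a k * s + b k * c).
Hypotheses (a1 : forall k, `|a k| <= 1) (b1 : forall k, `|b k| <= 1).
Hypotheses (c1 : `|c| <= 1) (q1 : `|q| <= 1).

(** The hypotheses say that a n + i b n is the n-th power of c + i s. The imaginary part grows by at
    most |s| at each multiplication. *)
Lemma rotation_sin n : `|b n| <= n%:R * `|s|.
Proof.
elim: n => [|n IH]; first by rewrite b0 normr0 mul0r.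
rewrite bS -natr1 mulrDl mul1r; apply: le_trans (ler_normD _ _) _.
rewrite !normrM addrC lerD//; last by rewrite ler_piMl.
by apply: le_trans IH; rewrite ler_piMr.
Qed.

(** Comparison of the real part of (c + i s)^n with the power of a real number q: each factor
    replaced costs at most |c - q| + |s|. *)
Lemma rotation_cos n : `|a n - q ^+ n| <= n%:R * (`|c - q| + `|s|).
Proof.
elim: n => [|n IH]; first by rewrite a0 expr0 subrr normr0 mul0r.
have -> : a n.+1 - q ^+ n.+1 = (a n - q ^+ n) * q + (a n * (c - q) - b n * s).
  by rewrite aS exprSr; ring.
rewrite -natr1 [leRHS]mulrDl mul1r; apply: le_trans (ler_normD _ _) _; apply: lerD.
  by apply: le_trans IH; rewrite normrM ler_piMr.
by apply: le_trans (ler_normB _ _) _; rewrite !normrM lerD// ler_piMl.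
Qed.

End rotation_recursion.

Section central_limit_theorem.
Context {R : realType} {d0 d d' : measure_display}.
Context {Omega0 : measurableType d0} {Omega : measurableType d}
        {E : measurableType d'}.
Variables (P0 : probability Omega0 R) (T : {RV P0 >-> E}).
Variables (P : probability Omega R) (T_ : nat -> {RV P >-> E}).
Hypotheses (T_indep : mutually_independent T_).
Hypotheses (T_law : forall i, same_law (T_ i) T).

Let mT_ i (B : set E) : measurable B -> measurable (T_ i @^-1` B).
Proof. by move=> mB; rewrite -[X in measurable X]setTI; exact: measurable_funP. Qed.

(* g is decorrelated from every event on T_k, T_(k+1), ...                    *)
Definition past k (g : Omega -> R) := [/\ measurable_fun setT g,
  exists M, forall w, `|g w| <= M &
  forall (J : {fset nat}) (B : nat -> set E), (forall i, i \in J -> (k <= i)%N) ->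
    (forall i, measurable (B i)) ->
    \int[P]_w (g w * \1_(\bigcap_(i in [set` J]) (T_ i @^-1` B i)) w) =
    \int[P]_w g w * \prod_(i <- J) fine (P (T_ i @^-1` B i))].

Let mcap (J : {fset nat}) (B : nat -> set E) : (forall i, measurable (B i)) ->
  measurable (\bigcap_(i in [set` J]) (T_ i @^-1` B i)).
Proof.
move=> mB; apply: fin_bigcap_measurable; first exact: finite_fset.
by move=> i _; exact: mT_.
Qed.

Lemma past_integrable k g : past k g -> P.-integrable setT (EFin \o g).
Proof. by move=> [mg [M gM] _]; exact: bounded_integrable gM. Qed.

Lemma past_integrableM k g (A : set Omega) : past k g -> measurable A ->
  P.-integrable setT (EFin \o (fun w => g w * \1_A w)).
Proof.
move=> [mg [M gM] _] mA; apply: (@bounded_integrable _ _ _ _ _ M) => [|w].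
  by apply: measurable_funM => //; exact: measurable_indic.
rewrite normrM; apply: le_trans (gM w).
by rewrite ler_piMr// indicE; case: (_ \in _); rewrite ?normr1 ?normr0.
Qed.

(** For the constant 1, the decorrelation required by [past] is mutual independence itself; the
    other functions are built from this one. *)
Lemma past_cst : past 0 (fun=> 1).
Proof.
split=> // [|J B _ mB]; first by exists 1 => w; rewrite normr1.
under eq_Rintegral do rewrite mul1r.
rewrite expect_cst mul1r /Rintegral integral_indic ?setIT//; last exact: mcap.
rewrite [X in fine X](T_indep _ mB).
rewrite (eq_bigr (fun i => (fine (P (T_ i @^-1` B i)))%:E)).
  by rewrite prodEFin.
by move=> i _; rewrite fineK// fin_num_measure//; exact: mT_.
Qed.

Lemma past_lin k g1 g2 (a1 a2 : R) : past k g1 -> past k g2 ->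
  past k (fun w => a1 * g1 w + a2 * g2 w).
Proof.
move=> p1 p2; have := p1; have := p2.
move=> [mg2 [M2 gM2] H2] [mg1 [M1 gM1] H1]; split.
- by apply: measurable_funD; apply: measurable_funM.
- exists (`|a1| * M1 + `|a2| * M2) => w; apply: le_trans (ler_normD _ _) _.
  by rewrite !normrM lerD// ler_wpM2l.
- move=> J B JB mB; under eq_Rintegral do rewrite mulrDl -!mulrA.
  have mI := mcap J mB.
  rewrite RintegralD//; last 2 first.
  + by apply: integrableZlR; exact: past_integrableM p1 _.
  + by apply: integrableZlR; exact: past_integrableM p2 _.
  rewrite !RintegralZl//; last 2 first.
  + exact: past_integrableM p2 _.
  + exact: past_integrableM p1 _.
  rewrite H1// H2// RintegralD//; last 2 first.
  + by apply: integrableZlR; exact: past_integrable p1.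
  + by apply: integrableZlR; exact: past_integrable p2.
  rewrite !RintegralZl//; last 2 first.
  + exact: past_integrable p2.
  + exact: past_integrable p1.
  by rewrite mulrDl !mulrA.
Qed.

(** The event on T_k is absorbed into the finite set of indices as k added to J, to which the
    hypothesis on g applies since J lies beyond k. *)
Lemma past_event k g (A : set E) : past k g -> measurable A ->
  past k.+1 (fun w => g w * \1_(T_ k @^-1` A) w) /\
  \int[P]_w (g w * \1_(T_ k @^-1` A) w) = \int[P]_w g w * fine (P (T_ k @^-1` A)).
Proof.
move=> [mg [M gM] H] mA.
have Hk : \int[P]_w (g w * \1_(T_ k @^-1` A) w) = \int[P]_w g w * fine (P (T_ k @^-1` A)).
  have := H [fset k]%fset (fun=> A); rewrite big_seq_fset1 set_fset1 bigcap_set1.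
  by apply=> // i /fset1P ->.
split=> //; split.
- by apply: measurable_funM => //; apply: measurable_indic; exact: mT_.
- exists M => w; rewrite normrM; apply: le_trans (gM w).
  by rewrite ler_piMr// indicE; case: (_ \in _); rewrite ?normr1 ?normr0.
- move=> J B Jk mB; rewrite Hk.
  pose B' i := if i == k then A else B i.
  have kJ : k \notin J by apply/negP => /Jk; rewrite ltnn.
  have B'E i : i \in J -> B' i = B i.
    by move=> iJ; rewrite /B' (negbTE (memPn kJ _ iJ)).
  have := H (k |` J)%fset B'; rewrite big_fsetU1//= /B' eqxx => {}H.
  transitivity (\int[P]_w (g w *
     \1_(\bigcap_(i in [set` (k |` J)%fset]) (T_ i @^-1` B' i)) w)).
    apply: eq_Rintegral => w _; rewrite -mulrA; congr (_ * _).
    rewrite !indicE -natrM mulnb; congr (nat_of_bool _)%:R.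
    apply/andP/idP => [[/set_mem wA /set_mem wB]|/set_mem wB].
      apply/mem_set => i /=; rewrite !inE => /orP[/eqP ->|iJ].
        by rewrite /B' eqxx.
      by rewrite B'E//; exact: wB.
    split; apply/mem_set.
      by have := wB k; rewrite /= /B' eqxx; apply; rewrite !inE eqxx.
    by move=> i iJ; rewrite -B'E//; apply: wB; apply/fset1UP; right.
  rewrite H.
  + rewrite mulrA; congr (_ * _); rewrite big_seq [RHS]big_seq.
    by apply: eq_bigr => i iJ; rewrite (negbTE (memPn kJ _ iJ)).
  + by move=> i; rewrite !inE => /orP[/eqP ->//|/Jk/ltnW].
  + by move=> i; case: ifP.
Qed.

Lemma past_sum k I (s : seq I) (g : I -> Omega -> R) :
  (forall i, past k (g i)) -> past k (fun w => \sum_(i <- s) g i w).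
Proof.
move=> pg; elim: s => [|i s IH].
  under eq_fun do rewrite big_nil.
  split=> //; first by exists 0 => w; rewrite normr0.
  move=> J B _ _; under eq_Rintegral do rewrite mul0r.
  by rewrite expect_cst mul0r.
under eq_fun do rewrite big_cons -[g i _]mul1r -[\sum_(_ <- _) _]mul1r.
exact: past_lin.
Qed.

Lemma finite_range_decomp (phi : E -> R) : finite_set (range phi) ->
  exists ys : seq R, forall x, phi x = \sum_(y <- ys) y * \1_(phi @^-1` [set y]) x.
Proof.
move=> fphi; exists (fset_set (range phi)) => x.
rewrite (bigD1_seq (phi x)) ?fset_uniq//=; last first.
  by rewrite in_fset_set// inE; exists x.
rewrite indicE mem_set// mulr1 big1 ?addr0// => y yx.
by rewrite indicE memNset ?mulr0//= => xy; rewrite xy eqxx in yx.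
Qed.

(** A function of finite range is a finite combination of indicators, so [past_event] extends by
    linearity. Finite range is enough here: the functions that occur depend on finitely many
    vertices of a tree. *)
Lemma past_fun k g (phi : E -> R) : past k g -> measurable_fun setT phi ->
  finite_set (range phi) ->
  past k.+1 (fun w => g w * phi (T_ k w)) /\
  \int[P]_w (g w * phi (T_ k w)) = \int[P]_w g w * \int[P0]_w phi (T w).
Proof.
move=> pg mphi /finite_range_decomp[ys phiE].
have mA y : measurable (phi @^-1` [set y]).
  by rewrite -[X in measurable X]setTI; exact: mphi.
have pgA y := past_event pg (mA y).
(* The summand with coefficient 0 gives each term the two-term shape of [past_lin]. *)
have gphiE : (fun w => g w * phi (T_ k w)) = (fun w =>
    \sum_(y <- ys) (y * (g w * \1_(T_ k @^-1` (phi @^-1` [set y])) w) +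
                    0 * (g w * \1_(T_ k @^-1` (phi @^-1` [set y])) w))).
  apply/funext => w; rewrite phiE big_distrr/=; apply: eq_bigr => y _.
  by rewrite mul0r addr0 mulrCA.
have pS y : past k.+1 (fun w => y * (g w * \1_(T_ k @^-1` (phi @^-1` [set y])) w) +
                    0 * (g w * \1_(T_ k @^-1` (phi @^-1` [set y])) w)).
  by apply: past_lin; have [] := pgA y.
rewrite gphiE; split; first exact: past_sum.
rewrite expect_sum; last by move=> y; exact: past_integrable (pS y).
have -> : \int[P0]_w phi (T w) = \int[P0]_w
    (\sum_(y <- ys) y * \1_(phi @^-1` [set y]) (T w)).
  by apply: eq_Rintegral => w _; rewrite phiE.
have mTA y : measurable (T @^-1` (phi @^-1` [set y])).
  by rewrite -[X in measurable X]setTI; exact: measurable_funP.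
have iT y : P0.-integrable setT (EFin \o (fun w => \1_(T @^-1` (phi @^-1` [set y])) w)).
  by apply: (@bounded_integrable _ _ _ _ _ 1) => [|w];
    [exact: measurable_indic|rewrite indicE; case: (_ \in _); rewrite ?normr1 ?normr0].
rewrite expect_sum; last by move=> y; exact: integrableZlR (iT y).
rewrite big_distrr/=; apply: eq_bigr => y _.
under eq_Rintegral do rewrite mul0r addr0.
rewrite !RintegralZl//; [|exact: iT|by have [/past_integrable + _] := pgA y; exact].
have [_ ->] := pgA y; rewrite mulrCA; congr (_ * (_ * _)).
have -> : P (T_ k @^-1` (phi @^-1` [set y])) = P0 (T @^-1` (phi @^-1` [set y])).
  exact: T_law.
rewrite /Rintegral (_ : (fun w => _) = (EFin \o \1_(T @^-1` (phi @^-1` [set y]))))//.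
by rewrite integral_indic ?setIT.
Qed.

Lemma finite_range_comp (phi : E -> R) (h : R -> R) :
  finite_set (range phi) -> finite_set (range (fun x => h (phi x))).
Proof.
move=> fphi; rewrite (_ : range _ = h @` (range phi)); last first.
  by rewrite image_comp.
exact: finite_image.
Qed.

Section sums.
Variable f : E -> R.
Hypotheses (mf : measurable_fun setT f) (ff : finite_set (range f)).

Let S k w := \sum_(j < k) f (T_ j w).

Let mcosf : measurable_fun setT (fun x => cos (f x)).
Proof. exact: measurable_cos. Qed.

Let msinf : measurable_fun setT (fun x => sin (f x)).
Proof. exact: measurableT_comp (continuous_measurable_fun (@continuous_sin R)) mf. Qed.

Lemma past_cos_sin k : past k (fun w => cos (S k w)) /\ past k (fun w => sin (S k w)).
Proof.
elim: k => [|k [pc ps]].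
  split.
    rewrite (_ : (fun w => _) = fun=> 1); first exact: past_cst.
    by apply/funext => w; rewrite /S big_ord0 cos0.
  rewrite (_ : (fun w => _) = fun=> 0 * 1 + 0 * 1).
    by apply: past_lin; exact: past_cst.
  by apply/funext => w; rewrite /S big_ord0 sin0 mul0r addr0.
have fc := finite_range_comp (@cos R) ff.
have fs := finite_range_comp (@sin R) ff.
split.
- rewrite (_ : (fun w => _) = fun w => 1 * (cos (S k w) * cos (f (T_ k w))) +
      (-1) * (sin (S k w) * sin (f (T_ k w)))).
    by apply: past_lin; [have [] := past_fun pc mcosf fc|have [] := past_fun ps msinf fs].
  by apply/funext => w; rewrite /S big_ord_recr/= cosD mul1r mulN1r.
- rewrite (_ : (fun w => _) = fun w => 1 * (sin (S k w) * cos (f (T_ k w))) +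
      1 * (cos (S k w) * sin (f (T_ k w)))).
    by apply: past_lin; [have [] := past_fun ps mcosf fc|have [] := past_fun pc msinf fs].
  by apply/funext => w; rewrite /S big_ord_recr/= sinD !mul1r.
Qed.

(** By the addition formulas and the decorrelation of S_k from T_k, the expectations of cos S_k and
    sin S_k satisfy the recursion of a rotation: they are the real and imaginary parts of (E exp (i
    f(T)))^k. *)
Lemma cos_sum_bound (q : R) n : `|q| <= 1 ->
  `|\int[P]_w cos (S n w) - q ^+ n| <=
    n%:R * (`|\int[P0]_w cos (f (T w)) - q| + `|\int[P0]_w sin (f (T w))|) /\
  `|\int[P]_w sin (S n w)| <= n%:R * `|\int[P0]_w sin (f (T w))|.
Proof.
move=> q1.
have fc := finite_range_comp (@cos R) ff.
have fs := finite_range_comp (@sin R) ff.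
have ic k := past_integrable (past_cos_sin k).1.
have isn k := past_integrable (past_cos_sin k).2.
have bnd1 d1 (O1 : measurableType d1) (Q : probability O1 R) (g : O1 -> R) :
    Q.-integrable setT (EFin \o g) -> (forall w, `|g w| <= 1) -> `|\int[Q]_w g w| <= 1.
  move=> ig g1; have i0 : Q.-integrable setT (EFin \o (fun=> 0 : R)).
    by apply: (@bounded_integrable _ _ _ _ _ 0) => // w; rewrite normr0.
  have i1 : Q.-integrable setT (EFin \o (fun=> 1 : R)).
    by apply: (@bounded_integrable _ _ _ _ _ 1) => // w; rewrite normr1.
  have := expect_dist_le ig i0 i1; rewrite !expect_cst subr0; apply => w.
  by rewrite subr0.
pose a k := \int[P]_w cos (S k w); pose b k := \int[P]_w sin (S k w).
have a0 : a 0%N = 1.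
  by rewrite /a /S; under eq_Rintegral do rewrite big_ord0 cos0; rewrite expect_cst.
have b0 : b 0%N = 0.
  by rewrite /b /S; under eq_Rintegral do rewrite big_ord0 sin0; rewrite expect_cst.
set c := \int[P0]_w cos (f (T w)); set s := \int[P0]_w sin (f (T w)).
have aS k : a k.+1 = a k * c - b k * s.
  have [p1 E1] := past_fun (past_cos_sin k).1 mcosf fc.
  have [p2 E2] := past_fun (past_cos_sin k).2 msinf fs.
  rewrite /a /b /c /s -E1 -E2 -RintegralB//; try exact: past_integrable p1;
    try exact: past_integrable p2.
  by apply: eq_Rintegral => w _; rewrite /S big_ord_recr/= cosD.
have bS k : b k.+1 = a k * s + b k * c.
  have [p1 E1] := past_fun (past_cos_sin k).1 msinf fs.
  have [p2 E2] := past_fun (past_cos_sin k).2 mcosf fc.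
  rewrite /a /b /c /s -E1 -E2 -RintegralD//; try exact: past_integrable p1;
    try exact: past_integrable p2.
  by apply: eq_Rintegral => w _; rewrite /S big_ord_recr/= sinD addrC.
have c1 : `|c| <= 1.
  apply: bnd1 => [|w]; last exact: cos_max.
  apply: (@bounded_integrable _ _ _ _ _ 1) => [|w]; last exact: cos_max.
  exact: measurableT_comp mcosf (measurable_funP T).
have a1 k : `|a k| <= 1 by apply: bnd1 => // w; exact: cos_max.
have b1 k : `|b k| <= 1 by apply: bnd1 => // w; exact: sin_max.
split; first exact: (rotation_cos a0 aS a1 b1 q1).
exact: (rotation_sin b0 bS a1 c1).
Qed.

End sums.

End central_limit_theorem.

Lemma invsqrt_cvg0 {R : realType} (K e : R) : 0 < e ->
  \forall n \near \oo, (0 < n)%N /\ K * (Num.sqrt n%:R)^-1 <= e.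
Proof.
move=> e0; near=> n.
have n0 : (0 < n)%N by near: n; exact: nbhs_infty_gt.
have s0 : 0 < Num.sqrt n%:R :> R by rewrite sqrtr_gt0 ltr0n.
split=> //; rewrite ler_pdivrMr// -ler_pdivrMl//.
apply: le_trans (ler_norm _) _; rewrite -sqrtr_sqr ler_sqrt ?ler0n//.
by near: n; exact: nbhs_infty_ger.
Unshelve. all: by end_near. Qed.

(** With t = 1 / sqrt n, the expectation of exp (i t f(T)) differs from q = exp (- t^2 s2 / 2) by
    O(t^3), where s2 is the variance of f(T). Since n t^2 = 1, the n-th powers differ by O(t) and
    q^n = exp (- s2 / 2). The phase b is split off by the addition formula. *)
Lemma clt_cos {R : realType} {d0 d d' : measure_display}
    {Omega0 : measurableType d0} {Omega : measurableType d}
    {E : measurableType d'} (P0 : probability Omega0 R) (T : {RV P0 >-> E})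
    (P : probability Omega R) (T_ : nat -> {RV P >-> E}) (f : E -> R) (b : R) :
  mutually_independent T_ -> (forall i, same_law (T_ i) T) ->
  measurable_fun setT f -> finite_set (range f) -> \int[P0]_w f (T w) = 0 ->
  \int[P]_w cos ((Num.sqrt n%:R)^-1 * (\sum_(j < n) f (T_ j w)) + b)
    @[n --> \oo] --> cos b * expR (- (\int[P0]_w (f (T w) ^+ 2) / 2)).
Proof.
move=> T_indep T_law mf ff f0.
have [K [K0 fK]] : exists K, 0 <= K /\ forall x, `|f x| <= K.
  exists (\sum_(y <- fset_set (range f)) `|y|); split; first exact: sumr_ge0.
  move=> x; rewrite (bigD1_seq (f x)) ?fset_uniq//=; last first.
    by rewrite in_fset_set// inE; exists x.
  by rewrite lerDl sumr_ge0.
set s2 := \int[P0]_w (f (T w) ^+ 2).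
have mfT : measurable_fun setT (fun w => f (T w)) by exact: measurableT_comp.
have iT : P0.-integrable setT (EFin \o (fun w => f (T w))).
  by apply: (@bounded_integrable _ _ _ _ _ K).
have f2K w : f (T w) ^+ 2 <= K ^+ 2.
  by rewrite -(real_normK (num_real (f _))) lerXn2r ?nnegrE.
have iT2 : P0.-integrable setT (EFin \o (fun w => f (T w) ^+ 2)).
  apply: (@bounded_integrable _ _ _ _ _ (K ^+ 2)) => [|w].
    exact: measurable_funX.
  by rewrite ger0_norm ?sqr_ge0.
have icst (a : R) : P0.-integrable setT (EFin \o (fun=> a)).
  by apply: (@bounded_integrable _ _ _ _ _ `|a|).
have s20 : 0 <= s2 by apply: Rintegral_ge0 => w _; exact: sqr_ge0.
have s2K : s2 <= K ^+ 2.
  by rewrite -(expect_cst P0 (K ^+ 2)); apply: le_Rintegral.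
apply/cvgrPdist_le => e e0.
(* The errors for one variable are three times t^3 K^3 / 2 (cosine once, sine twice) and (t^2 K^2 /
   2)^2. Multiplied by n = t^-2, they stay below (2 K^3 + K^4) t because t is at most 1. *)
apply: filterS (invsqrt_cvg0 (2 * K ^+ 3 + K ^+ 4) e0) => n [n0].
set t := (Num.sqrt _)^-1 => te.
have t0 : 0 < t by rewrite invr_gt0 sqrtr_gt0 ltr0n.
have nt2 : n%:R * t ^+ 2 = 1.
  by rewrite exprVn sqr_sqrtr// divff// gt_eqF// ltr0n.
have t1 : t <= 1.
  by rewrite invf_le1 ?sqrtr_gt0 ?ltr0n// -{1}sqrtr1 ler_sqrt ?ler0n// ler1n.
apply: le_trans te.
have mtf : measurable_fun setT (fun x => t * f x) by exact: measurable_funM.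
have ftf : finite_set (range (fun x => t * f x)).
  exact: (finite_range_comp ( *%R t) ff).
pose q := expR (- (t ^+ 2 * s2 / 2)).
have q1 : `|q| <= 1.
  rewrite ger0_norm ?expR_ge0// -expR0 ler_expR oppr_le0.
  by rewrite divr_ge0// mulr_ge0// sqr_ge0.
have [Hc Hs] := cos_sum_bound T_indep T_law mtf ftf n q1.
have SE w : \sum_(j < n) t * f (T_ j w) = t * \sum_(j < n) f (T_ j w).
  by rewrite big_distrr.
set A := \int[P]_w cos _ in Hc; set B := \int[P]_w sin _ in Hs.
have qn : q ^+ n = expR (- (s2 / 2)).
  rewrite /q -expRM_natl; congr expR; rewrite mulrN; congr (- _).
  by rewrite -mulrA (mulrA n%:R) nt2 mul1r.
have mX (g : Omega -> R) : measurable_fun setT g -> (forall w, `|g w| <= 1) ->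
    P.-integrable setT (EFin \o g).
  by move=> mg; apply: bounded_integrable.
have mS : measurable_fun setT (fun w => \sum_(j < n) t * f (T_ j w)).
  by apply: measurable_sum => j; apply: measurable_funM => //; exact: measurableT_comp.
have -> : \int[P]_w cos (t * (\sum_(j < n) f (T_ j w)) + b) = A * cos b - B * sin b.
  have i1 : P.-integrable setT (EFin \o (fun w => cos (\sum_(j < n) t * f (T_ j w)))).
    by apply: mX => [|w]; [exact: measurable_cos|exact: cos_max].
  have i2 : P.-integrable setT (EFin \o (fun w => sin (\sum_(j < n) t * f (T_ j w)))).
    apply: mX => [|w]; last exact: sin_max.
    exact: measurableT_comp (continuous_measurable_fun (@continuous_sin R)) mS.
  rewrite /A /B -!RintegralZr// -RintegralB//; last 2 first.
  - by apply: eq_integrable (integrableZlR (cos b) i1) => // w _; rewrite /= mulrC.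
  - by apply: eq_integrable (integrableZlR (sin b) i2) => // w _; rewrite /= mulrC.
  by apply: eq_Rintegral => w _; rewrite -SE cosD.
rewrite -qn.
have -> : cos b * q ^+ n - (A * cos b - B * sin b) =
    - (cos b * (A - q ^+ n)) + sin b * B by ring.
apply: le_trans (ler_normD _ _) _; rewrite normrN !normrM.
apply: (@le_trans _ _ (`|A - q ^+ n| + `|B|)).
  by apply: lerD; rewrite ler_piMl// ?cos_max// sin_max.
apply: le_trans (lerD Hc Hs) _.
have Hs' : `|\int[P0]_w sin (t * f (T w))| <= t ^+ 3 * (K ^+ 3 / 2).
  have E0 : \int[P0]_w (t * f (T w)) = 0 by rewrite RintegralZl// f0 mulr0.
  have := @expect_dist_le _ _ _ P0 (fun w => sin (t * f (T w))) (fun w => t * f (T w))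
    (fun=> t ^+ 3 * (K ^+ 3 / 2)).
  rewrite E0 subr0 expect_cst; apply => //.
  - apply: (@bounded_integrable _ _ _ _ _ 1) => [|w]; last exact: sin_max.
    apply: measurableT_comp (continuous_measurable_fun (@continuous_sin R)) _.
    exact: measurable_funM.
  - exact: integrableZlR.
  - move=> w; apply: le_trans (sinB_le3 _) _; rewrite mulrA ler_pM2r ?invr_gt0//.
    rewrite normrM exprMn (ger0_norm (ltW t0)) ler_wpM2l ?exprn_ge0 ?(ltW t0)//.
    by rewrite lerXn2r ?nnegrE.
have Hc' : `|\int[P0]_w cos (t * f (T w)) - q| <=
    t ^+ 3 * (K ^+ 3 / 2) + (t ^+ 2 * K ^+ 2 / 2) ^+ 2.
  rewrite -(subrK (1 - t ^+ 2 * s2 / 2) (\int[P0]_w _)) -addrA.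
  apply: le_trans (ler_normD _ _) _; apply: lerD; last first.
    rewrite distrC; apply: le_trans (expRN_le2 _) _.
      by rewrite divr_ge0// mulr_ge0// sqr_ge0.
    rewrite lerXn2r ?nnegrE ?divr_ge0 ?mulr_ge0 ?sqr_ge0 ?(ltW t0)//.
    by rewrite ler_pM2r ?invr_gt0// ler_pM2l// exprn_gt0.
  have -> : 1 - t ^+ 2 * s2 / 2 = \int[P0]_w (1 - (t * f (T w)) ^+ 2 / 2).
    under eq_Rintegral do rewrite exprMn mulrAC.
    rewrite RintegralB//; last exact: integrableZlR.
    by rewrite expect_cst RintegralZl// mulrAC.
  rewrite -[leRHS](expect_cst P0).
  apply: expect_dist_le => //.
  - apply: (@bounded_integrable _ _ _ _ _ 1) => [|w]; last exact: cos_max.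
    by apply: measurable_cos; exact: measurable_funM.
  - apply: eq_integrable (integrableDR (icst 1) (integrableZlR (- (t ^+ 2 / 2)) iT2)) => //.
    by move=> w _; rewrite /= exprMn mulNr mulrAC.
  - move=> w; apply: le_trans (cosB_le3 _) _; rewrite mulrA ler_pM2r ?invr_gt0//.
    rewrite normrM exprMn (ger0_norm (ltW t0)) ler_wpM2l ?exprn_ge0 ?(ltW t0)//.
    by rewrite lerXn2r ?nnegrE.
rewrite -mulrDr; apply: le_trans (ler_wpM2l (ler0n _ n) (lerD (lerD Hc' Hs') Hs')) _.
have -> : n%:R * (t ^+ 3 * (K ^+ 3 / 2) + (t ^+ 2 * K ^+ 2 / 2) ^+ 2 +
    t ^+ 3 * (K ^+ 3 / 2) + t ^+ 3 * (K ^+ 3 / 2)) =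
    (n%:R * t ^+ 2) * (t * (K ^+ 3 * 3 / 2) + t ^+ 2 * K ^+ 4 / 4).
  by field.
rewrite nt2 mul1r; have K3 : 0 <= K ^+ 3 by rewrite exprn_ge0.
have K4 : 0 <= K ^+ 4 by rewrite exprn_ge0.
have tt : t ^+ 2 <= t by rewrite expr2 ler_piMl// ltW.
have h1 : t ^+ 2 * K ^+ 4 <= t * K ^+ 4 by rewrite ler_wpM2r.
have h2 : 0 <= t * K ^+ 3 by rewrite mulr_ge0// ltW.
have h3 : 0 <= t * K ^+ 4 by rewrite mulr_ge0// ltW.
have -> : t * (K ^+ 3 * 3 / 2) = (t * K ^+ 3) * 3 / 2 by field.
have -> : (2 * K ^+ 3 + K ^+ 4) * t = 2 * (t * K ^+ 3) + t * K ^+ 4 by ring.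
by move: (t * K ^+ 3) (t * K ^+ 4) (t ^+ 2 * K ^+ 4) h1 h2 h3 => ? ? ?; lra.
Qed.

(** * The normal law *)

Section normal_law.
Context {R : realType}.
Variable s : R.
Hypothesis s0 : s != 0.
Let N := normal_prob (0 : R) s : probability _ R.
Let p := normal_pdf (0 : R) s.
Local Notation mu := (@lebesgue_measure R).

Let s2 : 0 < s ^+ 2. Proof. by rewrite exprn_even_gt0. Qed.

Let pE x : p x = normal_peak s * expR (- (x ^+ 2 / (s ^+ 2 * 2))).
Proof.
by rewrite /p normal_pdfE// /normal_fun subr0 mulNr -[X in _ / X]mulr_natr.
Qed.

Let dp (x : R) : is_derive x 1 p (- (x / s ^+ 2) * p x).
Proof.
have -> : p = (fun y => normal_peak s * (expR \o (fun z => (- (s ^+ 2 * 2)^-1) * z ^+ 2)) y).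
  by apply/funext => y; rewrite pE/=; congr (_ * expR _); rewrite mulNr mulrC.
have d1 : is_derive x 1 (fun z : R => (- (s ^+ 2 * 2)^-1) * z ^+ 2) (- (x / s ^+ 2)).
  apply: is_derive_eq; rewrite /GRing.scale/=; field.
  by rewrite s0.
have d2 := is_derive1_comp (is_derive_expR _) d1.
apply: is_derive_eq; rewrite /GRing.scale/=; ring.
Qed.

Let p_le x : 0 <= p x <= normal_peak s.
Proof. by rewrite normal_pdf_ge0 normal_pdf_ub. Qed.

Lemma integral_normal_prob (f : R -> \bar R) U : measurable U ->
  N.-integrable U f ->
  (\int[N]_(x in U) f x = \int[mu]_(x in U) (f x * (p x)%:E))%E.
Proof.
move=> mU intf.
rewrite -(Radon_Nikodym_change_of_variables (normal_prob_dominates 0 s))//=.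
have mf := measurable_int _ intf.
apply: ae_eq_integral => //.
- apply: emeasurable_funM => //; apply: (measurable_int mu).
  apply: (integrableS _ _ (@subsetT _ _)) => //=.
  by apply: Radon_Nikodym_integrable; exact: normal_prob_dominates.
- apply: emeasurable_funM => //=; apply/measurableT_comp => //=.
  by apply/measurable_funTS; exact: measurable_normal_pdf.
- apply: ae_eqe_mul2l => /=.
  rewrite Radon_NikodymE//=; first exact: normal_prob_dominates.
  move=> abmu; case: cid => /= h [h1 h2 h3].
  apply: integral_ae_eq => //=.
  + exact: integrableS h2.
  + by apply/measurable_funTS/measurableT_comp =>//; exact: measurable_normal_pdf.
  + by move=> E E01 mE; rewrite -h3.
Qed.

Let integrable_segment (a b : R) (g : R -> R) : continuous g ->
  N.-integrable `[a, b] (EFin \o g).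
Proof.
move=> cg; apply: measurable_bounded_integrable => //.
- by rewrite (le_lt_trans (probability_le1 N _))// ltry.
- by apply: measurable_funTS; exact: continuous_measurable_fun.
- have /compact_bounded[M [Mr HM]] : compact (g @` `[a, b]).
    by apply: continuous_compact (@segment_compact _ _ _); exact: continuous_subspaceT.
  by exists M; split=> // M' MM' x xa; apply: HM MM' _ _; exists x.
Qed.

(** The density satisfies p' = - (x / s^2) p, so the integrand times p is the derivative of f p. *)
Lemma normal_stein_itv (f df : R -> R) (a : R) : 0 < a ->
  (forall x : R, is_derive x 1 f (df x)) -> continuous df ->
  \int[N]_(x in `[- a, a]) (df x - x * f x / s ^+ 2) = f a * p a - f (- a) * p (- a).
Proof.
move=> a0 fdf cdf; pose g x := df x - x * f x / s ^+ 2.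
have cf : continuous f.
  by move=> x; apply/differentiable_continuous/derivable1_diffP; have [] := fdf x.
have cp : continuous p by move=> x; exact: continuous_normal_pdf.
have cg : continuous g.
  by move=> x; apply: cvgB; [exact: cdf|apply: cvgMl; apply: cvgM; [exact: cvg_id|exact: cf]].
have ig := integrable_segment (- a) a cg.
rewrite /Rintegral integral_normal_prob//.
under eq_integral do rewrite -EFinM.
rewrite (@continuous_FTC2 _ (fun x => g x * p x) (fun x => f x * p x)) //=.
- by rewrite gt0_cp.
- by apply: continuous_subspaceT => x; apply: cvgM; [exact: cg|exact: cp].
- split.
  + by move=> x _; apply: derivableM; [have [] := fdf x|have [] := dp x].
  + by apply: cvg_at_right_filter; apply: cvgM; [exact: cf|exact: cp].
  + by apply: cvg_at_left_filter; apply: cvgM; [exact: cf|exact: cp].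
- move=> x _; rewrite derive1E; have d1 := fdf x; have d2 := dp x.
  have := is_deriveM d1 d2 => -[_ ->]; rewrite /GRing.scale/= /g.
  by ring.
Qed.

Let pN x : p (- x) = p x.
Proof. by rewrite !pE sqrrN. Qed.

(** From y exp (- y) <= 1 at y = a^2 / (2 s^2). Hence a p(a) tends to 0, which removes the boundary
    terms of Stein's identity for f of linear growth. *)
Let p_tail (a : R) : 0 < a -> a * p a <= normal_peak s * (s ^+ 2 * 2) / a.
Proof.
move=> a0; rewrite pE; set y := a ^+ 2 / _.
have -> : a * (normal_peak s * expR (- y)) =
    normal_peak s * (s ^+ 2 * 2) / a * (y * expR (- y)).
  by rewrite /y; field; rewrite s0 gt_eqF.
rewrite ler_piMr//.
  by rewrite divr_ge0 ?(ltW a0)// mulr_ge0 ?normal_peak_ge0// mulr_ge0// ltW.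
rewrite expRN ler_pdivrMr ?expR_gt0// mul1r; apply: le_trans (expR_ge1Dx _).
by rewrite lerDr.
Qed.

Let itvn (n : nat) : set R := `[- n%:R, n%:R].

Let itvn_nd : {homo itvn : n m / (n <= m)%N >-> (n <= m)%O}.
Proof.
move=> n m nm; apply/subsetPset; apply: subset_itv; rewrite bnd_simp ?lerN2 ler_nat//.
Qed.

Let itvn_cover : \bigcup_n itvn n = setT.
Proof.
apply/seteqP; split=> // x _; exists (Num.truncn `|x|).+1 => //=.
by rewrite /itvn/= in_itv/= -ler_norml ltW// truncnS_gt.
Qed.

Let cvg_itvn (g : R -> \bar R) : measurable_fun setT g -> (forall x, 0 <= g x)%E ->
  (\int[N]_(x in itvn n) g x)%E @[n --> \oo] --> (\int[N]_x g x)%E.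
Proof.
move=> mg g0; rewrite -itvn_cover.
apply: ge0_nondecreasing_set_cvg_integral => [|n|n|n x _].
- exact: itvn_nd.
- exact: measurable_itv.
- exact: measurable_funTS.
- exact: g0.
Qed.

Let boundary_cvg (f : R -> R) (M : R) : (forall x, `|f x| <= M * (1 + `|x|)) ->
  f n%:R * p n%:R - f (- n%:R) * p (- n%:R) @[n --> \oo] --> (0 : R).
Proof.
move=> fM; have M0 : 0 <= M.
  by have := le_trans (normr_ge0 _) (fM 0); rewrite normr0 addr0 mulr1.
apply/cvgr0Pnorm_le => e e0.
pose C := 4 * M * (normal_peak s * (s ^+ 2 * 2)).
have C0 : 0 <= C.
  apply: mulr_ge0; first exact: mulr_ge0.
  by rewrite mulr_ge0 ?normal_peak_ge0// mulr_ge0// ltW.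
near=> n; have n1 : 1 <= n%:R :> R by near: n; exact: nbhs_infty_ger.
have n0 : 0 < n%:R :> R by rewrite (lt_le_trans _ n1).
have /andP[pn0 _] := p_le n%:R.
have ptl := p_tail n0.
rewrite pN; apply: le_trans (ler_normB _ _) _; rewrite !normrM (ger0_norm pn0).
have h1 := fM n%:R; have h2 := fM (- n%:R); rewrite normrN (ger0_norm (ltW n0)) in h2.
rewrite (ger0_norm (ltW n0)) in h1.
apply: (@le_trans _ _ (C / n%:R)).
  rewrite -mulrDl; apply: (@le_trans _ _ (4 * M * n%:R * p n%:R)).
    rewrite ler_wpM2r//.
    have : M <= M * n%:R by rewrite ler_peMr.
    by move: h1 h2; rewrite mulrDr mulr1; lra.
  by rewrite /C -!(mulrA (4 * M)) ler_wpM2l// mulr_ge0.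
rewrite ler_pdivrMr// -ler_pdivrMl// mulrC; near: n; exact: nbhs_infty_ger.
Unshelve. all: by end_near. Qed.

(** Stein's identity for f = id on [- n, n], with n tending to infinity. Monotone convergence
    applies to x^2 before its integrability is known, and the limit shows that the second moment is
    finite. *)
Let integral_sqr : (\int[N]_x (x ^+ 2)%:E = (s ^+ 2)%:E)%E.
Proof.
have mx2 : measurable_fun setT (fun x : R => x ^+ 2) by exact: measurable_funX.
have L1 : (\int[N]_(x in itvn n) (x ^+ 2)%:E)%E @[n --> \oo] -->
    (\int[N]_x (x ^+ 2)%:E)%E.
  by apply: cvg_itvn => [|x]; [exact/measurable_EFinP|rewrite lee_fin sqr_ge0].
have N1 : fine (N (itvn n)) @[n --> \oo] --> (1 : R).
  have H : (\int[N]_(x in itvn n) (cst 1%E x))%E @[n --> \oo] --> (\int[N]_x cst 1%E x)%E.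
    by apply: cvg_itvn => // x; rewrite lee01.
  move: H; rewrite [X in _ --> X]integral_cst// mul1e
    [X in _ --> X](@probability_setT _ _ _ N) => H.
  have /fine_cvgP[_] := H; apply: cvg_trans; apply: near_eq_cvg; apply: nearW => n /=.
  by rewrite integral_cst//= ?mul1e//; exact: measurable_itv.
have B0 := @boundary_cvg id 1 _.
have L : s ^+ 2 * (fine (N (itvn n)) - (n%:R * p n%:R - (- n%:R) * p (- n%:R)))
    @[n --> \oo] --> s ^+ 2 * (1 - 0).
  apply: cvgMr; apply: cvgB => //; apply: B0 => x.
  by rewrite mul1r lerDr ler01.
rewrite subr0 mulr1 in L.
have ix2 n : N.-integrable (itvn n) (EFin \o (fun x : R => x ^+ 2)).
  by apply: integrable_segment; exact: exprn_continuous.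
apply: (cvg_unique (@ereal_hausdorff R) L1).
apply: cvg_EFin.
  by near=> n; apply: integrable_fin_num (ix2 n); exact: measurable_itv.
apply: cvg_trans L; apply: near_eq_cvg; near=> n => /=.
have n0 : 0 < n%:R :> R by near: n; exact: nbhs_infty_gtr.
rewrite -(@normal_stein_itv id (fun=> 1))//; last by move=> x; exact: cvg_cst.
have icst : N.-integrable (itvn n) (EFin \o (fun=> 1 : R)).
  by apply: integrable_segment => x; exact: cvg_cst.
have i2 : N.-integrable (itvn n) (EFin \o (fun x : R => (s ^+ 2)^-1 * x ^+ 2)).
  by apply: integrable_segment => x; apply: cvgMr; exact: exprn_continuous.
rewrite (_ : \int[N]_(x in `[- n%:R, n%:R]) (1 - x * x / s ^+ 2) =
    fine (N (itvn n)) - (s ^+ 2)^-1 * \int[N]_(x in itvn n) (x ^+ 2)); last first.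
  rewrite -(RintegralZl _ _ (ix2 n)); last exact: measurable_itv.
  have -> : fine (N (itvn n)) = \int[N]_(x in itvn n) 1.
    by rewrite Rintegral_cst ?mul1r//; exact: measurable_itv.
  rewrite -RintegralB//; last exact: measurable_itv.
  by apply: eq_Rintegral => x _; rewrite expr2 mulrC.
by rewrite opprB addrCA subrr addr0 mulrA divff ?mul1r// gt_eqF.
Unshelve. all: by end_near. Qed.

Let integrable_sqr : N.-integrable setT (EFin \o (fun x : R => x ^+ 2)).
Proof.
apply/integrableP; split; first by apply/measurable_EFinP; exact: measurable_funX.
under eq_integral do rewrite gee0_abs ?lee_fin ?sqr_ge0//.
by rewrite integral_sqr ltry.
Qed.

Let integrable_quad (g : R -> R) (M : R) : measurable_fun setT g ->
  (forall x, `|g x| <= M * (1 + x ^+ 2)) -> N.-integrable setT (EFin \o g).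
Proof.
move=> mg gM; have icst : N.-integrable setT (EFin \o (fun=> 1 : R)).
  by apply: (@bounded_integrable _ _ _ N _ 1) => // x; rewrite normr1.
have := @integrableZlR _ _ _ N M _ (integrableDR icst integrable_sqr).
apply: le_integrable => //; first exact/measurable_EFinP.
by move=> x _; rewrite /= lee_fin; apply: le_trans (gM x) (ler_norm _).
Qed.

Let cvg_itvn_integrable (g : R -> R) : N.-integrable setT (EFin \o g) ->
  \int[N]_(x in itvn n) g x @[n --> \oo] --> \int[N]_x g x.
Proof.
move=> ig; under eq_fun do rewrite Rintegral_mkcond.
apply: (@dominated_Rintegral _ _ _ N _ _ (fun x => `|g x|)) => [n||n x|x].
- apply/(measurable_restrictT _ _).1; first exact: measurable_itv.
  by apply: measurable_funTS; apply/measurable_EFinP; exact: measurable_int ig.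
- exact: (integrable_abse ig).
- by rewrite patchE; case: ifP => // _; rewrite normr0.
- apply: cvg_near_cst; near=> n; rewrite patchE mem_set// /itvn/= in_itv/=.
  by rewrite -ler_norml; near: n; exact: nbhs_infty_ger.
Unshelve. all: by end_near. Qed.

(** Limit of [normal_stein_itv] on [- n, n]: the growth conditions make both terms integrable, by
    the second moment, and the boundary terms vanish. *)
Lemma normal_stein (f df : R -> R) (M : R) :
  (forall x : R, is_derive x 1 f (df x)) -> continuous df ->
  (forall x, `|f x| <= M * (1 + `|x|)) -> (forall x, `|df x| <= M) ->
  \int[N]_x (x * f x) = s ^+ 2 * \int[N]_x df x.
Proof.
move=> fdf cdf fM dfM.
have M0 : 0 <= M by apply: le_trans (normr_ge0 _) (dfM 0).
have cf : continuous f.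
  by move=> x; apply/differentiable_continuous/derivable1_diffP; have [] := fdf x.
have mf := continuous_measurable_fun cf; have mdf := continuous_measurable_fun cdf.
have i1 : N.-integrable setT (EFin \o df) by exact: (@bounded_integrable _ _ _ N _ M).
have i2 : N.-integrable setT (EFin \o (fun x => x * f x)).
  apply: (@integrable_quad _ (M * 2)); first exact: measurable_funM.
  move=> x; rewrite normrM; apply: le_trans (ler_wpM2l (normr_ge0 _) (fM x)) _.
  rewrite mulrCA -mulrA ler_wpM2l// -(real_normK (num_real x)).
  by have := sqr_ge0 (`|x| - 1); rewrite sqrrB expr1n; move: `|x| => a; nra.
have i3 : N.-integrable setT (EFin \o (fun x => x * f x / s ^+ 2)).
  by apply: eq_integrable (integrableZlR (s ^+ 2)^-1 i2) => // x _; rewrite /= mulrC.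
have i4 : N.-integrable setT (EFin \o (fun x => df x - x * f x / s ^+ 2)).
  exact: (integrableB _ i1 i3).
suff : \int[N]_x (df x - x * f x / s ^+ 2) = 0.
  rewrite RintegralB// RintegralZr// => /subr0_eq ->.
  by rewrite mulrC divfK// gt_eqF.
apply: (cvg_unique (@Rhausdorff R) (cvg_itvn_integrable i4)).
apply: cvg_trans (boundary_cvg fM); apply: near_eq_cvg; near=> n.
rewrite normal_stein_itv//; near: n; exact: nbhs_infty_gtr.
Unshelve. all: by end_near. Qed.

(** Used to differentiate under an integral: a second-order Taylor bound with integrable remainder
    replaces a domination argument for difference quotients. *)
Lemma is_derive_quad_bound (y : R -> R) (u l C : R) :
  (forall h, `|y (u + h) - y u - h * l| <= C * h ^+ 2) -> is_derive u 1 y l.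
Proof.
move=> H; wlog C0 : C H / 0 < C.
  move=> /(_ (Num.max C 1)); apply; last by rewrite lt_max ltr01 orbT.
  move=> h; apply: le_trans (H h) _.
  by rewrite ler_wpM2r ?sqr_ge0// le_max lexx.
have L : h^-1 *: ((y \o shift u) (h *: 1) - y u) @[h --> 0^'] --> l.
  apply/cvgrPdist_le => e e0; near=> h.
  have h0 : h != 0 by near: h; exact: nbhs_dnbhs_neq.
  have -> : l - h^-1 *: ((y \o shift u) (h *: 1) - y u) =
      - h^-1 * (y (u + h) - y u - h * l).
    rewrite /GRing.scale/= mulr1 (addrC h); field.
    by rewrite h0.
  rewrite normrM normrN normfV ler_pdivrMl ?normr_gt0//.
  apply: le_trans (H h) _; rewrite -(real_normK (num_real h)) expr2 mulrCA ler_wpM2l//.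
  rewrite -ler_pdivlMl//; near: h; apply: dnbhs0_le.
  by rewrite mulr_gt0// invr_gt0.
split; first by apply/cvg_ex; exists l.
exact: cvg_lim L.
Unshelve. all: by end_near. Qed.

Lemma gaussian_ode (y : R -> R) (k : R) :
  (forall u : R, is_derive u 1 y (- (k * u) * y u)) ->
  forall u, y u = y 0 * expR (- (k * u ^+ 2 / 2)).
Proof.
move=> dy u; pose E (u : R) := expR (k * u ^+ 2 / 2).
have dE (v : R) : is_derive v 1 E ((k * v) * E v).
  have d1 : is_derive v 1 (fun z : R => (k / 2) * z ^+ 2) (k * v).
    by apply: is_derive_eq; rewrite /GRing.scale/=; field.
  have := is_derive1_comp (is_derive_expR _) d1.
  rewrite (_ : expR \o _ = E); last by apply/funext => z /=; rewrite /E mulrAC.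
  by rewrite mulrC (_ : (k / 2) * v ^+ 2 = k * v ^+ 2 / 2)// mulrAC.
have d0 (v : R) : is_derive v 1 (y * E) 0.
  have := is_deriveM (dy v) (dE v); rewrite (_ : _ + _ = 0)// /GRing.scale/=; ring.
have : y u * E u = y 0 * E 0 := is_derive_0_is_cst u 0 d0.
rewrite /E expr0n/= mulr0 mul0r expR0 mulr1 => <-.
by rewrite -(mulrA (y u)) -expRD subrr expR0 mulr1.
Qed.

(** Differentiating in u produces the integral of - x sin (u x + b), which Stein's identity turns
    into - s^2 u times the original integral. The linear equation y' = - s^2 u y is solved by
    [gaussian_ode]. *)
Lemma normal_cos (u b : R) :
  \int[N]_x cos (u * x + b) = cos b * expR (- (s ^+ 2 * u ^+ 2 / 2)).
Proof.
pose y v := \int[N]_x cos (v * x + b).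
have maff v : measurable_fun setT (fun x : R => v * x + b).
  by apply: measurable_funD => //; exact: measurable_funM.
have msin v : measurable_fun setT (fun x : R => sin (v * x + b)).
  exact: measurableT_comp (continuous_measurable_fun (@continuous_sin R)) (maff v).
have icos v : N.-integrable setT (EFin \o (fun x => cos (v * x + b))).
  apply: (@bounded_integrable _ _ _ N _ 1) => [|x]; last exact: cos_max.
  exact: (measurable_cos (maff v)).
have ixsin v : N.-integrable setT (EFin \o (fun x => x * sin (v * x + b))).
  apply: (@integrable_quad _ 1) => [|x]; first exact: measurable_funM.
  rewrite normrM mul1r; apply: (@le_trans _ _ (`|x| * 1)).
    by rewrite ler_wpM2l// sin_max.
  rewrite mulr1 -(real_normK (num_real x)).
  by have := sqr_ge0 (`|x| - 1); rewrite sqrrB expr1n; move: `|x| => a; nra.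
have dsin v (x : R) : is_derive x 1 (fun x => sin (v * x + b)) (v * cos (v * x + b)).
  have d1 : is_derive x 1 (fun x : R => v * x + b) v.
    by apply: is_derive_eq; rewrite /GRing.scale/= mulr1 addr0.
  by have := is_derive1_comp (is_derive_sin _) d1; rewrite mulrC.
have stein v : \int[N]_x (x * sin (v * x + b)) = s ^+ 2 * (v * y v).
  rewrite (@normal_stein _ (fun x => v * cos (v * x + b)) (1 + `|v|) (dsin v)).
  - by rewrite RintegralZl//; exact: icos.
  - move=> x; apply: cvgMr; apply: continuous_comp; last exact: continuous_cos.
    by apply: cvgD; [apply: cvgMr; exact: cvg_id|exact: cvg_cst].
  - move=> x; apply: le_trans (sin_max _) _.
    by rewrite mulrDl mul1r -addrA lerDl addr_ge0// mulr_ge0// addr_ge0.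
  - move=> x; rewrite normrM; apply: (@le_trans _ _ (`|v| * 1)).
      by rewrite ler_wpM2l// cos_max.
    by rewrite mulr1 lerDr ler01.
have dy (v : R) : is_derive v 1 y (- (s ^+ 2 * v) * y v).
  (* The remainder at x is at most (h x)^2 / 2 from cos (h x) - 1 plus (h x)^2 from sin (h x) - h x;
     s^2 is the integral of x^2. *)
  apply: (@is_derive_quad_bound _ _ _ (3 / 2 * s ^+ 2)) => h.
  have ilin : N.-integrable setT (EFin \o
      (fun x => cos (v * x + b) + (- h) * (x * sin (v * x + b)))).
    by apply: integrableDR => //; exact: integrableZlR.
  have -> : y (v + h) - y v - h * (- (s ^+ 2 * v) * y v) =
      y (v + h) - \int[N]_x (cos (v * x + b) + (- h) * (x * sin (v * x + b))).
    rewrite RintegralD ?RintegralZl//; last exact: integrableZlR.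
    by rewrite stein -/(y v); ring.
  have -> : 3 / 2 * s ^+ 2 * h ^+ 2 = \int[N]_x ((3 / 2 * h ^+ 2) * x ^+ 2).
    rewrite RintegralZl; [|exact: measurableT|exact: integrable_sqr].
    by rewrite /Rintegral integral_sqr/= mulrAC.
  apply: expect_dist_le => //; first exact: integrableZlR integrable_sqr.
  move=> x; have -> : (v + h) * x + b = (v * x + b) + h * x by ring.
  rewrite cosD; move: (v * x + b) => A.
  have -> : cos A * cos (h * x) - sin A * sin (h * x) - (cos A + - h * (x * sin A)) =
    cos A * (cos (h * x) - 1) - sin A * (sin (h * x) - h * x) by ring.
  have -> : 3 / 2 * h ^+ 2 * x ^+ 2 = (h * x) ^+ 2 / 2 + (h * x) ^+ 2 by field.
  apply: le_trans (ler_normB _ _) _; rewrite !normrM; apply: lerD.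
    by apply: le_trans (cosB1_le _); rewrite ler_piMl// cos_max.
  by apply: le_trans (sinB_le2 _); rewrite ler_piMl// sin_max.
rewrite -/(y u) (gaussian_ode dy u); congr (_ * _).
rewrite /y; under eq_Rintegral do rewrite mul0r add0r.
exact: expect_cst.
Qed.

Lemma normal_moments : [/\ N.-integrable setT (EFin \o (fun x : R => x ^+ 2)),
  \int[N]_x (x ^+ 2) = s ^+ 2 & \int[N]_x x = 0].
Proof.
split; first exact: integrable_sqr.
- by rewrite /Rintegral integral_sqr.
- have := @normal_stein (fun=> 1) (fun=> 0) 1.
  under eq_Rintegral do rewrite mulr1; rewrite expect_cst mulr0; apply => //.
  + by move=> x; exact: cvg_cst.
  + by move=> x; rewrite normr1 mul1r lerDl.
  + by move=> x; rewrite normr0.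
Qed.

End normal_law.

(** A reference variable for each centered Gaussian law, degenerate or not. For s = 0 it is the
    constant 0, on a probability space that only has to exist. *)
Lemma gaussian_law_model {R : realType} (s : R) :
  exists (d : measure_display) (S : measurableType d) (N : probability S R) (G : S -> R),
  [/\ measurable_fun setT G,
      N.-integrable setT (EFin \o (fun w => G w ^+ 2)),
      \int[N]_w (G w ^+ 2) = s ^+ 2, \int[N]_w G w = 0 &
      (forall u b, \int[N]_w cos (u * G w + b) = cos b * expR (- (s ^+ 2 * u ^+ 2 / 2))) /\
      forall B, measurable B -> N (G @^-1` B) = gaussian_law 0 s B].
Proof.
have [->|s0] := eqVneq s 0.
  exists _, _, (normal_prob (0 : R) 1 : probability _ R), (fun=> 0); split.
  - exact: measurable_cst.
  - apply: (@bounded_integrable _ _ _ _ _ 0) => [|w]; first exact: measurable_cst.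
    by rewrite expr0n normr0.
  - by rewrite expect_cst.
  - by rewrite expect_cst.
  split=> [u b|B mB].
    rewrite expect_cst mulr0 add0r expr0n/= !mul0r oppr0 expR0 mulr1//.
  rewrite /gaussian_law eqxx preimage_cst diracE; case: ifPn => _.
    exact: (@probability_setT _ _ _ (normal_prob (0 : R) 1 : probability _ R)).
  by rewrite measure0.
have [? ? ?] := normal_moments s0.
exists _, _, (normal_prob (0 : R) s : probability _ R), id; split=> //.
by split=> [u b|B mB]; [exact: normal_cos|rewrite /gaussian_law (negbTE s0)].
Qed.

(** * Limits of variables with Gaussian characteristic functions *)

Lemma cvg_lipschitz {R : realType} {V : normedModType R} (f : V -> R) (L : R) :
  (forall x y, `|f x - f y| <= L * `|x - y|) ->
  forall (u : nat -> V) (l : V), u n @[n --> \oo] --> l -> f (u n) @[n --> \oo] --> f l.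
Proof.
move=> fL u l ul.
wlog L0 : L fL / 0 < L.
  move=> /(_ (Num.max L 1)); apply; last by rewrite lt_max ltr01 orbT.
  by move=> x y; apply: le_trans (fL x y) _; rewrite ler_wpM2r// le_max lexx.
apply/cvgrPdist_le => e e0; near=> n; apply: le_trans (fL _ _) _.
rewrite -ler_pdivlMl//; near: n.
by move/cvgrPdist_le : ul; apply; rewrite mulr_gt0// invr_gt0.
Unshelve. all: by end_near. Qed.

Section equal_laws.
Context {R : realType} {d d' : measure_display} {S : measurableType d}
  {S' : measurableType d'}.
Variables (Q : probability S R) (N : probability S' R) (X : S -> R) (G : S' -> R).
Hypotheses (mX : measurable_fun setT X) (mG : measurable_fun setT G).
Hypothesis XG : forall B, measurable B -> Q (X @^-1` B) = N (G @^-1` B).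

Lemma ge0_integral_equal_law (g : R -> \bar R) : measurable_fun setT g ->
  (forall x, 0 <= g x)%E -> (\int[Q]_w g (X w) = \int[N]_w g (G w))%E.
Proof.
move=> mg g0; pose mQ : {measure set _ -> \bar R} := pushforward Q X.
pose mN : {measure set _ -> \bar R} := pushforward N G.
have -> : (\int[Q]_w g (X w) = \int[mQ mX]_x g x)%E.
  by rewrite ge0_integral_pushforward.
have -> : (\int[N]_w g (G w) = \int[mN mG]_x g x)%E.
  by rewrite ge0_integral_pushforward.
by apply: eq_measure_integral => A mA _; exact: XG.
Qed.

Lemma integrable_equal_law (g : R -> R) : measurable_fun setT g ->
  N.-integrable setT (EFin \o (fun w => g (G w))) ->
  Q.-integrable setT (EFin \o (fun w => g (X w))).
Proof.
move=> mg /integrableP[_ ig]; apply/integrableP; split.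
  by apply/measurable_EFinP; exact: measurableT_comp.
rewrite (@ge0_integral_equal_law (fun x => `|(g x)%:E|%E))//.
by apply: measurableT_comp => //; exact/measurable_EFinP.
Qed.

Lemma Rintegral_equal_law (g : R -> R) : measurable_fun setT g ->
  N.-integrable setT (EFin \o (fun w => g (G w))) ->
  \int[Q]_w g (X w) = \int[N]_w g (G w).
Proof.
move=> mg ig; have ig' := integrable_equal_law mg ig.
rewrite /Rintegral; congr fine.
pose mQ : {measure set _ -> \bar R} := pushforward Q X.
pose mN : {measure set _ -> \bar R} := pushforward N G.
have mg' : measurable_fun setT (EFin \o g) by exact/measurable_EFinP.
transitivity (\int[mQ mX]_x (EFin \o g) x)%E; first by rewrite integral_pushforward.
transitivity (\int[mN mG]_x (EFin \o g) x)%E; last by rewrite integral_pushforward.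
by apply: eq_measure_integral => A mA _; exact: XG.
Qed.

End equal_laws.

Section gaussian_limit.
Context {R : realType} {d : measure_display} {S : measurableType d}.
Variables (Q : probability S R) (X_ : nat -> S -> R) (X : S -> R) (sg C : R).
Hypotheses (mX : forall n, measurable_fun setT (X_ n)).
Hypothesis iX : forall n, Q.-integrable setT (EFin \o (fun w => X_ n w ^+ 2)).
Hypothesis XC : forall n, \int[Q]_w (X_ n w ^+ 2) <= C.
Hypothesis X_cvg : forall w, X_ n w @[n --> \oo] --> X w.
Hypothesis X_cos : forall u b, \int[Q]_w cos (u * X_ n w + b) @[n --> \oo] -->
  cos b * expR (- (sg ^+ 2 * u ^+ 2 / 2)).

(** For a bounded Lipschitz f, the integrals of f(X_n) tend to that of f(X) by bounded convergence,
    and to that of f at the reference variable by [cvg_lipschitz_of_cos] in dimension one. Such f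
    determine the law. *)
Lemma gaussian_limit : measurable_fun setT X /\
  forall B, measurable B -> Q (X @^-1` B) = gaussian_law 0 sg B.
Proof.
have mXX : measurable_fun setT X by apply: (measurable_fun_cvg mX) => w _; exact: X_cvg.
split=> // B mB; have [d' [S' [N [G [mG iG G2 _ [Gcos <-//]]]]]] := gaussian_law_model sg.
have := @law_determined R _ _ _ _ Q N X G setT 1 mXX mG measurableT ler01 _ B mB.
rewrite setIT mul1e; apply => f L f01 mf fL; rewrite mul1r.
under eq_Rintegral do rewrite indicT mulr1.
have f1 x : `|f x| <= 1 by have /andP[? ?] := f01 x; rewrite ger0_norm.
have L1 : \int[Q]_w f (X_ n w) @[n --> \oo] --> \int[Q]_w f (X w).
  apply: (@bounded_cvg_Rintegral _ _ _ Q _ _ 1) => // [n|w].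
    exact: measurableT_comp mf (mX n).
  exact: cvg_lipschitz fL _ _ (@X_cvg w).
apply: (cvg_unique (@Rhausdorff R) L1).
apply: (@cvg_lipschitz_of_cos R _ _ _ Q _ N 1 (fun n w _ => X_ n w) (fun w _ => G w)
  (Num.max C (sg ^+ 2)) _ _ _ _ _ _ _ (fun x => f (x 0%N)) L 1) => //.
- by move=> n i _; apply: le_trans (XC n) _; rewrite le_max lexx.
- by move=> i _; rewrite G2 le_max lexx orbT.
- move=> u b; under eq_Rintegral do rewrite /lin big_ord1.
  rewrite Gcos (_ : (fun n => _) = fun n => \int[Q]_w cos (u 0%N * X_ n w + b)); first exact: X_cos.
  by apply/funext => n; under eq_Rintegral do rewrite /lin big_ord1.
- by move=> x y; rewrite big_ord1.
Qed.

(** The moments are those of the reference variable, transported along the equality of laws; hence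
    no uniform integrability of the squares is involved. *)
Lemma gaussian_limit_moments : [/\ Q.-integrable setT (EFin \o (fun w => X w ^+ 2)),
  \int[Q]_w (X w ^+ 2) = sg ^+ 2 & \int[Q]_w X w = 0].
Proof.
have [mXX XB] := gaussian_limit.
have [d' [S' [N [G [mG iG G2 G1 [_ Glaw]]]]]] := gaussian_law_model sg.
have XG B : measurable B -> Q (X @^-1` B) = N (G @^-1` B).
  by move=> mB; rewrite XB// Glaw.
have msqr : measurable_fun setT (fun x : R => x ^+ 2) by exact: measurable_funX.
have iG1 : N.-integrable setT (EFin \o (fun w => idfun (G w))) := integrable_of_sqr mG iG.
split.
- exact: (integrable_equal_law mXX mG XG msqr iG).
- by rewrite (Rintegral_equal_law mXX mG XG msqr iG).
- by rewrite (Rintegral_equal_law mXX mG XG (@measurable_id _ _ _) iG1).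
Qed.

End gaussian_limit.

(** * Independent uniform variables from binary digits *)

Section finite_range_approximation.
Context {R : realType}.

Lemma finite_range_approx {d : measure_display} {T : measurableType d} (k : T -> R) :
  measurable_fun setT k -> (forall x, `|k x| <= 1) ->
  exists k_ : nat -> T -> R, [/\ forall n, measurable_fun setT (k_ n),
    forall n, finite_set (range (k_ n)),
    forall n x, `|k_ n x| <= 3 &
    forall x, k_ n x @[n --> \oo] --> k x].
Proof.
move=> mk k1; pose h n x := Num.truncn (n.+1%:R * (k x + 1)).
have k01 x : 0 <= k x + 1 <= 2.
  by have := k1 x; rewrite ler_norml => /andP[? ?]; apply/andP; split; lra.
have hk n x : `|k x - (n.+1%:R^-1 * (h n x)%:R - 1)| <= n.+1%:R^-1.
  have /andP[a b] := k01 x.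
  have n0 : 0 < n.+1%:R :> R by rewrite ltr0n.
  have /truncn_itv/andP[h1 h2] : 0 <= n.+1%:R * (k x + 1) by rewrite mulr_ge0.
  rewrite -/(h n x) in h1 h2.
  have -> : k x - (n.+1%:R^-1 * (h n x)%:R - 1) =
      n.+1%:R^-1 * (n.+1%:R * (k x + 1) - (h n x)%:R).
    by field; rewrite gt_eqF.
  rewrite normrM ger0_norm ?invr_ge0// ler_piMr ?invr_ge0//.
  rewrite ger0_norm ?subr_ge0//; rewrite -natr1 in h2; lra.
exists (fun n x => n.+1%:R^-1 * (h n x)%:R - 1); split.
- move=> n; apply: measurable_funB => //; apply: measurable_funM => //.
  have mt : measurable_fun setT (fun t : R => (Num.truncn t)%:R : R).
    by apply: nondecreasing_measurable => // s t st; rewrite ler_nat le_truncn.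
  have mg : measurable_fun setT (fun x => n.+1%:R * (k x + 1)).
    by apply: measurable_funM => //; exact: measurable_funD.
  exact: measurableT_comp mt mg.
- move=> n; apply: (@sub_finite_set _ _ ((fun j : nat => n.+1%:R^-1 * j%:R - 1 : R) @`
     `I_(n.+1 * 2).+1)); last exact/finite_image/finite_II.
  move=> _ [x _ <-]; exists (h n x) => //=.
  have /andP[a b] := k01 x.
  rewrite ltnS /h truncn_le_nat (@le_lt_trans _ _ (n.+1 * 2)%:R) ?ltr_nat//.
  by rewrite natrM ler_pM2l.
- move=> n x; have n1 : n.+1%:R^-1 <= 1 :> R by rewrite invf_le1 ?ltr0n// ler1n.
  have := hk n x; have := k1 x.
  move: (n.+1%:R^-1 * _ - 1) => kn; move: n1; move: (n.+1%:R^-1) => q q1.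
  rewrite !ler_norml => /andP[a b] /andP[c d'].
  by apply/andP; split; lra.
- move=> x; apply/cvgrPdist_le => e e0; near=> n; apply: le_trans (hk n x) _.
  by apply/ltW; near: n; exact: (near_infty_natSinv_lt (PosNum e0)).
Unshelve. all: by end_near. Qed.

(** Passage from indicators to bounded measurable k, by finite-range approximations. The weight g
    makes the lemma usable for independence, first in one factor and then in the other. *)
Lemma bounded_Rintegral_law {d d' : measure_display} {Omega : measurableType d}
    {Omega' : measurableType d'} (P : probability Omega R) (P' : probability Omega' R)
    (d1 : measure_display) (T : measurableType d1)
    (A : Omega -> T) (A' : Omega' -> T) (g : Omega -> R) (c : R) :
  measurable_fun setT A -> measurable_fun setT A' -> measurable_fun setT g ->
  (forall w, `|g w| <= 1) ->
  (forall B, measurable B -> \int[P]_w (\1_B (A w) * g w) = c * fine (P' (A' @^-1` B))) ->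
  forall k : T -> R, measurable_fun setT k -> (forall x, `|k x| <= 1) ->
  \int[P]_w (k (A w) * g w) = c * \int[P']_w k (A' w).
Proof.
move=> mA mA' mg g1 H k mk k1.
have [k_ [mk_ fk_ k_3 k_cvg]] := finite_range_approx mk k1.
have L1 : \int[P]_w (k_ n (A w) * g w) @[n --> \oo] --> \int[P]_w (k (A w) * g w).
  apply: (@bounded_cvg_Rintegral _ _ _ P _ _ 3) => [n|n w|w].
  - by apply: measurable_funM => //; exact: measurableT_comp.
  - rewrite normrM; apply: (@le_trans _ _ (3 * 1)); last by rewrite mulr1.
    exact: ler_pM.
  - by apply: cvgMl; exact: k_cvg.
have L2 : c * \int[P']_w k_ n (A' w) @[n --> \oo] --> c * \int[P']_w k (A' w).
  apply: cvgMr; apply: (@bounded_cvg_Rintegral _ _ _ P' _ _ 3) => [n|n w|w].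
  - exact: measurableT_comp.
  - exact: k_3.
  - exact: k_cvg.
suff E n : \int[P]_w (k_ n (A w) * g w) = c * \int[P']_w k_ n (A' w).
  rewrite (_ : (fun n => _) = (fun n => c * \int[P']_w k_ n (A' w))) in L1.
    exact: (cvg_unique (@Rhausdorff R) L1 L2).
  exact/funext.
have [ys kE] := finite_range_decomp (fk_ n).
have mB y : measurable (k_ n @^-1` [set y]).
  by rewrite -[X in measurable X]setTI; exact: mk_.
have mAB y : measurable (A' @^-1` (k_ n @^-1` [set y])).
  by rewrite -[X in measurable X]setTI; exact: mA'.
have i1 y : P.-integrable setT (EFin \o (fun w => \1_(k_ n @^-1` [set y]) (A w) * g w)).
  apply: (@bounded_integrable _ _ _ _ _ 1) => [|w].
    by apply: measurable_funM => //; apply: measurableT_comp mA; exact: measurable_indic.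
  rewrite normrM -[leRHS]mulr1; apply: ler_pM => //.
  by rewrite indicE; case: (_ \in _); rewrite ?normr1 ?normr0.
have i2 y : P'.-integrable setT (EFin \o (fun w => \1_(k_ n @^-1` [set y]) (A' w))).
  apply: (@bounded_integrable _ _ _ _ _ 1) => [|w].
    by apply: measurableT_comp mA'; exact: measurable_indic.
  by rewrite indicE; case: (_ \in _); rewrite ?normr1 ?normr0.
transitivity (\sum_(y <- ys) y * \int[P]_w (\1_(k_ n @^-1` [set y]) (A w) * g w)).
  rewrite (_ : (fun w => k_ n (A w) * g w) = fun w =>
     \sum_(y <- ys) y * (\1_(k_ n @^-1` [set y]) (A w) * g w)); last first.
    by apply/funext => w; rewrite kE big_distrl/=; apply: eq_bigr => y _; rewrite mulrA.
  rewrite expect_sum; last by move=> y; exact: integrableZlR.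
  by apply: eq_bigr => y _; rewrite RintegralZl.
transitivity (c * \sum_(y <- ys) y * \int[P']_w \1_(k_ n @^-1` [set y]) (A' w)); last first.
  congr (_ * _); rewrite (_ : (fun w => k_ n (A' w)) = fun w =>
     \sum_(y <- ys) y * \1_(k_ n @^-1` [set y]) (A' w)); last first.
    by apply/funext => w; rewrite kE.
  rewrite expect_sum; last by move=> y; exact: integrableZlR.
  by apply: eq_bigr => y _; rewrite RintegralZl//; exact: i2.
rewrite big_distrr/=; apply: eq_bigr => y _; rewrite H// mulrCA; congr (_ * (_ * _)).
rewrite /Rintegral (_ : (fun w => _) = (EFin \o \1_(A' @^-1` (k_ n @^-1` [set y]))))//.
by rewrite integral_indic ?setIT.
Qed.

End finite_range_approximation.

Section binary_splitting.
Context {R : realType}.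
Local Notation mu := (@lebesgue_measure R).
Local Notation U := (uniform_prob (@ltr01 R) : probability _ R).

Lemma uniform01E (V : set R) : measurable V -> U V = mu (V `&` `[0, 1]).
Proof.
move=> mV; rewrite /= /uniform_prob integral_uniform_pdf.
rewrite (eq_integral (fun=> 1%:E)); last first.
  move=> x; rewrite inE => -[_]/=; rewrite in_itv/= /uniform_pdf => ->.
  by rewrite subr0 invr1.
rewrite integral_cst ?mul1e//; exact: (measurableI _ _ mV (measurable_itv _)).
Qed.

Lemma uniform01_itv (V : set R) (b1 b2 : bool) (x y : R) : measurable V -> x <= y ->
  V `&` `[0, 1] = [set` Interval (BSide b1 x) (BSide b2 y)] -> U V = (y - x)%:E.
Proof.
move=> mV xy VE; rewrite uniform01E// VE lebesgue_measure_itv/= lte_fin.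
case: ltP => // yx; have -> : y = x by apply/eqP; rewrite eq_le xy yx.
by rewrite subrr.
Qed.

Lemma uniform01_set0 (V : set R) : measurable V -> V `&` `[0, 1] = set0 -> U V = 0%E.
Proof. by move=> mV V0; rewrite uniform01E// V0 measure0. Qed.

(** First binary digit on [0, 1], with [dbl] the shift of the digits. Both are defined on the whole
    line, where [bit_dblK] still recovers x. *)
Definition bit (x : R) : bool := 2^-1 <= x.
Definition dbl (x : R) : R := 2 * x - (bit x)%:R.

Lemma bit_dblK (x : R) : ((bit x)%:R + dbl x) / 2 = x.
Proof. by rewrite /dbl; field. Qed.

Lemma measurable_bit (p : bool) : measurable [set x : R | bit x = p].
Proof.
have m1 : measurable [set x : R | bit x = true].
  rewrite (_ : [set _ | _] = `[2^-1, +oo[%classic)//.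
  by apply/seteqP; split => x /=; rewrite in_itv/= andbT /bit.
case: p => //; rewrite (_ : [set _ | _] = ~` [set x : R | bit x = true]).
  exact: measurableC.
by apply/seteqP; split => x /=; case: (bit x).
Qed.

Lemma bitE (x : R) : (bit x)%:R = \1_[set x : R | bit x = true] x :> R.
Proof.
rewrite indicE; congr (nat_of_bool _)%:R.
by apply/idP/idP => [bx|/set_mem//]; exact/mem_set.
Qed.

Lemma measurable_dbl : measurable_fun setT dbl.
Proof.
apply: measurable_funB; first exact: measurable_funM.
rewrite (_ : (fun x => _) = \1_[set x : R | bit x = true]).
  by apply: measurable_indic; exact: measurable_bit.
by apply/funext => x; exact: bitE.
Qed.

(** Under the uniform law the first digit is a fair coin and the shifted number is again uniform and
    independent of it. The three cases are a >= 1, a < 0 and a in between. *)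
Lemma dbl_rays (p : bool) (a : R) :
  U (dbl @^-1` `]a, +oo[ `&` [set x : R | bit x = p]) = ((2^-1)%:E * U `]a, +oo[%classic)%E.
Proof.
have mray : measurable `]a, +oo[%classic by exact: measurable_itv.
have mV : measurable (dbl @^-1` `]a, +oo[ `&` [set x : R | bit x = p]).
  apply: measurableI; last exact: measurable_bit.
  by rewrite -[X in measurable X]setTI; exact: measurable_dbl.
have [a1|a1] := leP 1 a.
  rewrite !uniform01_set0 ?mule0//.
    apply/seteqP; split => // x [] /=; rewrite !in_itv/= andbT => ax /andP[x0 x1].
    lra.
  apply/seteqP; split => // x [[/= ax bx]]; rewrite !in_itv/= => /andP[x0 x1].
  exfalso; move: ax; rewrite in_itv/= andbT /dbl bx.
  by case: p {mV} bx => /= [_|/negbT]; rewrite /bit -?ltNge; lra.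
have [a0|a0] := ltP a 0.
  have -> : U `]a, +oo[%classic = 1%:E.
    rewrite (@uniform01_itv _ true false 0 1) ?subr0//.
    apply/seteqP; split => x /=; rewrite !in_itv/= andbT; first by move=> [].
    by move=> /andP[x0 x1]; split; [lra|apply/andP].
  case: p mV => mV; rewrite mule1.
  - rewrite (@uniform01_itv _ true false 2^-1 1)//; first by congr EFin; lra.
      lra.
    apply/seteqP; split => x /=; rewrite !in_itv/= andbT /dbl.
      by move=> [[_ bx] /andP[x0 x1]]; apply/andP.
    move=> /andP[x0 x1]; rewrite /bit x0; split; last by apply/andP; split; lra.
    by split=> //=; lra.
  - rewrite (@uniform01_itv _ true true 0 2^-1)//; first by congr EFin; lra.
    apply/seteqP; split => x /=; rewrite !in_itv/= andbT /dbl /bit.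
      by move=> [[_ /negbT +] /andP[x0 x1]]; rewrite -ltNge x0.
    move=> /andP[x0 x1]; rewrite leNgt x1/=; split; last by apply/andP; split; lra.
    by split=> //=; lra.
have -> : U `]a, +oo[%classic = (1 - a)%:E.
  rewrite (@uniform01_itv _ false false a 1)//; first exact: ltW.
  apply/seteqP; split => x /=; rewrite !in_itv/= andbT; first by move=> [-> /andP[_ ->]].
  by move=> /andP[x0 x1]; split; [lra|apply/andP; split; lra].
rewrite -EFinM; case: p mV => mV.
- rewrite (@uniform01_itv _ false false ((a + 1) / 2) 1)//; first by congr EFin; lra.
    lra.
  apply/seteqP; split => x /=; rewrite !in_itv/= andbT /dbl.
    by move=> [[ax bx] /andP[x0 x1]]; rewrite bx/= in ax; apply/andP; split; lra.
  move=> /andP[x0 x1]; have -> : bit x by rewrite /bit; lra.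
  by split; [split=> //=; lra|apply/andP; split; lra].
- rewrite (@uniform01_itv _ false true (a / 2) 2^-1)//; first by congr EFin; lra.
    lra.
  apply/seteqP; split => x /=; rewrite !in_itv/= andbT /dbl /bit.
    move=> [[ax /negbT x2] /andP[x0 x1]]; rewrite (negbTE x2)/= in ax.
    by rewrite -ltNge in x2; apply/andP; split; lra.
  move=> /andP[x0 x1]; rewrite leNgt x1/=.
  by split; [split=> //=; lra|apply/andP; split; lra].
Qed.

Lemma expect_dbl (h : bool -> R -> R) : (forall p, measurable_fun setT (h p)) ->
  (forall p x, `|h p x| <= 1) ->
  \int[U]_x h (bit x) (dbl x) = (\int[U]_x h false x + \int[U]_x h true x) / 2.
Proof.
move=> mh h1.
have H p : \int[U]_x (h p (dbl x) * \1_[set x : R | bit x = p] x) = 2^-1 * \int[U]_x h p x.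
  apply: (@bounded_Rintegral_law _ _ _ _ _ U U _ _ dbl id) => //.
  - exact: measurable_dbl.
  - by apply: measurable_indic; exact: measurable_bit.
  - by move=> w; rewrite indicE; case: (_ \in _); rewrite ?normr1 ?normr0.
  - move=> B mB; have h2 : (0 : R) <= 2^-1 by rewrite invr_ge0.
    have mE := measurable_bit p.
    have mD : measurable (dbl @^-1` B) by rewrite -[X in measurable X]setTI; exact: measurable_dbl.
    have := @law_rays _ _ _ _ _ U U dbl id _ _ measurable_dbl (@measurable_id _ _ _)
      mE h2 (dbl_rays p) B mB.
    move=> /(congr1 fine); rewrite fineM ?fin_num_measure//= => <-.
    rewrite /Rintegral (_ : (fun w => _) =
      (EFin \o \1_(dbl @^-1` B `&` [set x : R | bit x = p]))).
      by rewrite integral_indic ?setIT//; exact: measurableI.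
    apply/funext => w /=; rewrite !indicE in_setI -natrM mulnb.
    by congr (nat_of_bool (_ && _))%:R%:E; apply/idP/idP => /[!inE].
have i1 p : U.-integrable setT (EFin \o (fun x => h p (dbl x) * \1_[set x : R | bit x = p] x)).
  apply: (@bounded_integrable _ _ _ _ _ 1) => [|w].
    apply: measurable_funM; last by apply: measurable_indic; exact: measurable_bit.
    exact: measurableT_comp (mh p) measurable_dbl.
  rewrite normrM -[leRHS]mulr1; apply: ler_pM => //.
  by rewrite indicE; case: (_ \in _); rewrite ?normr1 ?normr0.
transitivity (\int[U]_x (h false (dbl x) * \1_[set x : R | bit x = false] x +
                         h true (dbl x) * \1_[set x : R | bit x = true] x)).
  apply: eq_Rintegral => x _; rewrite !indicE.
  case E : (bit x).
    by rewrite memNset/= ?mulr0 ?add0r ?mem_set ?mulr1//= E.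
  by rewrite mem_set//= ?mulr1 memNset/= ?mulr0 ?addr0//= E.
by rewrite RintegralD// !H; field.
Qed.

End binary_splitting.

(** * Two independent uniform variables from one *)

Section splitting_a_uniform_variable.
Context {R : realType}.
Local Notation U := (uniform_prob (@ltr01 R) : probability _ R).
Implicit Types (f g : R -> R) (x : R).

(* The binary digits of x of even rank, read as a binary expansion; those of  *)
(* odd rank are the digits of even rank of dbl x.                             *)
Fixpoint digits n x : R :=
  if n is m.+1 then ((bit x)%:R + digits m (dbl (dbl x))) / 2 else 0.

Definition half1 x : R := lim (digits n x @[n --> \oo]).
Definition half2 x : R := half1 (dbl x).

Lemma digits_itv n x : 0 <= digits n x <= 1.
Proof.
elim: n x => [|n IH] x /=; first by rewrite lexx ler01.
have /andP[a b] := IH (dbl (dbl x)).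
by case: (bit x) => /=; apply/andP; split; lra.
Qed.

Lemma digits_nd x : nondecreasing_seq (digits ^~ x).
Proof.
apply/nondecreasing_seqP => n; elim: n x => [|n IH] x.
  by have /andP[] := digits_itv 1 x.
by rewrite [leRHS]/= [leLHS]/= ler_pM2r ?invr_gt0// lerD2l IH.
Qed.

Lemma digits_cvg x : digits n x @[n --> \oo] --> half1 x.
Proof.
apply: nondecreasing_is_cvgn; first exact: digits_nd.
by exists 1 => _ [n _ <-]; have /andP[] := digits_itv n x.
Qed.

Lemma half1_itv x : 0 <= half1 x <= 1.
Proof.
have c : cvgn (digits ^~ x) by apply/cvg_ex; exists (half1 x); exact: digits_cvg.
apply/andP; split.
  by apply: limr_ge c _; apply: nearW => n; have /andP[] := digits_itv n x.
by apply: limr_le c _; apply: nearW => n; have /andP[] := digits_itv n x.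
Qed.

Lemma half1E x : half1 x = ((bit x)%:R + half2 (dbl x)) / 2.
Proof.
have L : digits n.+1 x @[n --> \oo] --> half1 x.
  by have := @digits_cvg x; rewrite -(cvg_shiftS (digits ^~ x)).
apply: (cvg_unique (@Rhausdorff R) L).
apply: cvgMl; apply: cvgD; first exact: cvg_cst.
exact: digits_cvg.
Qed.

Lemma measurable_digits n : measurable_fun setT (digits n).
Proof.
elim: n => [|n IH] /=; first exact: measurable_cst.
apply: measurable_funM => //; apply: measurable_funD.
  rewrite (_ : (fun x => _) = \1_[set x : R | bit x = true]).
    by apply: measurable_indic; exact: measurable_bit.
  by apply/funext => x; exact: bitE.
exact: measurableT_comp IH (measurableT_comp measurable_dbl measurable_dbl).
Qed.

Lemma measurable_half1 : measurable_fun setT half1.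
Proof.
by apply: (measurable_fun_cvg measurable_digits) => x _; exact: digits_cvg.
Qed.

Lemma measurable_half2 : measurable_fun setT half2.
Proof. exact: measurableT_comp measurable_half1 measurable_dbl. Qed.

(** Prefixing a digit p to the argument. It halves the Lipschitz constant, which drives the
    contraction arguments below. *)
Let shrink (p : bool) f x := f ((p%:R + x) / 2).

Let measurable_shrink p f : measurable_fun setT f -> measurable_fun setT (shrink p f).
Proof.
move=> mf; apply: measurableT_comp mf _; apply: measurable_funM => //.
exact: measurable_funD.
Qed.

Let shrink_lipschitz p f (L : R) : (forall x y, `|f x - f y| <= L * `|x - y|) ->
  forall x y, `|shrink p f x - shrink p f y| <= (L / 2) * `|x - y|.
Proof.
move=> fL x y; apply: le_trans (fL _ _) _; rewrite -mulrA.
have -> : (p%:R + x) / 2 - (p%:R + y) / 2 = 2^-1 * (x - y) by field.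
by rewrite normrM ger0_norm ?invr_ge0.
Qed.

Let le1M (a b : R) : `|a| <= 1 -> `|b| <= 1 -> `|a * b| <= 1.
Proof. by move=> a1 b1; rewrite normrM -[leRHS]mulr1; exact: ler_pM. Qed.

(** Averaging over the first digit of x: in terms of the shifted variable, the first half becomes
    (digit + second half) / 2 and the second half becomes the first. The halves exchange their roles
    and f is shrunk. *)
Let step1 f g : measurable_fun setT f -> measurable_fun setT g ->
  (forall x, `|f x| <= 1) -> (forall x, `|g x| <= 1) ->
  \int[U]_x (f (half1 x) * g (half2 x)) =
  (\int[U]_x (shrink false f (half2 x) * g (half1 x)) +
   \int[U]_x (shrink true f (half2 x) * g (half1 x))) / 2.
Proof.
move=> mf mg f1 g1.
rewrite -(@expect_dbl _ (fun p x => shrink p f (half2 x) * g (half1 x))).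
- by apply: eq_Rintegral => x _; rewrite half1E.
- move=> p; apply: measurable_funM; last exact: measurableT_comp mg measurable_half1.
  exact: measurableT_comp (measurable_shrink p mf) measurable_half2.
- by move=> p x; (apply: le1M; [exact: f1|exact: g1]).
Qed.

Let step2 f g : measurable_fun setT f -> measurable_fun setT g ->
  (forall x, `|f x| <= 1) -> (forall x, `|g x| <= 1) ->
  \int[U]_x (f (half2 x) * g (half1 x)) =
  (\int[U]_x (f (half1 x) * shrink false g (half2 x)) +
   \int[U]_x (f (half1 x) * shrink true g (half2 x))) / 2.
Proof.
move=> mf mg f1 g1.
rewrite -(@expect_dbl _ (fun p x => f (half1 x) * shrink p g (half2 x))).
- by apply: eq_Rintegral => x _; rewrite (half1E x).
- move=> p; apply: measurable_funM; first exact: measurableT_comp mf measurable_half1.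
  exact: measurableT_comp (measurable_shrink p mg) measurable_half2.
- by move=> p x; (apply: le1M; [exact: f1|exact: g1]).
Qed.

Let half2_half1 f : measurable_fun setT f -> (forall x, `|f x| <= 1) ->
  \int[U]_x f (half2 x) = \int[U]_x f (half1 x).
Proof.
move=> mf f1.
have one1 (x : R) : `|1 : R| <= 1 by rewrite normr1.
have H1 (A : R -> R) : \int[U]_x (f (A x) * 1) = \int[U]_x f (A x).
  by apply: eq_Rintegral => x _; rewrite mulr1.
have := @step2 f (fun=> 1) mf (measurable_cst _) f1 one1.
by rewrite /shrink !H1 => ->; field.
Qed.

Let half1_shrink f : measurable_fun setT f -> (forall x, `|f x| <= 1) ->
  \int[U]_x f (half1 x) = (\int[U]_x shrink false f (half1 x) +
                           \int[U]_x shrink true f (half1 x)) / 2.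
Proof.
move=> mf f1; have one1 (x : R) : `|1 : R| <= 1 by rewrite normr1.
have H1 (g A : R -> R) : \int[U]_x (g (A x) * 1) = \int[U]_x g (A x).
  by apply: eq_Rintegral => x _; rewrite mulr1.
have := @step1 f (fun=> 1) mf (measurable_cst _) f1 one1.
rewrite !H1 => ->; have mfp p := measurable_shrink p mf.
by rewrite !half2_half1// => x; exact: f1.
Qed.

Let bint f (A : R -> R) : measurable_fun setT f -> measurable_fun setT A ->
  (forall x, `|f x| <= 1) -> U.-integrable setT (EFin \o (fun x => f (A x))).
Proof.
move=> mf mA f1; apply: (@bounded_integrable _ _ _ U _ 1) => [|x]; last exact: f1.
exact: measurableT_comp.
Qed.

Let bintM f g (A B : R -> R) : measurable_fun setT f -> measurable_fun setT A ->
  (forall x, `|f x| <= 1) -> measurable_fun setT g -> measurable_fun setT B ->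
  (forall x, `|g x| <= 1) -> U.-integrable setT (EFin \o (fun x => f (A x) * g (B x))).
Proof.
move=> mf mA f1 mg mB g1; apply: (@bounded_integrable _ _ _ U _ 1) => [|x];
  last (apply: le1M; [exact: f1|exact: g1]).
by apply: measurable_funM; exact: measurableT_comp.
Qed.

Let expect_le1 f (A : R -> R) : measurable_fun setT f -> measurable_fun setT A ->
  (forall x, `|f x| <= 1) -> `|\int[U]_x f (A x)| <= 1.
Proof.
move=> mf mA f1; have i0 (a : R) : U.-integrable setT (EFin \o (fun=> a)).
  by apply: (@bounded_integrable _ _ _ U _ `|a|) => // x.
have := expect_dist_le (bint mf mA f1) (i0 0) (i0 1).
by rewrite !expect_cst subr0; apply => x; rewrite subr0.
Qed.

(** After [step1] and [step2] the covariance is the average of the four covariances of shrunk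
    functions, since the product of the means splits in the same way. Each round halves the constant
    of f. At n = 0, replacing f by its value at 0 costs L in each of the two terms. *)
Let cov_half f g n (L : R) : measurable_fun setT f -> measurable_fun setT g ->
  (forall x, `|f x| <= 1) -> (forall x, `|g x| <= 1) ->
  (forall x y, `|f x - f y| <= L * `|x - y|) ->
  `|\int[U]_x (f (half1 x) * g (half2 x)) -
    \int[U]_x f (half1 x) * \int[U]_x g (half2 x)| <= 2 * L / 2 ^+ n.
Proof.
elim: n f g L => [|n IH] f g L mf mg f1 g1 fL.
  have L0 : 0 <= L by have := le_trans (normr_ge0 _) (fL 1 0); rewrite subr0 normr1 mulr1.
  have i0 (a : R) : U.-integrable setT (EFin \o (fun=> a)).
    by apply: (@bounded_integrable _ _ _ U _ `|a|) => // x.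
  have fA x : `|f (half1 x) - f 0| <= L.
    apply: le_trans (fL _ _) _; rewrite subr0 ler_piMr//.
    by have /andP[? ?] := half1_itv x; rewrite ger0_norm.
  have ig := bint mg measurable_half2 g1.
  have h1 : `|\int[U]_x (f (half1 x) * g (half2 x)) - \int[U]_x (f 0 * g (half2 x))| <= L.
    rewrite -(expect_cst U L); apply: expect_dist_le => //.
    - exact: bintM mf measurable_half1 f1 mg measurable_half2 g1.
    - exact: integrableZlR.
    - move=> x; rewrite -mulrBl normrM; apply: le_trans (fA x).
      by rewrite ler_piMr.
  have h2 : `|\int[U]_x f (half1 x) - f 0| <= L.
    rewrite -{1}(expect_cst U (f 0)) -(expect_cst U L); apply: expect_dist_le => //.
    exact: bint mf measurable_half1 f1.
  rewrite expr0 divr1; rewrite RintegralZl// in h1.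
  have -> : \int[U]_x (f (half1 x) * g (half2 x)) -
    \int[U]_x f (half1 x) * \int[U]_x g (half2 x) =
    (\int[U]_x (f (half1 x) * g (half2 x)) - f 0 * \int[U]_x g (half2 x)) -
    (\int[U]_x f (half1 x) - f 0) * \int[U]_x g (half2 x) by ring.
  have -> : 2 * L = L + L by ring.
  apply: le_trans (ler_normB _ _) _; rewrite lerD// normrM.
  apply: le_trans h2; rewrite ler_piMr//.
  exact: expect_le1 mg measurable_half2 g1.
have mfp p := measurable_shrink p mf.
have mgp p := measurable_shrink p mg.
have fp1 p x : `|shrink p f x| <= 1 by exact: f1.
have gp1 p x : `|shrink p g x| <= 1 by exact: g1.
have fpL p := shrink_lipschitz p fL.
rewrite step1// !step2// half1_shrink// (half2_half1 mg g1) (half1_shrink mg g1).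
rewrite -!(half2_half1 (mgp _) (gp1 _)).
have := IH _ _ _ (mfp false) (mgp false) (fp1 false) (gp1 false) (fpL false).
have := IH _ _ _ (mfp false) (mgp true) (fp1 false) (gp1 true) (fpL false).
have := IH _ _ _ (mfp true) (mgp false) (fp1 true) (gp1 false) (fpL true).
have := IH _ _ _ (mfp true) (mgp true) (fp1 true) (gp1 true) (fpL true).
have -> : 2 * L / 2 ^+ n.+1 = 2 * (L / 2) / 2 ^+ n.
  by rewrite exprS; field; rewrite expf_neq0.
move: (2 * (L / 2) / 2 ^+ n) => K.
move: (\int[U]_x (shrink true f (half1 x) * shrink true g (half2 x))) => ftt.
move: (\int[U]_x (shrink true f (half1 x) * shrink false g (half2 x))) => ftf.
move: (\int[U]_x (shrink false f (half1 x) * shrink true g (half2 x))) => fft.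
move: (\int[U]_x (shrink false f (half1 x) * shrink false g (half2 x))) => fff.
move: (\int[U]_x shrink true f (half1 x)) (\int[U]_x shrink false f (half1 x)) => ft ff.
move: (\int[U]_x shrink true g (half2 x)) (\int[U]_x shrink false g (half2 x)) => gt gf.
rewrite !ler_norml => /andP[? ?] /andP[? ?] /andP[? ?] /andP[? ?].
by apply/andP; split; lra.
Qed.

Let pow2_small (K e : R) : 0 < e -> exists n, K / 2 ^+ n <= e.
Proof.
move=> e0; exists (Num.truncn (K / e)); rewrite ler_pdivrMr ?exprn_gt0//.
rewrite -ler_pdivrMl// mulrC; apply: (@le_trans _ _ (Num.truncn (K / e)).+1%:R).
  by apply/ltW; rewrite truncnS_gt.
by rewrite -natrX ler_nat ltn_expl.
Qed.

Let eq_of_dist (a b K : R) : (forall n, `|a - b| <= K / 2 ^+ n) -> a = b.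
Proof.
move=> H; apply/eqP; rewrite -subr_eq0 -normr_le0; apply/ler_addgt0Pl => e e0.
by have [n Hn] := pow2_small K e0; rewrite addr0; exact: le_trans (H n) Hn.
Qed.

Lemma expect_half_lipschitz f g (L : R) : measurable_fun setT f ->
  measurable_fun setT g -> (forall x, `|f x| <= 1) -> (forall x, `|g x| <= 1) ->
  (forall x y, `|f x - f y| <= L * `|x - y|) ->
  \int[U]_x (f (half1 x) * g (half2 x)) =
  \int[U]_x f (half1 x) * \int[U]_x g (half2 x).
Proof.
by move=> mf mg f1 g1 fL; apply: (@eq_of_dist _ _ (2 * L)) => n; exact: cov_half.
Qed.

(** The uniform variable x lies in [0, 1] only almost surely; clamping makes its distance to
    [half1 x] at most 1 everywhere without changing integrals. *)
Let clamp x : R := Num.max 0 (Num.min 1 x).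

Let clamp_itv x : 0 <= clamp x <= 1.
Proof.
rewrite /clamp; case: (lerP 1 x) => h1; first by rewrite max_r ?ler01// lexx.
by case: (lerP 0 x) => h2; rewrite ?lexx ?ler01// h2 ltW.
Qed.

Let clamp_id x : 0 <= x <= 1 -> clamp x = x.
Proof. by move=> /andP[x0 x1]; rewrite /clamp min_r// max_r. Qed.

Let measurable_clamp : measurable_fun setT clamp.
Proof. by apply: measurable_maxr => //; exact: measurable_minr. Qed.

Let expect_clamp f : measurable_fun setT f -> (forall x, `|f x| <= 1) ->
  \int[U]_x f (clamp x) = \int[U]_x f x.
Proof.
move=> mf f1; apply: (@Rintegral_equal_law R _ _ _ _ U U clamp id) => //.
- move=> B mB; have mcB : measurable (clamp @^-1` B).
    by rewrite -[X in measurable X]setTI; exact: measurable_clamp.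
  rewrite [LHS]uniform01E// [RHS]uniform01E//; congr (lebesgue_measure _).
  by apply/seteqP; split => x [/= Bx]; rewrite in_itv/= => x01; split=> //;
    move: Bx; rewrite clamp_id.
- exact: (@bint f id).
Qed.

(** The laws of [half1] and of the uniform variable are both invariant under prefixing a fair digit,
    so their difference on f is an average of differences on shrunk functions. *)
Let law_half f n (L : R) : measurable_fun setT f -> (forall x, `|f x| <= 1) ->
  (forall x y, `|f x - f y| <= L * `|x - y|) ->
  `|\int[U]_x f (half1 x) - \int[U]_x f x| <= L / 2 ^+ n.
Proof.
elim: n f L => [|n IH] f L mf f1 fL.
  have L0 : 0 <= L by have := le_trans (normr_ge0 _) (fL 1 0); rewrite subr0 normr1 mulr1.
  rewrite expr0 divr1 -(expect_clamp mf f1) -{1}(expect_cst U L).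
  apply: expect_dist_le => [||//|x].
  - exact: bint mf measurable_half1 f1.
  - exact: bint mf measurable_clamp f1.
  - by apply: (@bounded_integrable _ _ _ U _ `|L|) => // x.
  - apply: le_trans (fL _ _) _; rewrite ler_piMr// ler_norml.
    by have /andP[? ?] := half1_itv x; have /andP[? ?] := clamp_itv x; apply/andP; split; lra.
have mfp p := measurable_shrink p mf.
have fp1 p x : `|shrink p f x| <= 1 by exact: f1.
have fpL p := shrink_lipschitz p fL.
have -> : \int[U]_x f x = (\int[U]_x shrink false f x + \int[U]_x shrink true f x) / 2.
  rewrite -(@expect_dbl _ (fun p x => shrink p f x))//.
  by apply: eq_Rintegral => x _; rewrite /shrink bit_dblK.
rewrite half1_shrink//.
have := IH _ _ (mfp false) (fp1 false) (fpL false).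
have := IH _ _ (mfp true) (fp1 true) (fpL true).
have -> : L / 2 ^+ n.+1 = (L / 2) / 2 ^+ n.
  by rewrite exprS; field; rewrite expf_neq0.
move: (L / 2 / 2 ^+ n) => K; rewrite !ler_norml => /andP[? ?] /andP[? ?].
by apply/andP; split; lra.
Qed.

Lemma half1_uniform (B : set R) : measurable B -> U (half1 @^-1` B) = U B.
Proof.
move=> mB; have := @law_determined _ _ _ _ _ U U half1 id setT 1 measurable_half1
  (@measurable_id _ _ _) measurableT ler01.
move=> /(_ _ B mB); rewrite setIT mul1e; apply => f L f01 mf fL.
under eq_Rintegral do rewrite indicT mulr1.
have f1 x : `|f x| <= 1 by have /andP[? ?] := f01 x; rewrite ger0_norm.
by rewrite mul1r; apply: (@eq_of_dist _ _ L) => n; exact: law_half.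
Qed.

Lemma expect_half1 f : measurable_fun setT f -> (forall x, `|f x| <= 1) ->
  \int[U]_x f (half1 x) = \int[U]_x f x.
Proof.
move=> mf f1; apply: (@Rintegral_equal_law R _ _ _ _ U U half1 id) => //.
- exact: measurable_half1.
- exact: half1_uniform.
- exact: (@bint f id).
Qed.

(** [expect_half_lipschitz] with g an indicator gives the law of [half1] on an event of [half2]; two
    passages from indicators to bounded functions then treat f and g. *)
Lemma expect_half f g : measurable_fun setT f -> measurable_fun setT g ->
  (forall x, `|f x| <= 1) -> (forall x, `|g x| <= 1) ->
  \int[U]_x (f (half1 x) * g (half2 x)) = \int[U]_x f x * \int[U]_x g x.
Proof.
move=> mf mg f1 g1; have m1 := measurable_half1; have m2 := measurable_half2.
have HB (B : set R) : measurable B ->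
    \int[U]_x (f (half1 x) * \1_(half2 @^-1` B) x) =
    fine (U (half2 @^-1` B)) * \int[U]_x f (half1 x).
  move=> mB; have mE : measurable (half2 @^-1` B).
    by rewrite -[X in measurable X]setTI; exact: m2.
  have c0 : 0 <= fine (U (half2 @^-1` B)) by rewrite fine_ge0.
  apply: (@bounded_Rintegral_law _ _ _ _ _ U U _ _ half1 half1) => //.
  - by move=> w; rewrite indicE; case: (_ \in _); rewrite ?normr1 ?normr0.
  - move=> B1 mB1; have mE1 : measurable (half1 @^-1` B1).
      by rewrite -[X in measurable X]setTI; exact: m1.
    have := @law_determined _ _ _ _ _ U U half1 half1 _ _ m1 m1 mE c0 _ B1 mB1.
    move=> /(_ _)/(congr1 fine); rewrite fineM ?fin_num_measure//= => <-.
      rewrite /Rintegral (_ : (fun w => _) =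
        (EFin \o \1_(half1 @^-1` B1 `&` half2 @^-1` B))).
        by rewrite integral_indic ?setIT//; exact: measurableI.
      apply/funext => w /=; rewrite !indicE in_setI -natrM mulnb.
      by congr (nat_of_bool (_ && _))%:R%:E; apply/idP/idP => /[!inE].
    move=> h L h01 mh hL; have h1 x : `|h x| <= 1.
      by have /andP[? ?] := h01 x; rewrite ger0_norm.
    have mI : measurable_fun setT (\1_B : R -> R) by exact: measurable_indic.
    have I1 x : `|\1_B x : R| <= 1.
      by rewrite indicE; case: (_ \in _); rewrite ?normr1 ?normr0.
    have := @expect_half_lipschitz h \1_B L mh mI h1 I1 hL.
    rewrite [X in _ = _ * X](_ : _ = fine (U (half2 @^-1` B))); last first.
      rewrite /Rintegral (_ : (fun w => _) = (EFin \o \1_(half2 @^-1` B)))//.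
      by rewrite integral_indic ?setIT.
    by rewrite mulrC => <-.
rewrite -(expect_half1 mf f1) -(expect_half1 mg g1) -(half2_half1 mg g1) .
under eq_Rintegral do rewrite mulrC.
apply: (@bounded_Rintegral_law _ _ _ _ _ U U _ _ half2 half2) => //.
  exact: measurableT_comp mf m1.
move=> B mB; rewrite mulrC -HB//.
by apply: eq_Rintegral => x _; rewrite mulrC.
Qed.

End splitting_a_uniform_variable.

(** * Gaussian families *)

Section quantile_transform.
Context {R : realType} {d : measure_display} {S : measurableType d}.
Variables (N : probability S R) (G : {RV N >-> R}).
Local Notation U := (uniform_prob (@ltr01 R) : probability _ R).

Let F x : R := fine (cdf G x).

Let FE x : (F x)%:E = cdf G x.
Proof.
rewrite fineK// ge0_fin_numE ?cdf_ge0//.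
by apply: le_lt_trans (cdf_le1 _ _) _; exact: ltry.
Qed.

Let F_nd x y : x <= y -> F x <= F y.
Proof. by move=> xy; rewrite -lee_fin !FE; exact: cdf_nondecreasing. Qed.

Let F01 x : 0 <= F x <= 1.
Proof. by rewrite -!lee_fin FE cdf_ge0 cdf_le1. Qed.

Let F_rc x : F y @[y --> x^'+] --> F x.
Proof. by apply: fine_cvg; rewrite FE; exact: cdf_right_continuous. Qed.

Let Fy : F x @[x --> +oo] --> (1 : R).
Proof. by apply: fine_cvg; exact: cvg_cdfy1. Qed.

Let FNy : F x @[x --> -oo] --> (0 : R).
Proof. by apply: fine_cvg; exact: cvg_cdfNy0. Qed.

Definition quantile (u : R) : R :=
  if (0 < u) && (u < 1) then inf [set x | u <= F x] else 0.

(** Right continuity of the distribution function F gives the converse: if F x < u, then F stays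
    below u a little beyond x, so the infimum is strictly larger than x. *)
Lemma quantile_gt u x : 0 < u < 1 -> (x < quantile u) = (F x < u).
Proof.
move=> u01; rewrite /quantile u01; case/andP: u01 => u0 u1.
set Su := [set x | _].
have [y yu] : exists y, u <= F y := filter_ex (cvgr_ge _ Fy _ u1).
have [l lu] : exists l, F l < u := filter_ex (cvgr_lt _ FNy _ u0).
have Sl : has_lbound Su.
  exists l => z /= uz; rewrite leNgt; apply/negP => /ltW/F_nd zl.
  by have := le_lt_trans (le_trans uz zl) lu; rewrite ltxx.
apply/idP/idP => [xq|Fxu].
  rewrite ltNge; apply/negP => uF; move: xq; rewrite ltNge => /negP; apply.
  exact: ge_inf.
have : \forall z \near x^'+, x < z /\ F z < u.
  near=> z; split; first by near: z; exact: nbhs_right_gt.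
  by near: z; exact: (cvgr_lt _ (@F_rc x)).
move=> /filter_ex[z [xz zu]].
apply: lt_le_trans xz _; apply: lb_le_inf; first by exists y.
move=> w /= uw; rewrite leNgt; apply/negP => /ltW/F_nd wz.
by have := le_lt_trans (le_trans uw wz) zu; rewrite ltxx.
Unshelve. all: by end_near. Qed.

Lemma measurable_quantile : measurable_fun setT quantile.
Proof.
have mD : measurable [set u : R | (0 < u) && (u < 1)].
  by rewrite (_ : [set _ | _] = `]0, 1[%classic)//; apply/seteqP; split => u /=; rewrite in_itv.
have -> : quantile = (fun u => quantile u * \1_[set u : R | (0 < u) && (u < 1)] u).
  apply/funext => u; rewrite indicE; have [u01|u01] := boolP ((0 < u) && (u < 1)).
    by rewrite mem_set ?mulr1.
  by rewrite /quantile (negbTE u01) mul0r.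
apply: (measurability _ (RGenOInfty.measurableE R)) => // _ [_ [x ->] <-].
rewrite setTI; set V := _ @^-1` _.
have -> : V = ([set u : R | (0 < u) && (u < 1)] `&` `]F x, +oo[) `|`
    (~` [set u : R | (0 < u) && (u < 1)] `&` [set u : R | x < 0]).
  apply/seteqP; split => u; rewrite /V /= in_itv/= andbT indicE.
    have [u01|u01] := boolP ((0 < u) && (u < 1)).
      by rewrite mem_set// mulr1 quantile_gt// => Fu; left; rewrite in_itv/= andbT.
    have nu : ~ ((0 < u) && (u < 1)) by exact/negP.
    by rewrite memNset// mulr0 => x0; right.
  rewrite in_itv/= andbT => -[[u01 Fu]|[u01 x0]].
    by rewrite mem_set// mulr1 quantile_gt.
  by rewrite memNset// mulr0.
apply: measurableU; first by apply: measurableI mD _; exact: measurable_itv.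
apply: measurableI; first exact: measurableC.
case: (x < 0); first by rewrite (_ : [set _ | _] = setT)//; apply/seteqP; split.
by rewrite (_ : [set _ | _] = set0)//; apply/seteqP; split.
Qed.

Lemma quantile_law (B : set R) : measurable B -> U (quantile @^-1` B) = N (G @^-1` B).
Proof.
move=> mB; have mE : measurable (`]0, 1[%classic : set R) by exact: measurable_itv.
have mq := measurable_quantile.
have mqB : measurable (quantile @^-1` B) by rewrite -[X in measurable X]setTI; exact: mq.
have U01 : U `]0, 1[%classic = 1%E.
  rewrite (@uniform01_itv _ _ false true 0 1) ?subr0//.
  by apply/setIidl => x /=; rewrite !in_itv/= => /andP[/ltW-> /ltW->].
have -> : U (quantile @^-1` B) = U (quantile @^-1` B `&` `]0, 1[%classic).
  have mC : measurable (~` (`]0, 1[%classic : set R)) by exact: measurableC.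
  have UC : U (~` `]0, 1[%classic) = 0%E by rewrite probability_setC// U01 subee.
  rewrite [LHS](measureDI U mqB mE) [X in (X + _)%E](_ : _ = 0%E) ?add0e//.
  apply/eqP; rewrite eq_le measure_ge0 andbT -UC.
  by apply: le_measure; rewrite ?inE//; exact: measurableD.
rewrite -[RHS]mul1e.
have -> : 1%E = (1 : R)%:E by [].
apply: (@law_rays _ _ _ _ _ U N quantile G `]0, 1[%classic 1 mq _ mE ler01) => // a.
rewrite mul1e; have /andP[F0 F1] := F01 a.
have VE : quantile @^-1` `]a, +oo[ `&` `]0, 1[ = `]F a, 1[%classic.
  apply/seteqP; split => u /=; rewrite !in_itv/= andbT.
    by move=> [au u01]; rewrite -quantile_gt// au; case/andP: u01.
  move=> /andP[Fu u1]; have u01 : 0 < u < 1 by rewrite u1 (le_lt_trans F0).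
  by rewrite quantile_gt.
rewrite VE (@uniform01_itv _ _ false true (F a) 1)//; last first.
  apply/setIidl => u /=; rewrite !in_itv/= => /andP[Fu u1].
  by rewrite (ltW u1) (le_trans F0 (ltW Fu)).
have mGa : measurable (G @^-1` `]-oo, a]%classic).
  by rewrite -[X in measurable X]setTI; exact: measurable_funP.
rewrite EFinB FE /cdf /distribution /pushforward/=.
rewrite -[X in (X - _)%E](@probability_setT _ _ _ N).
rewrite -(setUv (G @^-1` `]-oo, a]%classic)) measureU//; last 2 first.
- exact: measurableC.
- exact: setICr.
rewrite addeAC subee ?add0e ?fin_num_measure//.
by congr (N _); rewrite preimage_setC setCitvl.
Qed.

End quantile_transform.

(** Iterated splitting of one uniform variable: [half1] gives the current variable, [half2] the
    independent uniform remainder, and the quantile function makes each one standard normal. Joint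
    independence is recorded as the product form of the cosine integrals. *)
Lemma gaussian_sequence {R : realType} :
  exists (d : measure_display) (S : measurableType d) (Q : probability S R)
    (xi : nat -> S -> R), [/\ forall k, measurable_fun setT (xi k),
    forall k, Q.-integrable setT (EFin \o (fun w => xi k w ^+ 2)) &
    forall n (u : nat -> R) b, \int[Q]_w cos (\sum_(k < n) u k * xi k w + b) =
      cos b * \prod_(k < n) expR (- (u k ^+ 2 / 2))].
Proof.
pose U := (uniform_prob (@ltr01 R) : probability _ R).
have [d [S [N [G0 [mG iG _ _ [Gcos _]]]]]] := gaussian_law_model (1 : R).
pose G : {RV N >-> R} := HB.pack G0 (isMeasurableFun.Build _ _ _ _ G0 mG).
pose q := quantile G; have mq : measurable_fun setT q := measurable_quantile G.
have mh1 := @measurable_half1 R; have mh2 := @measurable_half2 R.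
pose xi k x := q (half1 (iter k half2 x)).
have mit k : measurable_fun setT (iter k (@half2 R)).
  elim: k => [|k IH]; first exact: measurable_id.
  exact: measurableT_comp mh2 IH.
have mxi k : measurable_fun setT (xi k).
  exact: measurableT_comp mq (measurableT_comp mh1 (mit k)).
have Uh2 (B : set R) : measurable B -> U (@half2 R @^-1` B) = U B.
  move=> mB; have mI : measurable_fun setT (\1_B : R -> R) by exact: measurable_indic.
  have I1 x : `|\1_B x : R| <= 1.
    by rewrite indicE; case: (_ \in _); rewrite ?normr1 ?normr0.
  have one1 (x : R) : `|1 : R| <= 1 by rewrite normr1.
  have mhB : measurable (@half2 R @^-1` B).
    by rewrite -[X in measurable X]setTI; exact: mh2.
  have := @expect_half R (fun=> 1) \1_B (measurable_cst _) mI one1 I1.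
  under eq_Rintegral do rewrite mul1r.
  rewrite expect_cst mul1r /Rintegral.
  rewrite (_ : (fun x => _) = (EFin \o \1_(@half2 R @^-1` B)))//.
  rewrite !integral_indic ?setIT// => /(congr1 (@EFin R)).
  by rewrite !fineK// fin_num_measure.
have Uit k (B : set R) : measurable B -> U (iter k (@half2 R) @^-1` B) = U B.
  elim: k B => [//|k IH] B mB; rewrite -[RHS]Uh2// -[RHS](IH (@half2 R @^-1` B))//.
  by rewrite -[X in measurable X]setTI; exact: mh2.
have Uxi k (B : set R) : measurable B -> U (xi k @^-1` B) = N (G0 @^-1` B).
  move=> mB; have mqB : measurable (q @^-1` B).
    by rewrite -[X in measurable X]setTI; exact: mq.
  have mhB : measurable (@half1 R @^-1` (q @^-1` B)).
    by rewrite -[X in measurable X]setTI; exact: mh1.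
  transitivity (U (iter k (@half2 R) @^-1` (@half1 R @^-1` (q @^-1` B)))); first by [].
  by rewrite [LHS]Uit// [LHS]half1_uniform//; exact: quantile_law.
exists _, _, U, xi; split=> //.
  move=> k; apply: (@integrable_equal_law R _ _ _ _ U N (xi k) G0 (mxi k) mG (Uxi k)
    (fun x => x ^+ 2)) => //.
have qcos u b : \int[U]_x cos (u * q x + b) = cos b * expR (- (u ^+ 2 / 2)).
  rewrite (@Rintegral_equal_law R _ _ _ _ U N q G0 mq mG _ (fun x => cos (u * x + b))).
  - by rewrite Gcos expr1n mul1r.
  - by move=> B mB; exact: quantile_law.
  - by apply: measurable_cos; apply: measurable_funD => //; exact: measurable_funM.
  - apply: (@bounded_integrable _ _ _ N _ 1) => [|x]; last exact: cos_max.
    by apply: measurable_cos; apply: measurable_funD => //; exact: measurable_funM.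
elim=> [|n IH] u b.
  under eq_Rintegral do rewrite big_ord0 add0r.
  by rewrite expect_cst big_ord0 mulr1.
pose v k := u k.+1.
pose H x := \sum_(k < n) v k * xi k x.
have mH : measurable_fun setT H by apply: measurable_sum => k; exact: measurable_funM.
have E x : \sum_(k < n.+1) u k * xi k x + b = (u 0%N * q (half1 x) + b) + H (half2 x).
  rewrite big_ord_recl/= addrAC; congr (_ + _); apply: eq_bigr => k _.
  by rewrite /xi /= -iterSr.
have m1 : measurable_fun setT (fun x => u 0%N * q x + b).
  by apply: measurable_funD => //; exact: measurable_funM.
have msin := continuous_measurable_fun (@continuous_sin R).
have mc1 := measurable_cos m1; have ms1 := measurableT_comp msin m1.
have mc2 := measurable_cos mH; have ms2 := measurableT_comp msin mH.
have IHc : \int[U]_x cos (H x) = \prod_(k < n) expR (- (v k ^+ 2 / 2)).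
  by have := IH v 0; under eq_Rintegral do rewrite addr0; rewrite cos0 mul1r.
(* The induction hypothesis at phase - pi / 2; it kills the sine term of the addition formula. *)
have IHs : \int[U]_x sin (H x) = 0.
  have := IH v (- (pi / 2)); under eq_Rintegral do rewrite cosBpihalf.
  by rewrite cosN cos_pihalf mul0r.
have cm := @cos_max R; have sm := @sin_max R.
transitivity (\int[U]_x (cos (u 0%N * q (half1 x) + b) * cos (H (half2 x)) -
                         sin (u 0%N * q (half1 x) + b) * sin (H (half2 x)))).
  by apply: eq_Rintegral => x _; rewrite E cosD.
have ic (f g : R -> R) : measurable_fun setT f -> measurable_fun setT g ->
    (forall x : R, `|f x| <= 1) -> (forall x : R, `|g x| <= 1) ->
    U.-integrable setT (EFin \o (fun x : R => f (half1 x) * g (half2 x) : R)).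
  move=> mf mg f1 g1; apply: (@bounded_integrable _ _ _ U _ 1) => [|x].
    by apply: measurable_funM; [exact: measurableT_comp mf mh1|exact: measurableT_comp mg mh2].
  by rewrite normrM -[leRHS]mulr1; apply: ler_pM.
rewrite RintegralB//; last 2 first.
- exact: (ic _ _ mc1 mc2 (fun=> cm _) (fun=> cm _)).
- exact: (ic _ _ ms1 ms2 (fun=> sm _) (fun=> sm _)).
rewrite (expect_half mc1 mc2 (fun=> cm _) (fun=> cm _)).
rewrite (expect_half ms1 ms2 (fun=> sm _) (fun=> sm _)) IHs mulr0 subr0 qcos IHc.
by rewrite big_ord_recl mulrA.
Qed.

Lemma integrable_sqr_sum {R : realType} {d : measure_display} {S : measurableType d}
    (Q : probability S R) I (s : seq I) (X : I -> S -> R) :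
  (forall i, measurable_fun setT (X i)) ->
  (forall i, Q.-integrable setT (EFin \o (fun w => X i w ^+ 2))) ->
  Q.-integrable setT (EFin \o (fun w => (\sum_(i <- s) X i w) ^+ 2)).
Proof.
move=> mX iX; elim: s => [|i s IH].
  apply: (@bounded_integrable _ _ _ _ _ 0) => [|w]; last by rewrite big_nil expr0n normr0.
  by under eq_fun do rewrite big_nil; exact: measurable_cst.
apply: le_integrable (integrableDR (integrableZlR 2 (iX i)) (integrableZlR 2 IH)) => //.
  by apply/measurable_EFinP; apply: measurable_funX; exact: measurable_sum.
move=> w _; rewrite /= big_cons lee_fin ger0_norm ?sqr_ge0//.
apply: le_trans (ler_norm _); move: (X i w) (\sum_(_ <- s) _) => a b.
by have := sqr_ge0 (a - b); nra.
Qed.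

(** * Prescribed covariances by Cholesky factorization *)

Section gram_schmidt.
Context {R : realType} {d0 : measure_display} {Omega0 : measurableType d0}.
Variables (P0 : probability Omega0 R) (tau : nat -> Omega0 -> R).
Hypothesis mtau : forall i, measurable_fun setT (tau i).
Hypothesis tau_bounded : forall i, exists M, forall w, `|tau i w| <= M.

Let dotp (f g : Omega0 -> R) : R := \int[P0]_w (f w * g w).

(** Gram-Schmidt in L^2: what is left of tau_i after projection off the first k variables. The
    matrices [gram k] are the successive Schur complements; a null pivot gives coefficient 0. *)
Fixpoint resid (k i : nat) : Omega0 -> R :=
  if k is m.+1 then
    fun w => resid m i w -
      (dotp (resid m i) (resid m m) / dotp (resid m m) (resid m m)) * resid m m w
  else tau i.

Let gram k i j := dotp (resid k i) (resid k j).

(* The Cholesky coefficients of the Gram matrix of tau; a column with zero    *)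
(* pivot vanishes since x / 0 = 0.                                            *)
Definition chol (i k : nat) : R := gram k i k / Num.sqrt (gram k k k).

Let bounded_meas (f : Omega0 -> R) :=
  measurable_fun setT f /\ exists M, forall w, `|f w| <= M.

Let bm_resid k i : bounded_meas (resid k i).
Proof.
elim: k i => [|k IH] i /=; first by split.
have [m1 [M1 H1]] := IH i; have [m2 [M2 H2]] := IH k.
set a := _ / _; split.
  by apply: measurable_funB => //; exact: measurable_funM.
exists (M1 + `|a| * M2) => w; apply: le_trans (ler_normB _ _) _.
by rewrite lerD// normrM ler_wpM2l.
Qed.

Let integrable_prod f g : bounded_meas f -> bounded_meas g ->
  P0.-integrable setT (EFin \o (fun w => f w * g w)).
Proof.
move=> [mf [M HM]] [mg [K HK]]; apply: (@bounded_integrable _ _ _ _ _ (M * K)).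
  exact: measurable_funM.
by move=> w; rewrite normrM; apply: ler_pM.
Qed.

Let gramC k i j : gram k i j = gram k j i.
Proof. by apply: eq_Rintegral => w _; rewrite mulrC. Qed.

Let gram_ge0 k i : 0 <= gram k i i.
Proof. by apply: Rintegral_ge0 => w _; rewrite -expr2 sqr_ge0. Qed.

Let dotp_lin f g h k (a b : R) : bounded_meas f -> bounded_meas g ->
  bounded_meas h -> bounded_meas k ->
  \int[P0]_w ((f w + a * g w) * (h w + b * k w)) =
  dotp f h + b * dotp f k + a * dotp g h + a * b * dotp g k.
Proof.
move=> bf bg bh bk.
have i1 := integrable_prod bf bh; have i2 := integrableZlR b (integrable_prod bf bk).
have i3 := integrableZlR a (integrable_prod bg bh).
have i4 := integrableZlR (a * b) (integrable_prod bg bk).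
transitivity (\int[P0]_w (f w * h w + b * (f w * k w) + a * (g w * h w) +
    (a * b) * (g w * k w))).
  by apply: eq_Rintegral => w _; ring.
have i12 := integrableDR i1 i2; have i123 := integrableDR i12 i3.
by rewrite !RintegralD// !RintegralZl//; exact: integrable_prod.
Qed.

Let gram_null k i j : gram k i i = 0 -> gram k i j = 0.
Proof.
move=> Ki; apply/eqP; apply: contraT => Kij.
(* Chosen so that the squared norm of resid_j + t resid_i would be - 1. *)
pose t := - (gram k j j + 1) / (2 * gram k i j).
have := dotp_lin t t (bm_resid k j) (bm_resid k i) (bm_resid k j) (bm_resid k i).
rewrite -!/(gram k _ _) Ki mulr0 addr0 (gramC k j i).
have : 0 <= \int[P0]_w ((resid k j w + t * resid k i w) * (resid k j w + t * resid k i w)).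
  by apply: Rintegral_ge0 => w _; rewrite -expr2 sqr_ge0.
move=> + E; rewrite E.
have -> : gram k j j + t * gram k i j + t * gram k i j = - 1.
  by rewrite /t; field.
by rewrite oppr_ge0 ler10.
Qed.

Let gramS k i j : gram k.+1 i j = gram k i j - chol i k * chol j k.
Proof.
rewrite /gram /= -!/(gram k _ _).
transitivity (\int[P0]_w ((resid k i w + (- (gram k i k / gram k k k)) * resid k k w) *
   (resid k j w + (- (gram k j k / gram k k k)) * resid k k w))).
  by apply: eq_Rintegral => w _; rewrite !mulNr.
rewrite dotp_lin; [|exact: bm_resid..].
rewrite -!/(gram k _ _) /chol (gramC k k j).
have -> : gram k i k / Num.sqrt (gram k k k) * (gram k j k / Num.sqrt (gram k k k)) =
    gram k i k * gram k j k / gram k k k.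
  rewrite mulrACA -invfM -[_ * Num.sqrt _]expr2 sqr_sqrtr//.
have [K0|K0] := eqVneq (gram k k k) 0;
  first by rewrite K0 invr0 !mulr0 oppr0 ?mul0r ?mulr0 ?addr0 ?subr0.
by field.
Qed.

Let gram_zero k i j : (i < k)%N -> gram k i j = 0.
Proof.
elim: k i j => // k IH i j; rewrite ltnS leq_eqVlt gramS => /orP[/eqP ->|ik]; last first.
  by rewrite /chol !(IH i _ ik) !mul0r subr0.
have [K0|K0] := eqVneq (gram k k k) 0.
  by rewrite /chol (gram_null j K0) K0 !mul0r subr0.
rewrite /chol mulrACA -invfM -[_ * Num.sqrt _]expr2 sqr_sqrtr// (gramC k k j).
by rewrite mulrAC divff// mul1r subrr.
Qed.

Lemma chol_zero i k : (i < k)%N -> chol i k = 0.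
Proof. by move=> ik; rewrite /chol gram_zero// mul0r. Qed.

(** Each step subtracts a rank-one matrix ([gramS]), and row i has become zero once i < n
    ([gram_zero]). *)
Lemma cholE n i j : (i < n)%N ->
  \int[P0]_w (tau i w * tau j w) = \sum_(k < n) chol i k * chol j k.
Proof.
move=> ni; have H m :
    gram m i j = \int[P0]_w (tau i w * tau j w) - \sum_(k < m) chol i k * chol j k.
  by elim: m => [|m IH]; rewrite ?big_ord0 ?subr0// gramS IH big_ord_recr/= opprD addrA.
by have := H n; rewrite gram_zero// => /esym/subr0_eq.
Qed.

Lemma chol_quad n (u : nat -> R) :
  \int[P0]_w (lin n u (tau ^~ w) ^+ 2) = \sum_(k < n) (\sum_(i < n) u i * chol i k) ^+ 2.
Proof.
have bt i : bounded_meas (tau i) by split.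
transitivity (\sum_(i < n) \sum_(j < n) u i * u j * \int[P0]_w (tau i w * tau j w)).
  transitivity (\int[P0]_w (\sum_(i < n) \sum_(j < n) (u i * u j) * (tau i w * tau j w))).
    apply: eq_Rintegral => w _; rewrite expr2 /lin big_distrl/=; apply: eq_bigr => i _.
    by rewrite big_distrr/=; apply: eq_bigr => j _; rewrite mulrACA.
  have ij i j := integrableZlR (u i * u j) (integrable_prod (bt i) (bt j)).
  rewrite expect_sum; last by move=> i; apply: integrable_sumR => j; exact: ij.
  apply: eq_bigr => i _; rewrite expect_sum; last by move=> j; exact: ij.
  by apply: eq_bigr => j _; rewrite RintegralZl//; exact: integrable_prod.
under eq_bigr => i _ do under eq_bigr => j _ do rewrite (cholE j (ltn_ord i)) big_distrr/=.
under [RHS]eq_bigr => k _ do rewrite expr2 big_distrl/=.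
rewrite [RHS]exchange_big/=; apply: eq_bigr => i _.
under [RHS]eq_bigr => k _ do rewrite big_distrr/=.
rewrite [RHS]exchange_big/=; apply: eq_bigr => j _; apply: eq_bigr => k _.
by rewrite mulrACA.
Qed.

(** Z_i is the sum of [chol i k] xi_k over k <= i. As [chol] is lower triangular, this finite sum
    serves for all n at once, and [chol_quad] matches the quadratic forms. *)
Lemma gaussian_family :
  exists (d : measure_display) (S : measurableType d) (Q : probability S R)
    (Z : S -> nat -> R), [/\ forall i, measurable_fun setT (fun w => Z w i),
    forall i, Q.-integrable setT (EFin \o (fun w => Z w i ^+ 2)) &
    forall n u b, \int[Q]_w cos (lin n u (Z w) + b) =
      cos b * expR (- (\int[P0]_w (lin n u (tau ^~ w) ^+ 2) / 2))].
Proof.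
have [d [S [Q [xi [mxi ixi xicos]]]]] := @gaussian_sequence R.
exists d, S, Q, (fun w i => \sum_(k < i.+1) chol i k * xi k w); split.
- by move=> i; apply: measurable_sum => k; apply: measurable_funM => //; exact: mxi.
- move=> i; apply: integrable_sqr_sum => k; first by apply: measurable_funM => //; exact: mxi.
  apply: eq_integrable (integrableZlR (chol i k ^+ 2) (ixi k)) => //.
  by move=> w _; rewrite /= [in RHS]exprMn.
- move=> n u b; rewrite chol_quad.
  have -> : (fun w => cos (lin n u (fun i => \sum_(k < i.+1) chol i k * xi k w) + b)) =
      (fun w => cos (\sum_(k < n) (\sum_(i < n) u i * chol i k) * xi k w + b)).
    apply/funext => w; congr (cos (_ + b)); rewrite /lin.
    under [RHS]eq_bigr => k _ do rewrite big_distrl/=.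
    rewrite [RHS]exchange_big/=; apply: eq_bigr => i _.
    rewrite big_distrr/= (big_ord_widen n (fun k => u i * (chol i k * xi k w)))//.
    rewrite big_mkcond/=; apply: eq_bigr => k _; rewrite mulrA; case: ifPn => // ik.
    by rewrite chol_zero ?mulr0 ?mul0r// ltnNge -ltnS.
  rewrite (xicos n (fun k => \sum_(i < n) u i * chol i k)); congr (_ * _).
  rewrite -expR_sum sumrN; congr (expR (- _)); rewrite mulr_suml.
  by apply: eq_bigr.
Qed.

End gram_schmidt.

(** * Random series in a normed space *)

Section lipschitz_regularization.
Context {R : realType} {V : normedModType R}.
Variables (F : V -> R) (M : R).
Hypothesis FM : forall x, `|F x| <= M.

(** The Pasch-Hausdorff envelope: for k >= 0 and F bounded, the largest k-Lipschitz function below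
    F. *)
Definition inf_conv (k : R) (x : V) : R := inf [set F y + k * `|x - y| | y in [set: V]].

Let inf_conv_lbound k x : 0 <= k -> has_lbound [set F y + k * `|x - y| | y in [set: V]].
Proof.
move=> k0; exists (- M) => _ [y _ <-].
by have := FM y; rewrite ler_norml => /andP[My _]; rewrite ler_wpDr// mulr_ge0.
Qed.

Lemma inf_conv_le_add k x y : 0 <= k -> inf_conv k x <= F y + k * `|x - y|.
Proof. by move=> k0; apply: ge_inf; [exact: inf_conv_lbound|exists y]. Qed.

Lemma inf_conv_le k x : 0 <= k -> inf_conv k x <= F x.
Proof.
by move=> k0; have := inf_conv_le_add x x k0; rewrite subrr normr0 mulr0 addr0.
Qed.

Lemma le_inf_conv k x a : (forall y, a <= F y + k * `|x - y|) -> a <= inf_conv k x.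
Proof.
move=> H; apply: lb_le_inf; first by exists (F x + k * `|x - x|), x.
by move=> _ [y _ <-].
Qed.

Lemma inf_conv_bounded k x : 0 <= k -> `|inf_conv k x| <= M.
Proof.
move=> k0; rewrite ler_norml; apply/andP; split.
  apply: le_inf_conv => y; have := FM y; rewrite ler_norml => /andP[My _].
  by rewrite ler_wpDr// mulr_ge0.
by apply: le_trans (inf_conv_le x k0) _; have := FM x; rewrite ler_norml => /andP[].
Qed.

Lemma inf_conv_lipschitz k x y : 0 <= k -> `|inf_conv k x - inf_conv k y| <= k * `|x - y|.
Proof.
move=> k0; have H u v : inf_conv k u - k * `|u - v| <= inf_conv k v.
  apply: le_inf_conv => t; rewrite lerBlDr; apply: le_trans (inf_conv_le_add u t k0) _.
  by rewrite -addrA lerD2l -mulrDr ler_wpM2l// [leRHS]addrC ler_distD.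
have := H x y; have := H y x; rewrite (distrC y x) ler_norml => h1 h2.
by apply/andP; split; lra.
Qed.

Lemma inf_conv_cvg x : {for x, continuous F} -> inf_conv n%:R x @[n --> \oo] --> F x.
Proof.
move=> cF; apply/cvgrPdist_le => e e0.
have M0 : 0 <= M by apply: le_trans (FM x).
have /nbhs_ballP[r /= r0 rF] : \forall y \near x, `|F x - F y| <= e.
  by move/cvgrPdist_le : cF; exact.
(* Outside the ball of radius r the penalty n |x - y| then exceeds 2 M, the largest possible
   oscillation of F. *)
near=> n; have n2 : (2 * M) / r <= n%:R by near: n; exact: nbhs_infty_ger.
rewrite ger0_norm ?subr_ge0 ?inf_conv_le// lerBlDr -lerBlDl; apply: le_inf_conv => y.
have [xy|xy] := ltP `|x - y| r.
  have : `|F x - F y| <= e by apply: rF; rewrite -ball_normE.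
  rewrite ler_norml => /andP[_]; rewrite lerBlDr => Fxy.
  by rewrite lerBlDl (le_trans Fxy)// lerD2l lerDl mulr_ge0.
have h : 2 * M <= n%:R * `|x - y|.
  by move: n2; rewrite ler_pdivrMr// => n2; apply: (le_trans n2); rewrite ler_wpM2l.
have := FM x; have := FM y; rewrite !ler_norml => /andP[? ?] /andP[? ?].
lra.
Unshelve. all: by end_near. Qed.

End lipschitz_regularization.

(** For A open, the envelope of its indicator with k = 1 is positive exactly on A, so the preimage
    of A is that of a ray under a real function of Y already known to be measurable. *)
Lemma measurable_borel {R : realType} {V : normedModType R} {d : measure_display}
    {Omega : measurableType d} (Y : Omega -> V) :
  (forall (f : V -> R) L M, (forall x y, `|f x - f y| <= L * `|x - y|) ->
     (forall x, `|f x| <= M) -> measurable_fun setT (fun w => f (Y w))) ->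
  measurable_fun setT (Y : Omega -> borel V).
Proof.
move=> H; apply: (@measurability _ _ Omega (borel V) setT Y (@open V) erefl) => _ [A oA <-].
rewrite setTI.
pose F (x : V) : R := \1_A x.
have F1 x : `|F x| <= 1 by rewrite /F indicE; case: (_ \in _); rewrite ?normr1 ?normr0.
have mf : measurable_fun setT (fun w => inf_conv F 1 (Y w)).
  apply: (H _ 1 1) => [x y|x]; first exact: inf_conv_lipschitz F1 _ _ _ ler01.
  exact: inf_conv_bounded F1 _ _ ler01.
rewrite (_ : Y @^-1` A = (fun w => inf_conv F 1 (Y w)) @^-1` `]0, +oo[%classic).
  by rewrite -[X in measurable X]setTI; apply: mf => //; exact: measurable_itv.
apply/seteqP; split => w /=; rewrite in_itv/= andbT.
  move=> AYw; have /nbhs_ballP[r /= r0 rA] := open_nbhs_nbhs (conj oA AYw).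
  apply: (@lt_le_trans _ _ (Num.min 1 r)); first by rewrite lt_min ltr01.
  apply: le_inf_conv => y; rewrite mul1r.
  have [xy|xy] := ltP `|Y w - y| r.
    have Ay : A y by apply: rA; rewrite -ball_normE.
    by rewrite /F indicE mem_set// ge_min ler_wpDr.
  rewrite ge_min; apply/orP; right; apply: le_trans xy _.
  by rewrite lerDr /F indicE.
apply: contraPP => nA; apply/negP; rewrite -leNgt.
by apply: le_trans (inf_conv_le F1 _ ler01) _; rewrite /F indicE memNset.
Qed.

Section random_series.
Context {R : realType} {V : normedModType R}.
Variables (psi : nat -> V) (phi : nat -> R) (Phi : R).
Hypotheses (psi_phi : forall i, `|psi i| <= phi i).
Hypothesis phi_cvg : series phi n @[n --> \oo] --> Phi.

Let phi_ge0 i : 0 <= phi i. Proof. exact: le_trans (psi_phi i). Qed.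

Let phi_nd : nondecreasing_seq (series phi).
Proof. by apply: nondecreasing_series => i _ _; exact: phi_ge0. Qed.

Let phi_le n : series phi n <= Phi.
Proof.
rewrite -(cvg_lim (@Rhausdorff R) phi_cvg); apply: nondecreasing_cvgn_le phi_nd _ _.
by apply/cvg_ex; exists Phi.
Qed.

Let phi1_le i : phi i <= Phi.
Proof.
apply: le_trans (phi_le i.+1); rewrite seriesEnat/= big_nat_recr//= lerDr.
by apply: sumr_ge0 => j _; exact: phi_ge0.
Qed.

Section one_random_series.
Context {d : measure_display} {Omega : measurableType d}.
Variables (P : probability Omega R) (X : Omega -> nat -> R) (Y : Omega -> V).
Hypothesis mX : forall i, measurable_fun setT (fun w => X w i).
Hypothesis iX : forall i, P.-integrable setT (EFin \o (fun w => X w i ^+ 2)).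
Hypothesis X1 : forall i, \int[P]_w (X w i ^+ 2) <= 1.
Hypothesis XY : forall w, \sum_(i < n) X w i *: psi i @[n --> \oo] --> Y w.

Variables (f : V -> R) (L M : R).
Hypothesis fL : forall x y, `|f x - f y| <= L * `|x - y|.
Hypothesis fM : forall x, `|f x| <= M.

Let part n (x : nat -> R) : R := f (\sum_(i < n) x i *: psi i).

Lemma part_lipschitz n x y :
  `|part n x - part n y| <= (`|L| * Phi) * \sum_(i < n) `|x i - y i|.
Proof.
apply: le_trans (fL _ _) _; apply: (@le_trans _ _ (`|L| *
  `|\sum_(i < n) x i *: psi i - \sum_(i < n) y i *: psi i|)).
  by rewrite ler_wpM2r// ler_norm.
rewrite -mulrA ler_wpM2l// -sumrB mulr_sumr; apply: le_trans (ler_norm_sum _ _ _) _.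
apply: ler_sum => i _; rewrite -scalerBl normrZ mulrC ler_wpM2r//.
exact: le_trans (psi_phi i) (phi1_le i).
Qed.

Let mpart n : measurable_fun setT (fun w => part n (X w)).
Proof. by apply: (measurable_lipschitz mX) => x y; exact: part_lipschitz. Qed.

Let part_cvg w : part n (X w) @[n --> \oo] --> f (Y w).
Proof. exact: cvg_lipschitz fL _ _ (@XY w). Qed.

Lemma measurable_random_series : measurable_fun setT (fun w => f (Y w)).
Proof. by apply: (measurable_fun_cvg mpart) => w _; exact: part_cvg. Qed.

(** The omitted terms have norm at most |X_i| phi_i, and E |X_i| is at most 1. The bound depends on
    the law of X through nothing else, hence is uniform along a sequence. *)
Lemma random_series_tail n :
  `|\int[P]_w f (Y w) - \int[P]_w part n (X w)| <= `|L| * (Phi - series phi n).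
Proof.
have ipart m : P.-integrable setT (EFin \o (fun w => part m (X w))).
  by apply: (@bounded_integrable _ _ _ _ _ M) => // w; exact: fM.
have cvg_int : \int[P]_w part m (X w) @[m --> \oo] --> \int[P]_w f (Y w).
  by apply: (@bounded_cvg_Rintegral _ _ _ P _ _ M) => // m w; exact: fM.
have iabs i := integrable_norm_of_sqr (mX i) (iX i).
have abs1 i := expect_norm_le1 (mX i) (iX i) (X1 i).
have diff m : (n <= m)%N ->
    `|\int[P]_w part m (X w) - \int[P]_w part n (X w)| <= `|L| * (Phi - series phi n).
  move=> nm; apply: le_trans (expect_dist_le (ipart m) (ipart n)
    (integrableZlR `|L| (integrable_sumR (index_iota n m)
       (fun i => integrableZlR (phi i) (iabs i)))) _) _ => [w|].
    apply: le_trans (fL _ _) _; apply: (@le_trans _ _ (`|L| *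
      `|\sum_(i < m) X w i *: psi i - \sum_(i < n) X w i *: psi i|)).
      by rewrite ler_wpM2r// ler_norm.
    rewrite ler_wpM2l// -!(big_mkord xpredT (fun i => X w i *: psi i)).
    rewrite (big_cat_nat (n := n))//= addrAC subrr add0r.
    apply: le_trans (ler_norm_sum _ _ _) _; apply: ler_sum => i _.
    by rewrite normrZ mulrC ler_wpM2r.
  rewrite RintegralZl//; last by apply: integrable_sumR => i; exact: integrableZlR.
  rewrite ler_wpM2l// expect_sum; last by move=> i; exact: integrableZlR.
  apply: (@le_trans _ _ (\sum_(n <= i < m) phi i)).
    apply: ler_sum => i _; rewrite RintegralZl//.
    by rewrite ler_piMr.
  rewrite -lerBlDr opprK addrC; apply: le_trans (phi_le m).
  by rewrite !seriesEnat/= -big_cat_nat.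
have H : `|\int[P]_w part m (X w) - \int[P]_w part n (X w)| @[m --> \oo] -->
    `|\int[P]_w f (Y w) - \int[P]_w part n (X w)|.
  by apply: cvg_norm; apply: cvgB => //; exact: cvg_cst.
apply: (cvgr_to_le H); near=> m; apply: diff; near: m; exact: nbhs_infty_ge.
Unshelve. all: by end_near. Qed.

End one_random_series.

End random_series.

Section convergence_of_random_series.
Context {R : realType} {V : normedModType R}.
Variables (psi : nat -> V) (phi : nat -> R) (Phi : R).
Hypotheses (psi_phi : forall i, `|psi i| <= phi i).
Hypothesis phi_cvg : series phi n @[n --> \oo] --> Phi.
Context {d d' : measure_display} {Omega : measurableType d} {S : measurableType d'}.
Variables (P : probability Omega R) (Q : probability S R).
Variables (X : nat -> Omega -> nat -> R) (Z : S -> nat -> R).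
Variables (Y : nat -> Omega -> V) (W : S -> V).
Hypothesis mX : forall n i, measurable_fun setT (fun w => X n w i).
Hypothesis mZ : forall i, measurable_fun setT (fun w => Z w i).
Hypothesis iX : forall n i, P.-integrable setT (EFin \o (fun w => X n w i ^+ 2)).
Hypothesis iZ : forall i, Q.-integrable setT (EFin \o (fun w => Z w i ^+ 2)).
Hypothesis X1 : forall n i, \int[P]_w (X n w i ^+ 2) <= 1.
Hypothesis Z1 : forall i, \int[Q]_w (Z w i ^+ 2) <= 1.
Hypothesis XY : forall n w, \sum_(i < k) X n w i *: psi i @[k --> \oo] --> Y n w.
Hypothesis ZW : forall w, \sum_(i < k) Z w i *: psi i @[k --> \oo] --> W w.
Hypothesis cos_cvg : forall k u b, \int[P]_w cos (lin k u (X n w) + b) @[n --> \oo] -->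
  \int[Q]_w cos (lin k u (Z w) + b).

Let cvg_lipschitz_series (f : V -> R) L M : (forall x y, `|f x - f y| <= L * `|x - y|) ->
  (forall x, `|f x| <= M) -> \int[P]_w f (Y n w) @[n --> \oo] --> \int[Q]_w f (W w).
Proof.
move=> fL fM; apply/cvgrPdist_le => e e0; have e3 : 0 < e / 3 by rewrite divr_gt0.
have [k Hk] : exists k, `|L| * (Phi - series phi k) <= e / 3.
  have H : `|L| * (Phi - series phi k) @[k --> \oo] --> (0 : R).
    rewrite -(mulr0 `|L|) -(subrr Phi); apply: cvgMr; apply: cvgB => //; exact: cvg_cst.
  move/cvgrPdist_le : H => /(_ _ e3)[k _ /(_ k (leqnn k))].
  by rewrite /= sub0r normrN => H; exists k; apply: le_trans H; exact: ler_norm.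
have HX n := random_series_tail psi_phi phi_cvg (mX n) (iX n) (X1 n) (@XY n) fL fM k.
have HZ := random_series_tail psi_phi phi_cvg mZ iZ Z1 ZW fL fM k.
have H : \int[P]_w f (\sum_(i < k) X n w i *: psi i) @[n --> \oo] -->
    \int[Q]_w f (\sum_(i < k) Z w i *: psi i).
  apply: (@cvg_lipschitz_of_cos _ _ _ _ P _ Q k X Z 1 mX mZ iX iZ _ _ _
    (fun x => f (\sum_(i < k) x i *: psi i)) _ M
    (part_lipschitz psi_phi phi_cvg fL k)) => //.
move/cvgrPdist_le : H => /(_ _ e3); apply: filterS => n Hn.
move: (HX n) HZ Hn => /le_trans/(_ Hk) + /le_trans/(_ Hk).
rewrite !ler_norml => /andP[p1 p2] /andP[q1 q2] /andP[h1 h2].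
by apply/andP; split; lra.
Qed.

Let measurable_series d1 (U : measurableType d1) (x : U -> nat -> R)
    (y : U -> V) (F : V -> R) M :
  (forall i, measurable_fun setT (fun w => x w i)) ->
  (forall w, \sum_(i < k) x w i *: psi i @[k --> \oo] --> y w) ->
  continuous F -> (forall v, `|F v| <= M) -> measurable_fun setT (fun w => F (y w)).
Proof.
move=> mx xy cF FM.
apply: (@measurable_fun_cvg _ _ _ _ (fun k w => inf_conv F k%:R (y w))) => [k|w _].
  apply: (measurable_random_series psi_phi phi_cvg mx xy (L := k%:R)) => u v.
  exact: (inf_conv_lipschitz FM u v (ler0n _ k)).
by apply: (inf_conv_cvg FM); exact: cF.
Qed.

(** A Lipschitz envelope lies below F and its integral at W is close to that of F, so convergence on
    Lipschitz functions gives one inequality. Applied to F and - F it gives the limit. *)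
Let lower_semicontinuity (F : V -> R) M (e : R) : continuous F -> (forall x, `|F x| <= M) ->
  0 < e -> \forall n \near \oo, \int[Q]_w F (W w) - e <= \int[P]_w F (Y n w).
Proof.
move=> cF FM e0; have e2 : 0 < e / 2 by rewrite divr_gt0.
have k0 k : 0 <= k%:R :> R by [].
have mW := measurable_series mZ ZW cF FM; have mY n := measurable_series (mX n) (@XY n) cF FM.
have mGW k : measurable_fun setT (fun w => inf_conv F k%:R (W w)).
  exact: (measurable_random_series psi_phi phi_cvg mZ ZW
    (fun x y => inf_conv_lipschitz FM x y (k0 k))).
have mGY k n : measurable_fun setT (fun w => inf_conv F k%:R (Y n w)).
  exact: (measurable_random_series psi_phi phi_cvg (mX n) (@XY n)
    (fun x y => inf_conv_lipschitz FM x y (k0 k))).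
have : \int[Q]_w inf_conv F k%:R (W w) @[k --> \oo] --> \int[Q]_w F (W w).
  apply: (@bounded_cvg_Rintegral _ _ _ Q _ _ M) => // [k w|w].
    exact: inf_conv_bounded FM _ _ (k0 k).
  by apply: (inf_conv_cvg FM); exact: cF.
move/cvgrPdist_le => /(_ _ e2)[k _ /(_ k (leqnn k))]/=.
rewrite ler_norml => /andP[_ Hk].
have : \int[P]_w inf_conv F k%:R (Y n w) @[n --> \oo] --> \int[Q]_w inf_conv F k%:R (W w).
  exact: cvg_lipschitz_series (fun x y => inf_conv_lipschitz FM x y (k0 k))
    (fun x => inf_conv_bounded FM x (k0 k)).
move/cvgrPdist_le => /(_ _ e2); apply: filterS => n.
rewrite ler_norml => /andP[_ Hn].
apply: (@le_trans _ _ (\int[P]_w inf_conv F k%:R (Y n w))); first lra.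
apply: le_Rintegral => //.
- apply: (@bounded_integrable _ _ _ _ _ M) => // w.
  exact: inf_conv_bounded FM _ _ (k0 k).
- by apply: (@bounded_integrable _ _ _ _ _ M) => // w.
- by move=> w _; exact: (inf_conv_le FM _ (k0 k)).
Qed.

Lemma random_series_cvg_in_distribution : cvg_in_distribution P Q Y W.
Proof.
split.
- move=> n; apply: measurable_borel => f L M fL _.
  exact: (measurable_random_series psi_phi phi_cvg (mX n) (@XY n) fL).
- apply: measurable_borel => f L M fL _.
  exact: (measurable_random_series psi_phi phi_cvg mZ ZW fL).
move=> F cF [M FM].
have mW := measurable_series mZ ZW cF FM; have mY n := measurable_series (mX n) (@XY n) cF FM.
have iW : Q.-integrable setT (EFin \o (fun w => F (W w))).
  by apply: (@bounded_integrable _ _ _ _ _ M).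
have iY n : P.-integrable setT (EFin \o (fun w => F (Y n w))).
  by apply: (@bounded_integrable _ _ _ _ _ M).
rewrite unlock.
have -> : (\int[Q]_w (F (W w))%:E = (\int[Q]_w F (W w))%:E)%E.
  by rewrite /Rintegral fineK//; exact: integrable_fin_num.
rewrite (_ : (fun n => _) = (fun n => (\int[P]_w F (Y n w))%:E)); last first.
  by apply/funext => n; rewrite /Rintegral fineK//; exact: (integrable_fin_num measurableT (iY n)).
apply: cvg_EFin; first exact: nearW.
have cNF : continuous (fun x => - F x).
  by move=> x; apply: (@cvgN _ R^o); exact: cF.
have NFM x : `|- F x| <= M by rewrite normrN.
apply/cvgrPdist_le => e e0.
apply: filterS2 (lower_semicontinuity cF FM e0) (lower_semicontinuity cNF NFM e0) => n.
have oppE d1 (U : measurableType d1) (N : probability U R) (f : U -> R) :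
    N.-integrable setT (EFin \o f) -> \int[N]_w (- f w) = - \int[N]_w f w.
  by move=> fi; under eq_Rintegral do rewrite -mulN1r; rewrite RintegralZl// mulN1r.
rewrite /= !oppE//; move: (\int[P]_w F (Y n w)) (\int[Q]_w F (W w)) => a b h1 h2.
by rewrite ler_norml; apply/andP; split; lra.
Qed.

End convergence_of_random_series.

(** * Gaussian series *)

Section second_moment_of_sums.
Context {R : realType} {d0 d d' : measure_display} {Omega0 : measurableType d0}
  {Omega : measurableType d} {E : measurableType d'}.
Variables (P0 : probability Omega0 R) (T : {RV P0 >-> E}) (P : probability Omega R)
  (T_ : nat -> {RV P >-> E}) (f : E -> R).
Hypotheses (T_indep : mutually_independent T_) (T_law : forall i, same_law (T_ i) T).
Hypotheses (mf : measurable_fun setT f) (ff : finite_set (range f)).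
Hypothesis f0 : \int[P0]_w f (T w) = 0.

Let pastS k g : past T_ k g -> past T_ k.+1 g.
Proof.
move=> pg; have [+ _] := past_fun T_law pg (@measurable_cst _ _ E _ setT (1 : R))
  (finite_range_comp (fun=> 1) ff).
by under eq_fun do rewrite mulr1.
Qed.

Let past1 k : past T_ k (fun=> 1 : R).
Proof. by elim: k => [|k]; [exact: past_cst|exact: pastS]. Qed.

Let past_partial_sum k : past T_ k (fun w => \sum_(j < k) f (T_ j w)).
Proof.
elim: k => [|k IH].
  have := past_lin 0 0 (past1 0) (past1 0).
  by under eq_fun do rewrite !mul0r addr0; under [in X in _ -> X]eq_fun do rewrite big_ord0.
have [pf _] := past_fun T_law (past1 k) mf ff.
have := past_lin 1 1 (pastS IH) pf.
by under eq_fun do rewrite !mul1r; under [in X in _ -> X]eq_fun do rewrite big_ord_recr/=.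
Qed.

(** The partial sum is decorrelated from the next centered term, so the cross terms vanish. *)
Lemma sum_second_moment n :
  P.-integrable setT (EFin \o (fun w => (\sum_(j < n) f (T_ j w)) ^+ 2)) /\
  \int[P]_w ((\sum_(j < n) f (T_ j w)) ^+ 2) = n%:R * \int[P0]_w (f (T w) ^+ 2).
Proof.
elim: n => [|n [i2 IH]].
  rewrite mul0r; under eq_fun do rewrite big_ord0 expr0n; split.
    by apply: (@bounded_integrable _ _ _ _ _ 0) => // w; rewrite normr0.
  by rewrite expect_cst.
have [p1 E1] := past_fun T_law (past_partial_sum n) mf ff.
have mf2 : measurable_fun setT (fun x => f x ^+ 2) by exact: measurable_funX.
have [p2 E2] := past_fun T_law (past1 n) mf2 (finite_range_comp (fun y => y ^+ 2) ff).
have i1 := integrableZlR 2 (past_integrable p1).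
have i3 := past_integrable p2.
have SE w : (\sum_(j < n.+1) f (T_ j w)) ^+ 2 = ((\sum_(j < n) f (T_ j w)) ^+ 2 +
    2 * ((\sum_(j < n) f (T_ j w)) * f (T_ n w))) + 1 * f (T_ n w) ^+ 2.
  by rewrite big_ord_recr/=; ring.
under eq_fun do rewrite SE.
have i12 := integrableDR i2 i1; split; first exact: integrableDR.
rewrite RintegralD// RintegralD// RintegralZl//; last exact: past_integrable p1.
by rewrite E1 E2 f0 IH expect_cst mulr0 mulr0 addr0 -natr1 mulrDl.
Qed.

End second_moment_of_sums.

Section gaussian_series.
Context {R : realType} {d0 d : measure_display} {Omega0 : measurableType d0}
  {S : measurableType d}.
Variables (P0 : probability Omega0 R) (tau : nat -> Omega0 -> R) (Q : probability S R)
  (Z : S -> nat -> R).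
Hypothesis mtau : forall i, measurable_fun setT (tau i).
Hypothesis tau1 : forall i w, `|tau i w| <= 1.
Hypothesis mZ : forall i, measurable_fun setT (fun w => Z w i).
Hypothesis iZ : forall i, Q.-integrable setT (EFin \o (fun w => Z w i ^+ 2)).
Hypothesis Zcos : forall n u b, \int[Q]_w cos (lin n u (Z w) + b) =
  cos b * expR (- (\int[P0]_w (lin n u (tau ^~ w) ^+ 2) / 2)).

Let var n (a : nat -> R) := \int[P0]_w (lin n a (tau ^~ w) ^+ 2).

Let var_ge0 n a : 0 <= var n a.
Proof. by apply: Rintegral_ge0 => w _; exact: sqr_ge0. Qed.

Let lin_norm n (a : nat -> R) w : `|lin n a (tau ^~ w)| <= \sum_(i < n) `|a i|.
Proof.
apply: le_trans (ler_norm_sum _ _ _) _; apply: ler_sum => i _.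
by rewrite normrM ler_piMr.
Qed.

Let mlin_tau n a : measurable_fun setT (fun w => lin n a (tau ^~ w)).
Proof. exact: (measurable_lin (X := fun w => tau ^~ w)). Qed.

Let ilin2 n a : Q.-integrable setT (EFin \o (fun w => lin n a (Z w) ^+ 2)).
Proof.
apply: integrable_sqr_sum => i; first by apply: measurable_funM => //; exact: mZ.
apply: eq_integrable (integrableZlR (a i ^+ 2) (iZ i)) => //.
by move=> w _; rewrite /= [in RHS]exprMn.
Qed.

Let lin_cos n a u b : \int[Q]_w cos (u * lin n a (Z w) + b) =
  cos b * expR (- (Num.sqrt (var n a) ^+ 2 * u ^+ 2 / 2)).
Proof.
have H (x : nat -> R) : u * lin n a x = lin n (fun i => u * a i) x.
  by rewrite /lin big_distrr/=; apply: eq_bigr => i _; rewrite mulrA.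
under eq_Rintegral do rewrite H; rewrite Zcos sqr_sqrtr//; congr (cos b * expR (- (_ / 2))).
under eq_Rintegral do rewrite -H exprMn.
rewrite RintegralZl 1?mulrC//; apply: (@bounded_integrable _ _ _ _ _ ((\sum_(i < n) `|a i|) ^+ 2)).
  exact: measurable_funX.
by move=> w; rewrite normrX lerXn2r ?nnegrE// sumr_ge0.
Qed.

(** Z is known through cosine integrals only; the second moment is read off the Gaussian law by
    applying the limit lemma to a constant sequence. *)
Let lin_var n a : \int[Q]_w (lin n a (Z w) ^+ 2) = var n a.
Proof.
have cosC u b : \int[Q]_w cos (u * lin n a (Z w) + b) @[_ --> \oo] -->
    cos b * expR (- (Num.sqrt (var n a) ^+ 2 * u ^+ 2 / 2)).
  by rewrite lin_cos; exact: cvg_cst.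
have mlin := measurable_lin mZ n a.
have [_ + _] := gaussian_limit_moments (fun=> mlin) (fun=> ilin2 n a)
  (fun=> lexx _) (fun w => cvg_cst _) cosC.
by rewrite sqr_sqrtr.
Qed.

Lemma family_second_moment i : \int[Q]_w (Z w i ^+ 2) <= 1.
Proof.
pose a j : R := (j == i)%:R.
have linE (x : nat -> R) : lin i.+1 a x = x i.
  rewrite /lin big_ord_recr/= /a eqxx mul1r big1 ?add0r// => j _.
  by rewrite (ltn_eqF (ltn_ord j)) mul0r.
have := lin_var i.+1 a; under eq_Rintegral do rewrite linE; move=> ->.
rewrite /var -[leRHS](expect_cst P0 1); under eq_Rintegral do rewrite linE.
have sq1 w : tau i w ^+ 2 <= 1.
  by rewrite -(real_normK (num_real (tau i w))) expr_le1.
apply: le_Rintegral => //; apply: (@bounded_integrable _ _ _ _ _ 1) => //.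
- exact: measurable_funX.
- by move=> w; rewrite ger0_norm ?sqr_ge0.
- by move=> w; rewrite normr1.
Qed.

(** The partial sums over Z are centered Gaussian with the variances of the partial sums over tau.
    These variances converge by bounded convergence, as tau is bounded and a is summable, and
    [gaussian_limit] identifies the law of X. *)
Lemma gaussian_series (a : nat -> R) (A : R) (X : S -> R) (Y : Omega0 -> R) :
  (forall n, \sum_(i < n) `|a i| <= A) ->
  (forall w, lin n a (Z w) @[n --> \oo] --> X w) ->
  (forall w, lin n a (tau ^~ w) @[n --> \oo] --> Y w) ->
  [/\ gaussian_variable Q X, Q.-integrable setT (EFin \o (fun w => X w ^+ 2)),
      \int[Q]_w (X w ^+ 2) = \int[P0]_w (Y w ^+ 2) & \int[Q]_w X w = 0].
Proof.
move=> aA ZX tauY.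
have A0 : 0 <= A by have := aA 0%N; rewrite big_ord0.
have Y0 : 0 <= \int[P0]_w (Y w ^+ 2) by apply: Rintegral_ge0 => w _; exact: sqr_ge0.
have linA n w : `|lin n a (tau ^~ w) ^+ 2| <= A ^+ 2.
  by rewrite normrX lerXn2r ?nnegrE//; exact: le_trans (lin_norm n a w) (aA n).
have var_cvg : var n a @[n --> \oo] --> \int[P0]_w (Y w ^+ 2).
  apply: (@bounded_cvg_Rintegral _ _ _ P0 _ _ (A ^+ 2)) => // [n|w].
    exact: measurable_funX.
  by apply: (@cvg_comp _ _ _ _ (fun x : R => x ^+ 2) _ _ _ (@tauY w)); exact: exprn_continuous.
have varA n : var n a <= A ^+ 2.
  rewrite -(expect_cst P0 (A ^+ 2)); apply: le_Rintegral => //.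
  - by apply: (@bounded_integrable _ _ _ _ _ (A ^+ 2)) => //; exact: measurable_funX.
  - by apply: (@bounded_integrable _ _ _ _ _ `|A ^+ 2|).
  - by move=> w _; apply: le_trans (linA n w); exact: ler_norm.
pose sg := Num.sqrt (\int[P0]_w (Y w ^+ 2)).
have mlin n : measurable_fun setT (fun w => lin n a (Z w)) by exact: measurable_lin.
have linC n : \int[Q]_w (lin n a (Z w) ^+ 2) <= A ^+ 2 by rewrite lin_var.
have cosC u b : \int[Q]_w cos (u * lin n a (Z w) + b) @[n --> \oo] -->
    cos b * expR (- (sg ^+ 2 * u ^+ 2 / 2)).
  under eq_fun do rewrite lin_cos sqr_sqrtr//; rewrite /sg sqr_sqrtr//.
  apply: cvgMr; apply: (@cvg_comp _ _ _ _ expR _ _ _ _ (@continuous_expR R _)).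
  by apply: cvgN; apply: cvgMl; apply: cvgMl.
have [mX lawX] := gaussian_limit mlin (ilin2 ^~ a) linC ZX cosC.
have [iX X2 X0] := gaussian_limit_moments mlin (ilin2 ^~ a) linC ZX cosC.
split=> //; last by rewrite X2 /sg sqr_sqrtr.
by split=> //; exists 0, sg.
Qed.

End gaussian_series.

(** The expectation of the sum of the phi_i |Z_i| is at most B, so the sum is finite almost
    surely. *)
Lemma ae_convergent_series {R : realType} {d : measure_display} {S : measurableType d}
    (Q : probability S R) (phi : nat -> R) (B : R) (Z : S -> nat -> R) :
  (forall i, 0 <= phi i) -> (forall n, series phi n <= B) ->
  (forall i, measurable_fun setT (fun w => Z w i)) ->
  (forall i, Q.-integrable setT (EFin \o (fun w => Z w i ^+ 2))) ->
  (forall i, \int[Q]_w (Z w i ^+ 2) <= 1) ->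
  exists A : set S, [/\ measurable A, Q (~` A) = 0%E &
    forall w, A w -> cvgn (series (fun i => phi i * `|Z w i|))].
Proof.
move=> phi0 phiB mZ iZ Z1.
pose f i w : \bar R := (phi i * `|Z w i|)%:E.
have mf i : measurable_fun setT (f i).
  by apply/measurable_EFinP; apply: measurable_funM => //; exact: measurableT_comp.
have f0 i w : (0 <= f i w)%E by rewrite lee_fin mulr_ge0.
pose g w := (\sum_(i <oo) f i w)%E.
have g0 w : (0 <= g w)%E by apply: nneseries_ge0.
have mg : measurable_fun setT g by apply: ge0_emeasurable_sum => // i w _ _.
have iabs i := integrable_norm_of_sqr (mZ i) (iZ i).
have abs1 i := expect_norm_le1 (mZ i) (iZ i) (Z1 i).
have fi i : (\int[Q]_w f i w <= (phi i)%:E)%E.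
  have -> : (\int[Q]_w f i w = (\int[Q]_w (phi i * `|Z w i|))%:E)%E.
    rewrite /Rintegral fineK//.
    exact: (integrable_fin_num measurableT (integrableZlR (phi i) (iabs i))).
  by rewrite RintegralZl// lee_fin ler_piMr.
have ig : (\int[Q]_w g w <= B%:E)%E.
  rewrite integral_nneseries//; apply: lime_le.
    by apply: is_cvg_nneseries => i _ _; apply: integral_ge0.
  apply: nearW => n; apply: (@le_trans _ _ (\sum_(0 <= i < n) (phi i)%:E)%E).
    by apply: lee_sum => i _.
  by rewrite sumEFin lee_fin; have := phiB n; rewrite seriesEnat.
have intg : Q.-integrable setT g.
  apply/integrableP; split=> //; under eq_integral do rewrite gee0_abs//.
  exact: le_lt_trans ig (ltry _).
have [N [mN N0 NP]] := integrable_ae measurableT intg.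
exists (~` N); rewrite setCK; split => //; [exact: measurableC|move=> w Nw].
have gfin : g w \is a fin_num.
  by apply: contrapT => gw; apply: Nw; apply: NP => /= /(_ I).
apply: nondecreasing_is_cvgn.
  by apply: nondecreasing_series => i _ _; exact: mulr_ge0.
exists (fine (g w)) => _ [n _ <-]; rewrite -lee_fin fineK// /g.
rewrite seriesEnat/= -sumEFin; apply: nneseries_lim_ge => i _ _; exact: f0.
Qed.

(* The vectors of gaussian_family are replaced by 0 on a null event.          *)
Lemma gaussian_family_summable {R : realType} {d0 : measure_display}
    {Omega0 : measurableType d0} (P0 : probability Omega0 R) (tau : nat -> Omega0 -> R)
    (phi : nat -> R) (B : R) :
  (forall i, measurable_fun setT (tau i)) -> (forall i w, `|tau i w| <= 1) ->
  (forall i, 0 <= phi i) -> (forall n, series phi n <= B) ->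
  exists (d : measure_display) (S : measurableType d) (Q : probability S R)
    (Z : S -> nat -> R), [/\ forall i, measurable_fun setT (fun w => Z w i),
    forall i, Q.-integrable setT (EFin \o (fun w => Z w i ^+ 2)),
    forall n u b, \int[Q]_w cos (lin n u (Z w) + b) =
      cos b * expR (- (\int[P0]_w (lin n u (tau ^~ w) ^+ 2) / 2)) &
    forall w, cvgn (series (fun i => phi i * `|Z w i|))].
Proof.
move=> mtau tau1 phi0 phiB.
have tau_bounded i : exists M, forall w, `|tau i w| <= M by exists 1; exact: tau1.
have [d [S [Q [Z [mZ iZ Zcos]]]]] := gaussian_family P0 mtau tau_bounded.
have Z1 := family_second_moment mtau tau1 mZ iZ Zcos.
have [A [mA A0 AP]] := ae_convergent_series phi0 phiB mZ iZ Z1.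
pose Z' w i : R := \1_A w * Z w i.
have mZ' i : measurable_fun setT (fun w => Z' w i).
  by apply: measurable_funM => //; exact: measurable_indic.
exists d, S, Q, Z'; split=> //.
- move=> i; apply: le_integrable (iZ i) => //.
    by apply/measurable_EFinP; exact: measurable_funX.
  move=> w _; rewrite /= lee_fin /Z' [in leLHS]exprMn normrM ler_piMl// indicE.
  by case: (_ \in _); rewrite ?expr1n ?expr0n ?normr1 ?normr0.
- move=> n u b; rewrite -Zcos; congr fine; apply: ae_eq_integral => //.
  + by apply/measurable_EFinP; exact: measurable_cos_lin.
  + by apply/measurable_EFinP; exact: measurable_cos_lin.
  + exists (~` A); split => //; first exact: measurableC.
    apply: subsetC => w Aw /= _; congr (cos (_ + b))%:E; apply: eq_bigr => i _.
    by rewrite /Z' indicE mem_set// mul1r.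
- move=> w; have [Aw|nAw] := pselect (A w).
    rewrite (_ : (fun i => _) = fun i => phi i * `|Z w i|); first exact: AP.
    by apply/funext => i; rewrite /Z' indicE mem_set// mul1r.
  rewrite (_ : series _ = fun=> 0); first exact: is_cvg_cst.
  apply/funext => n; rewrite seriesEnat/= big1// => i _.
  by rewrite /Z' indicE memNset// mul0r normr0 mulr0.
Qed.

(** * Random elements of C(T) *)

Section weierstrass_m_test.
Context {R : realType} {K : ptopologicalType} (cK : compact [set: K]).
Local Notation C := (continuous_space R cK).

Lemma csfun_linear a (f g : C) t : csfun (a *: f + g) t = a * csfun f t + csfun g t.
Proof. by []. Qed.

Lemma csfun_sum I (r : seq I) (g : I -> C) t :
  csfun (\sum_(i <- r) g i) t = \sum_(i <- r) csfun (g i) t.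
Proof. by elim: r => [|i r IH]; rewrite ?big_nil// !big_cons -IH. Qed.

Lemma norm_csfun (f : C) t : `|csfun f t| <= `|f|.
Proof. exact: le_supnorm. Qed.

Lemma csfun_cvg (u : nat -> C) (f : C) t :
  u n @[n --> \oo] --> f -> csfun (u n) t @[n --> \oo] --> csfun f t.
Proof.
apply: (@cvg_lipschitz _ _ (fun h : C => csfun h t) 1) => h k; rewrite mul1r.
exact: (norm_csfun (h - k)).
Qed.

Lemma csfun_series_cvg (c : nat -> R) (g : nat -> C) (G : C) t :
  \sum_(i < n) c i *: g i @[n --> \oo] --> G ->
  \sum_(i < n) c i * csfun (g i) t @[n --> \oo] --> csfun G t.
Proof.
move=> /(csfun_cvg (t := t)).
rewrite (_ : (fun n => csfun _ t) = fun n => \sum_(i < n) c i * csfun (g i) t)//.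
by apply/funext => n; exact: csfun_sum.
Qed.

(** Pointwise limits exist by comparison; the partial sums stay within the tails of b of the limit,
    uniformly in t, so the limit is continuous. *)
Lemma continuous_space_series (g : nat -> C) (b : nat -> R) (B : R) :
  (forall i, `|g i| <= b i) -> series b n @[n --> \oo] --> B ->
  exists G : C, \sum_(i < n) g i @[n --> \oo] --> G.
Proof.
move=> gb bB; pose s n : C := \sum_(i < n) g i.
have b_nd : nondecreasing_seq (series b).
  by apply: nondecreasing_series => i _ _; exact: le_trans (gb i).
have b_le n : series b n <= B.
  rewrite -(cvg_lim (@Rhausdorff R) bB); apply: nondecreasing_cvgn_le b_nd _ _.
  by apply/cvg_ex; exists B.
have s_dist n k : (n <= k)%N -> `|s k - s n| <= B - series b n.
  move=> nk; rewrite /s -!(big_mkord xpredT g) (big_cat_nat (n := n))//= addrAC subrr add0r.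
  apply: le_trans (ler_norm_sum _ _ _) _; apply: (@le_trans _ _ (\sum_(n <= i < k) b i)).
    by apply: ler_sum => i _.
  by rewrite -lerBlDr opprK addrC; apply: le_trans (b_le k); rewrite !seriesEnat/= -big_cat_nat.
have tail_small e : 0 < e -> \forall n \near \oo, B - series b n <= e.
  move=> e0; move/cvgrPdist_le : bB => /(_ e e0); apply: filterS => n.
  by rewrite ger0_norm// subr_ge0.
have pt_cvg t : cvgn (fun n => csfun (s n) t).
  rewrite (_ : (fun n => _) = series (fun i => csfun (g i) t)); last first.
    by apply/funext => n; rewrite csfun_sum seriesEnat/= big_mkord.
  apply: normed_cvg; apply: (@series_le_cvg _ _ b) => [i|i|i|]; first exact: normr_ge0.
  - exact: le_trans (gb i).
  - exact: le_trans (norm_csfun _ _) (gb i).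
  - by apply/cvg_ex; exists B.
pose G t : R := limn (fun n => csfun (s n) t).
have G_dist n t : `|G t - csfun (s n) t| <= B - series b n.
  have H : `|csfun (s k) t - csfun (s n) t| @[k --> \oo] --> `|G t - csfun (s n) t|.
    by apply: cvg_norm; apply: cvgB; [exact: pt_cvg|exact: cvg_cst].
  apply: (cvgr_to_le H); near=> k.
  apply: le_trans (s_dist n k _); first exact: (norm_csfun (s k - s n)).
  by near: k; exact: nbhs_infty_ge.
have cG : continuous G.
  move=> t; apply/cvgrPdist_le => e e0; have e3 : 0 < e / 3 by rewrite divr_gt0.
  have [n _ /(_ n (leqnn n)) /= ne] := tail_small _ e3.
  have /cvgrPdist_le /(_ _ e3) := @csfun_continuous _ _ _ (s n) t.
  apply: filterS => u.
  have := le_trans (G_dist n t) ne; have := le_trans (G_dist n u) ne.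
  rewrite !ler_norml => /andP[p1 p2] /andP[q1 q2] /andP[h1 h2].
  by apply/andP; split; lra.
exists (mkcs cK cG); apply/cvgrPdist_le => e e0; apply: filterS (tail_small e e0) => n ne.
by apply: supnorm_le => t; apply: le_trans ne; exact: (G_dist n t).
Unshelve. all: by end_near. Qed.

End weierstrass_m_test.

Lemma metric_lipschitz_continuous {R : realType} {T : metricType R} (f : T -> R) (L : R) :
  0 < L -> (forall x y, `|f x - f y| <= L * mdist x y) -> continuous f.
Proof.
move=> L0 fL x; apply/cvgrPdist_le => e e0; apply/nbhs_ballP; exists (e / L).
  by rewrite /= divr_gt0.
move=> y; rewrite /= ballEmdist /= => xy; apply: le_trans (fL x y) _.
by rewrite mulrC -ler_pdivlMr//; exact: ltW.
Qed.

(** * Trees as sequences of bits *)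

Section vertex_enumeration.
Context {R : realType} {m : nat} {z : R} (hz : 0 < z < m%:R `^ (- (3 / 2))).
Local Notation C := (continuous_space R (tree_space_compact hz)).
Implicit Types x y t : tree m.

(* The vertices are numbered by pickle; a number that is not the code of a     *)
(* vertex has bit and weight 0.                                               *)
Definition vertex_bit x (i : nat) : R :=
  if @pickle_inv (vertex m) i is Some v then (x v)%:R else 0.

Definition weight (i : nat) : R :=
  if @pickle_inv (vertex m) i is Some v then z ^+ gen v else 0.

Lemma vertex_bit_cases x i : vertex_bit x i = 0 \/ vertex_bit x i = 1.
Proof. by rewrite /vertex_bit; case: pickle_inv => [v|]; [case: (x v); [right|left]|left]. Qed.

Lemma vertex_bit_itv x i : 0 <= vertex_bit x i <= 1.
Proof. by case: (vertex_bit_cases x i) => ->; rewrite lexx ler01. Qed.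

Lemma vertex_bit_dist x t i :
  `|vertex_bit x i - vertex_bit t i| = vertex_bit x i * (1 - 2 * vertex_bit t i) + vertex_bit t i.
Proof.
by case: (vertex_bit_cases x i) => ->; case: (vertex_bit_cases t i) => ->;
  rewrite ?subrr ?subr0 ?sub0r ?normrN ?normr1 ?normr0; lra.
Qed.

Lemma weight_ge0 i : 0 <= weight i.
Proof.
rewrite /weight; case: pickle_inv => [v|//].
by rewrite exprn_ge0//; case/andP: hz => /ltW.
Qed.

Lemma tree_dist_series x y :
  series (fun i => `|vertex_bit x i - vertex_bit y i| * weight i) n @[n --> \oo] -->
  tree_dist z x y.
Proof.
set a := fun i => `|vertex_bit x i - vertex_bit y i| * weight i.
have a0 i : (0 <= (a i)%:E)%E by rewrite lee_fin mulr_ge0// weight_ge0.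
have E : ((tree_dist z x y)%:E = \sum_(i <oo) (a i)%:E)%E.
  rewrite tree_distE// nneseries_esumT//.
  transitivity (\esum_(v in [set: vertex m]) (a (choice.pickle v))%:E)%E.
    by apply: eq_esum => v _; rewrite /a /vertex_bit /weight pickleK_inv.
  transitivity (\esum_(i in range (@choice.pickle (vertex m))) (a i)%:E)%E.
    symmetry; apply: (@reindex_esum R (vertex m) nat setT (range choice.pickle) choice.pickle
      (fun i => (a i)%:E)).
    split; [by move=> v _ /=; exists v| |by []].
    by move=> u v _ _; exact: (pcan_inj pickleK_inv).
  rewrite esum_mkcond; apply: eq_esum => i _; case: ifPn => // ir.
  rewrite /a /weight; case E : pickle_inv => [v|]; last by rewrite mulr0.
  exfalso; move/negP: ir; apply; rewrite inE; exists v => //.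
  by have := @pickle_invK (vertex m) i; rewrite E.
have : (\sum_(0 <= i < n) (a i)%:E)%E @[n --> \oo] --> (tree_dist z x y)%:E.
  by rewrite E; apply: is_cvg_nneseries => i _ _.
rewrite (_ : (fun n => _) = fun n => (series a n)%:E); last first.
  by apply/funext => n; rewrite sumEFin seriesEnat.
by move/fine_cvg.
Qed.

Lemma weight_series : exists B : R,
  series weight n @[n --> \oo] --> B /\ forall n, series weight n <= B.
Proof.
(* The total weight is the distance from the full tree to the empty one, hence finite. *)
pose full := @Tree m (fun=> true) (fun _ _ => isT).
set B := tree_dist z full (empty_tree m).
have wB : series weight n @[n --> \oo] --> B.
  have := @tree_dist_series full (empty_tree m).
  rewrite (_ : series _ = series weight)//; congr series; apply/funext => i.
  rewrite /vertex_bit /weight; case: pickle_inv => [v|]; last by rewrite mulr0.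
  by rewrite subr0 normr1 mul1r.
exists B; split=> // n; rewrite -(cvg_lim (@Rhausdorff R) wB); apply: nondecreasing_cvgn_le.
  by apply: nondecreasing_series => i _ _; exact: weight_ge0.
by apply/cvg_ex; exists B.
Qed.

Lemma tree_dist_bounded : exists B : R, forall x y, `|tree_dist z x y| <= B.
Proof.
have [B [_ wB]] := weight_series; exists B => x y.
apply: (cvgr_to_le (cvg_norm (@tree_dist_series x y))); near=> n; apply: le_trans (wB n).
rewrite ger0_norm; last by rewrite seriesEnat/= sumr_ge0// => i _; rewrite mulr_ge0// weight_ge0.
rewrite !seriesEnat/=; apply: ler_sum => i _; rewrite ler_piMl ?weight_ge0//.
by case: (vertex_bit_cases x i) => ->; case: (vertex_bit_cases y i) => ->;
  rewrite ?subrr ?subr0 ?sub0r ?normrN ?normr1 ?normr0.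
Unshelve. all: by end_near. Qed.

Lemma vertex_bit_dist_le x y i : `|vertex_bit x i - vertex_bit y i| * weight i <= tree_dist z x y.
Proof.
set a := fun i => `|vertex_bit x i - vertex_bit y i| * weight i.
have a0 j : 0 <= a j by rewrite mulr_ge0// weight_ge0.
have nd : nondecreasing_seq (series a) by apply: nondecreasing_series => j _ _.
rewrite -(cvg_lim (@Rhausdorff R) (@tree_dist_series x y)).
apply: le_trans (nondecreasing_cvgn_le nd _ i.+1); last first.
  by apply/cvg_ex; exists (tree_dist z x y); exact: tree_dist_series.
by rewrite seriesEnat/= big_nat_recr//= lerDr sumr_ge0.
Qed.

Let coord (i : nat) (t : tree_space hz) : R := weight i * (1 - 2 * vertex_bit t i).

(** Lipschitz with constant 2, since one vertex contributes at most the whole distance. *)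
Let coord_continuous i : continuous (coord i).
Proof.
apply: (@metric_lipschitz_continuous R (tree_space hz) _ 2) => // t u.
apply: le_trans (_ : 2 * (`|vertex_bit t i - vertex_bit u i| * weight i) <= _); last first.
  by rewrite ler_wpM2l//; exact: vertex_bit_dist_le.
rewrite /coord -mulrBr.
rewrite (_ : 1 - 2 * vertex_bit t i - (1 - 2 * vertex_bit u i) =
  - 2 * (vertex_bit t i - vertex_bit u i)); last ring.
by rewrite !normrM normrN normr_nat (ger0_norm (weight_ge0 i)) mulrCA (mulrC (weight i)).
Qed.

Definition coordinate i : C := mkcs (tree_space_compact hz) (@coord_continuous i).

Lemma coordinateE i (t : tree m) :
  csfun (coordinate i) t = weight i * (1 - 2 * vertex_bit t i).
Proof. by []. Qed.

Lemma norm_coordinate i : `|coordinate i| <= weight i.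
Proof.
apply: supnorm_le => t; rewrite coordinateE normrM (ger0_norm (weight_ge0 i)).
rewrite ler_piMr ?weight_ge0//.
by case: (vertex_bit_cases t i) => ->; rewrite ler_norml; apply/andP; split; lra.
Qed.

Lemma measurable_vertex_bit i : measurable_fun setT (fun x : tree m => vertex_bit x i).
Proof.
rewrite /vertex_bit; case: pickle_inv => [v|]; last exact: measurable_cst.
rewrite (_ : (fun x => _) = \1_[set x : tree m | x v]); last first.
  apply/funext => x; rewrite indicE; congr (nat_of_bool _)%:R.
  by apply/idP/idP => [xv|/set_mem//]; exact: mem_set.
by apply: measurable_indic; apply: sub_sigma_algebra; exists v.
Qed.

Lemma finite_range_bits n (u : nat -> R) (p : nat -> R) :
  finite_set (range (fun x : tree m => lin n u (fun i => vertex_bit x i - p i))).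
Proof.
pose b (x : tree m) : {ffun 'I_n -> bool} := [ffun i : 'I_n => vertex_bit x i == 1].
pose h (c : {ffun 'I_n -> bool}) : R := \sum_(i < n) u i * ((c i)%:R - p i).
apply: (@sub_finite_set _ _ (h @` setT)); last first.
  by apply: finite_image; exact: finite_finset.
move=> _ [x _ <-]; exists (b x) => //; apply: eq_bigr => i _; rewrite ffunE.
by case: (vertex_bit_cases x i) => ->; rewrite ?eqxx// eq_sym oner_eq0.
Qed.

End vertex_enumeration.

(** Reduces covariances to second moments of X, Y and X + Y, the quantities that
    [gaussian_functional] transfers from tau to Z. *)
Lemma covariance_polarization {R : realType} {d : measure_display} {S : measurableType d}
    (Q : probability S R) (X Y : S -> R) :
  measurable_fun setT X -> measurable_fun setT Y ->
  Q.-integrable setT (EFin \o (fun w => X w ^+ 2)) ->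
  Q.-integrable setT (EFin \o (fun w => Y w ^+ 2)) ->
  \int[Q]_w X w = 0 -> \int[Q]_w Y w = 0 ->
  covariance Q X Y = ((\int[Q]_w ((X w + Y w) ^+ 2) - \int[Q]_w (X w ^+ 2) -
                       \int[Q]_w (Y w ^+ 2)) / 2)%:E.
Proof.
move=> mX mY iX iY X0 Y0.
have iXY : Q.-integrable setT (EFin \o (fun w => X w * Y w)).
  apply: le_integrable (integrableDR iX iY) => //.
    by apply/measurable_EFinP; exact: measurable_funM.
  move=> w _; rewrite /= lee_fin normrM [leRHS]ger0_norm ?addr_ge0 ?sqr_ge0//.
  rewrite -(real_normK (num_real (X w))) -(real_normK (num_real (Y w))).
  have := sqr_ge0 (`|X w| - `|Y w|); have := normr_ge0 (X w); have := normr_ge0 (Y w).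
  by move: `|X w| `|Y w| => a b; nra.
rewrite covariance.unlock (expectation_of_sqr mX iX) (expectation_of_sqr mY iY) X0 Y0 /=.
rewrite (_ : 'E_Q[_] = (\int[Q]_w (X w * Y w))%:E)%E; last first.
  rewrite unlock /Rintegral fineK; last exact: (integrable_fin_num measurableT iXY).
  apply: eq_integral => w _. congr EFin.
  by change ((X w - 0) * (Y w - 0) = X w * Y w); rewrite !subr0.
congr EFin; have -> : \int[Q]_w ((X w + Y w) ^+ 2) =
    \int[Q]_w ((X w ^+ 2 + 2 * (X w * Y w)) + Y w ^+ 2).
  by apply: eq_Rintegral => w _; ring.
have i2 := integrableZlR 2 iXY; rewrite RintegralD//; last exact: integrableDR.
by rewrite RintegralD// RintegralZl//; field.
Qed.

(** * Linear functionals of the limit *)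

Section functionals_of_gaussian_series.
Context {R : realType} {V : normedModType R} {d0 d : measure_display}
  {Omega0 : measurableType d0} {S : measurableType d}.
Variables (P0 : probability Omega0 R) (tau : nat -> Omega0 -> R) (Q : probability S R)
  (Z : S -> nat -> R) (psi : nat -> V) (phi : nat -> R) (B : R)
  (W : S -> V) (U : Omega0 -> V).
Hypothesis mtau : forall i, measurable_fun setT (tau i).
Hypothesis tau1 : forall i w, `|tau i w| <= 1.
Hypothesis mZ : forall i, measurable_fun setT (fun w => Z w i).
Hypothesis iZ : forall i, Q.-integrable setT (EFin \o (fun w => Z w i ^+ 2)).
Hypothesis Zcos : forall n u b, \int[Q]_w cos (lin n u (Z w) + b) =
  cos b * expR (- (\int[P0]_w (lin n u (tau ^~ w) ^+ 2) / 2)).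
Hypothesis psi_phi : forall i, `|psi i| <= phi i.
Hypothesis phiB : forall n, series phi n <= B.
Hypothesis ZW : forall w, \sum_(i < n) Z w i *: psi i @[n --> \oo] --> W w.
Hypothesis tauU : forall w, \sum_(i < n) tau i w *: psi i @[n --> \oo] --> U w.

(** l applied to the series of W or of U is the scalar series with coefficients l (psi_i), which are
    summable as l is bounded; [gaussian_series] applies to both. *)
Lemma gaussian_functional (l : V -> R) (K : R) :
  (forall a f g, l (a *: f + g) = a * l f + l g) -> (forall f, `|l f| <= K * `|f|) ->
  [/\ gaussian_variable Q (fun w => l (W w)),
      Q.-integrable setT (EFin \o (fun w => l (W w) ^+ 2)),
      \int[Q]_w (l (W w) ^+ 2) = \int[P0]_w (l (U w) ^+ 2) & \int[Q]_w l (W w) = 0].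
Proof.
move=> ll lK; have l0 : l 0 = 0.
  by apply/eqP; rewrite -normr_le0; have := lK 0; rewrite normr0 mulr0.
have lL f g : `|l f - l g| <= K * `|f - g|.
  have <- : l (f - g) = l f - l g by rewrite addrC -scaleN1r ll mulN1r addrC.
  exact: lK.
have lsum n (c : nat -> R) : l (\sum_(i < n) c i *: psi i) = lin n (fun i => l (psi i)) c.
  rewrite /lin; elim: n => [|n IH]; first by rewrite !big_ord0.
  by rewrite !big_ord_recr/= addrC ll IH addrC mulrC.
apply: (gaussian_series mtau tau1 mZ iZ Zcos (a := fun i => l (psi i)) (A := `|K| * B)) => [n|w|w].
- apply: (@le_trans _ _ (`|K| * series phi n)); last by rewrite ler_wpM2l.
  rewrite seriesEnat/= big_mkord mulr_sumr; apply: ler_sum => i _.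
  apply: le_trans (lK _) _; apply: (@le_trans _ _ (`|K| * `|psi i|)).
    by rewrite ler_wpM2r// ler_norm.
  by rewrite ler_wpM2l.
- by under eq_fun do rewrite -lsum; exact: cvg_lipschitz lL _ _ (@ZW w).
- by under eq_fun do rewrite -lsum; exact: cvg_lipschitz lL _ _ (@tauU w).
Qed.

End functionals_of_gaussian_series.

(** * The sample as a random series *)

Section tree_samples.
Context {R : realType} {m : nat} {z : R} (hz : 0 < z < m%:R `^ (- (3 / 2))).
Context {d0 d : measure_display} {Omega0 : measurableType d0} {Omega : measurableType d}.
Variables (P0 : probability Omega0 R) (T : {RV P0 >-> tree m})
  (P : probability Omega R) (T_ : nat -> {RV P >-> tree m}).
Hypotheses (T_indep : mutually_independent T_) (T_law : forall i, same_law (T_ i) T).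
Local Notation wt := (@weight R m z).
Local Notation C := (continuous_space R (tree_space_compact hz)).

Definition vertex_freq i : R := \int[P0]_w vertex_bit (T w : tree m) i.

Definition centered_bit (x : tree m) i : R := vertex_bit x i - vertex_freq i.

Definition normalized_sum n w i : R :=
  (Num.sqrt n%:R)^-1 * \sum_(j < n) centered_bit (T_ j w) i.

Lemma measurable_centered_bit i : measurable_fun setT (fun x : tree m => centered_bit x i).
Proof. by apply: measurable_funB => //; exact: measurable_vertex_bit. Qed.

Lemma integrable_vertex_bit i : P0.-integrable setT (EFin \o (fun w => vertex_bit (T w) i : R)).
Proof.
apply: (@bounded_integrable _ _ _ _ _ 1) => [|w].
  exact: (measurableT_comp (measurable_vertex_bit i)).
by have /andP[? ?] := @vertex_bit_itv R _ (T w) i; rewrite ger0_norm.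
Qed.

Lemma vertex_freq_itv i : 0 <= vertex_freq i <= 1.
Proof.
apply/andP; split.
  by apply: Rintegral_ge0 => w _; have /andP[] := @vertex_bit_itv R _ (T w) i.
rewrite -(expect_cst P0 1); apply: le_Rintegral => //; first exact: integrable_vertex_bit.
  by apply: (@bounded_integrable _ _ _ _ _ 1) => // w; rewrite normr1.
by move=> w _; have /andP[] := @vertex_bit_itv R _ (T w) i.
Qed.

Lemma centered_bit_le1 x i : `|centered_bit x i| <= 1.
Proof.
have := vertex_freq_itv i; have := @vertex_bit_itv R _ x i; rewrite /centered_bit.
by move=> /andP[? ?] /andP[? ?]; rewrite ler_norml; apply/andP; split; lra.
Qed.

Lemma expect_centered_bit i : \int[P0]_w centered_bit (T w) i = 0.
Proof.
rewrite /centered_bit RintegralB//; last 2 first.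
- exact: integrable_vertex_bit.
- by apply: (@bounded_integrable _ _ _ _ _ `|vertex_freq i|).
by rewrite expect_cst subrr.
Qed.

Lemma integrable_centered_bit i :
  P0.-integrable setT (EFin \o (fun w => centered_bit (T w) i)).
Proof.
apply: (@bounded_integrable _ _ _ _ _ 1) => [|w]; last exact: centered_bit_le1.
by apply: (measurableT_comp (measurable_centered_bit i)).
Qed.

Lemma coordinate_series (c : nat -> R) :
  cvgn (series (fun i => wt i * `|c i|)) ->
  exists G : C, \sum_(i < n) c i *: coordinate hz i @[n --> \oo] --> G.
Proof.
move=> /cvg_ex[B cB];
apply: (@continuous_space_series _ _ _ (fun i => c i *: coordinate hz i) _ B _ cB) => i.
by rewrite normrZ mulrC ler_wpM2r// norm_coordinate.
Qed.

Lemma bounded_coordinate_series (c : nat -> R) (K : R) : (forall i, `|c i| <= K) ->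
  exists G : C, \sum_(i < n) c i *: coordinate hz i @[n --> \oo] --> G.
Proof.
move=> cK; apply: coordinate_series; have [B [wB _]] := weight_series hz.
have w0 := weight_ge0 hz.
apply: (@series_le_cvg _ _ (fun i => wt i * K)) => [i|i|i|].
- exact: mulr_ge0.
- by rewrite mulr_ge0//; exact: le_trans (cK i).
- by rewrite ler_wpM2l.
- rewrite (_ : series _ = fun n => series wt n * K).
    by apply/cvg_ex; exists (B * K); exact: cvgMl.
  by apply/funext => n; rewrite !seriesEnat/= mulr_suml.
Qed.

Lemma measurable_tree_dist (t : tree m) : measurable_fun setT (fun x : tree m => tree_dist z x t).
Proof.
apply: (@measurable_fun_cvg _ _ _ _ (fun n (x : tree m) =>
  series (fun i => `|vertex_bit x i - vertex_bit t i| * wt i) n)).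
  move=> n; rewrite /series/=; apply: measurable_sum => i; apply: measurable_funM => //.
  by apply: measurableT_comp => //; apply: measurable_funB => //; exact: measurable_vertex_bit.
by move=> x _; exact: (tree_dist_series hz).
Qed.

Lemma mean_dist_series (t : tree m) :
  series (fun i => (vertex_freq i * (1 - 2 * vertex_bit t i) + vertex_bit t i) * wt i) n
    @[n --> \oo] --> mean_dist z T t.
Proof.
have [B [_ wle]] := weight_series hz; have w0 := weight_ge0 hz.
pose s n (w : Omega0) := series (fun i => `|vertex_bit (T w) i - vertex_bit t i| * wt i) n.
have -> : mean_dist z T t = \int[P0]_w tree_dist z (T w) t by rewrite /mean_dist unlock.
have term_le w i : `|vertex_bit (T w) i - vertex_bit t i| * wt i <= wt i.
  rewrite ler_piMl//; case: (@vertex_bit_cases R _ (T w) i) => ->;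
    case: (@vertex_bit_cases R _ t i) => ->;
  by rewrite ?subrr ?subr0 ?sub0r ?normrN ?normr1 ?normr0.
have mb i : measurable_fun setT (fun w => vertex_bit (T w) i : R).
  exact: (measurableT_comp (measurable_vertex_bit i)).
have H : \int[P0]_w s n w @[n --> \oo] --> \int[P0]_w tree_dist z (T w) t.
  apply: (@bounded_cvg_Rintegral _ _ _ P0 _ _ B) => [n|n w|w].
  - rewrite /s /series/=; apply: measurable_sum => i; apply: measurable_funM => //.
    by apply: measurableT_comp => //; apply: measurable_funB.
  - rewrite /s ger0_norm; last first.
      by rewrite seriesEnat/= sumr_ge0// => i _; rewrite mulr_ge0.
    apply: le_trans (wle n); rewrite !seriesEnat/=; apply: ler_sum => i _; exact: term_le.
  - exact: (tree_dist_series hz).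
rewrite (_ : series _ = fun n => \int[P0]_w s n w)//; apply/funext => n.
have ib i : P0.-integrable setT (EFin \o
    (fun w => (1 - 2 * vertex_bit t i) * vertex_bit (T w) i + vertex_bit t i)).
  apply: integrableDR; last by apply: (@bounded_integrable _ _ _ _ _ `|vertex_bit t i|).
  by apply: integrableZlR; exact: integrable_vertex_bit.
have sE w : s n w =
    \sum_(i <- index_iota 0 n)
    wt i * ((1 - 2 * vertex_bit t i) * vertex_bit (T w) i + vertex_bit t i).
  by rewrite /s seriesEnat/=; apply: eq_bigr => i _;
     rewrite vertex_bit_dist mulrC (mulrC (vertex_bit _ _)).
under eq_Rintegral do rewrite sE.
rewrite expect_sum; last by move=> i; exact: integrableZlR.
rewrite seriesEnat/=; apply: eq_bigr => i _; rewrite RintegralZl// mulrC; congr (_ * _).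
rewrite RintegralD//; last 2 first.
- by apply: integrableZlR; exact: integrable_vertex_bit.
- by apply: (@bounded_integrable _ _ _ _ _ `|vertex_bit t i|).
by rewrite RintegralZl ?expect_cst 1?mulrC//; exact: integrable_vertex_bit.
Qed.

(** Difference of the series of d(x, t) and of its mean: the terms t(v_i) cancel and what remains is
    linear in the centered bits. *)
Lemma centered_bit_series (x t : tree m) :
  \sum_(i < n) centered_bit x i * csfun (coordinate hz i) t @[n --> \oo] -->
  tree_dist z x t - mean_dist z T t.
Proof.
rewrite (_ : (fun n => _) = fun n => series (fun i => `|vertex_bit x i - vertex_bit t i| * wt i) n -
    series (fun i => (vertex_freq i * (1 - 2 * vertex_bit t i) + vertex_bit t i) * wt i) n).
  by apply: cvgB; [exact: (tree_dist_series hz)|exact: mean_dist_series].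
apply/funext => n.
transitivity (\sum_(i < n) centered_bit x i * (wt i * (1 - 2 * vertex_bit t i))) => //.
rewrite !seriesEnat/= !big_mkord -sumrB; apply: eq_bigr => i _.
by rewrite vertex_bit_dist /centered_bit; ring.
Qed.

Lemma centered_dist_moments (t : tree m) : [/\ measurable_fun setT (centered_dist z T t),
  P0.-integrable setT (EFin \o (fun w => centered_dist z T t w ^+ 2)) &
  \int[P0]_w centered_dist z T t w = 0].
Proof.
have [B dB] := tree_dist_bounded hz; pose D := mean_dist z T t.
have md : measurable_fun setT (fun w => tree_dist z (T w) t).
  exact: (measurableT_comp (measurable_tree_dist t)).
have mc : measurable_fun setT (centered_dist z T t) by exact: measurable_funB.
split=> //.
  apply: (@bounded_integrable _ _ _ _ _ ((B + `|D|) ^+ 2)) => [|w].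
    exact: measurable_funX.
  rewrite normrX lerXn2r ?nnegrE//.
    by rewrite addr_ge0//; exact: le_trans (dB t t).
  by apply: le_trans (ler_normB _ _) _; rewrite lerD2r.
have id0 : P0.-integrable setT (EFin \o (fun w => tree_dist z (T w) t)).
  by apply: (@bounded_integrable _ _ _ _ _ B).
rewrite /centered_dist RintegralB//; last by apply: (@bounded_integrable _ _ _ _ _ `|D|).
by rewrite expect_cst /mean_dist unlock subrr.
Qed.

Lemma normalized_sum_series n w (t : tree m) :
  \sum_(i < k) normalized_sum n w i * csfun (coordinate hz i) t @[k --> \oo] -->
  Num.sqrt n%:R * (empirical_dist z T_ n w t - mean_dist z T t).
Proof.
have -> : Num.sqrt n%:R * (empirical_dist z T_ n w t - mean_dist z T t) =
    (Num.sqrt n%:R)^-1 * \sum_(j < n) (tree_dist z (T_ j w) t - mean_dist z T t) :> R.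
  rewrite sumrB sumr_const card_ord -[mean_dist _ _ _ *+ n]mulr_natl /empirical_dist.
  (* For n = 0 both sides vanish, since sqrt 0 = 0 and the inverse of 0 is 0. *)
  have [->|n0] := eqVneq n 0%N; first by rewrite mulr0n sqrtr0 invr0 !mul0r.
  have nE : (n%:R : R) = Num.sqrt n%:R ^+ 2 by rewrite sqr_sqrtr.
  have s0 : Num.sqrt n%:R != 0 :> R by rewrite gt_eqF// sqrtr_gt0 ltr0n lt0n.
  by rewrite {2 4}nE; field.
rewrite (_ : (fun k => _) = fun k => (Num.sqrt n%:R)^-1 *
    \sum_(j < n) \sum_(i < k) centered_bit (T_ j w) i * csfun (coordinate hz i) t).
  apply: cvgMr; apply: (@cvg_sum_seq _ R^o _ _ _ _ _ (fun (j : 'I_n) k =>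
    \sum_(i < k) centered_bit (T_ j w) i * csfun (coordinate hz i) t)) => j.
  exact: centered_bit_series.
apply/funext => k; rewrite exchange_big/= mulr_sumr; apply: eq_bigr => i _.
by rewrite /normalized_sum -mulrA mulr_suml.
Qed.

Lemma measurable_normalized_sum n i : measurable_fun setT (fun w => normalized_sum n w i).
Proof.
apply: measurable_funM => //; apply: measurable_sum => j.
exact: (measurableT_comp (measurable_centered_bit i)).
Qed.

(** A crude bound at fixed n and w, which only makes the series defining Y_n converge; uniformity in
    n comes from the second moments. *)
Lemma normalized_sum_le n w i : `|normalized_sum n w i| <= Num.sqrt n%:R.
Proof.
have [->|n0] := eqVneq n 0%N.
  by rewrite /normalized_sum big_ord0 mulr0 normr0 sqrtr_ge0.
have s0 : 0 < Num.sqrt n%:R :> R by rewrite sqrtr_gt0 ltr0n lt0n.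
rewrite normrM ger0_norm ?invr_ge0 ?sqrtr_ge0// ler_pdivrMl// -expr2 sqr_sqrtr//.
apply: le_trans (ler_norm_sum _ _ _) _.
apply: (@le_trans _ _ (\sum_(j < n) 1)); last by rewrite sumr_const card_ord.
by apply: ler_sum => j _; exact: centered_bit_le1.
Qed.

Lemma lin_normalized_sum k u n w : lin k u (normalized_sum n w) =
  (Num.sqrt n%:R)^-1 * \sum_(j < n) lin k u (centered_bit (T_ j w)).
Proof.
rewrite /lin exchange_big/= mulr_sumr; apply: eq_bigr => i _.
by rewrite /normalized_sum mulrCA -mulr_sumr.
Qed.

Let lin_centered_bit k u :
  [/\ measurable_fun setT (fun x : tree m => lin k u (centered_bit x)),
      finite_set (range (fun x : tree m => lin k u (centered_bit x))) &
      \int[P0]_w lin k u (centered_bit (T w)) = 0].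
Proof.
split; first exact: (measurable_lin measurable_centered_bit).
  exact: finite_range_bits.
rewrite /lin expect_sum => [|i]; last by apply: integrableZlR; exact: integrable_centered_bit.
rewrite big1// => i _; rewrite RintegralZl ?expect_centered_bit ?mulr0//.
exact: integrable_centered_bit.
Qed.

Lemma normalized_sum_cos k u b :
  \int[P]_w cos (lin k u (normalized_sum n w) + b) @[n --> \oo] -->
  cos b * expR (- (\int[P0]_w (lin k u (centered_bit (T w)) ^+ 2) / 2)).
Proof.
have [mf ff f0] := lin_centered_bit k u.
under eq_fun do under eq_Rintegral do rewrite lin_normalized_sum.
exact: (clt_cos T_indep T_law mf ff f0).
Qed.

Lemma normalized_sum_second_moment n i :
  P.-integrable setT (EFin \o (fun w => normalized_sum n w i ^+ 2)) /\
  \int[P]_w (normalized_sum n w i ^+ 2) <= 1.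
Proof.
have fr : finite_set (range (fun x : tree m => centered_bit x i)).
  have [_ ff _] := lin_centered_bit i.+1 (fun j => (j == i)%:R).
  rewrite (_ : (fun x : tree m => centered_bit x i) =
    fun x => lin i.+1 (fun j => (j == i)%:R) (centered_bit x))//.
  apply/funext => x; rewrite /lin big_ord_recr/= eqxx mul1r.
  by rewrite big1 ?add0r// => j _; rewrite (ltn_eqF (ltn_ord j)) mul0r.
have [i2 E2] := sum_second_moment T_indep T_law (measurable_centered_bit i) fr
  (expect_centered_bit i) n.
have sE w : normalized_sum n w i ^+ 2 =
    (Num.sqrt n%:R)^-1 ^+ 2 * (\sum_(j < n) centered_bit (T_ j w) i) ^+ 2.
  by rewrite /normalized_sum exprMn.
under eq_fun do rewrite sE; split; first exact: integrableZlR.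
rewrite RintegralZl// E2 exprVn sqr_sqrtr//.
have [->|n0] := eqVneq n 0%N; first by rewrite mul0r mulr0.
rewrite mulKf ?pnatr_eq0// -[leRHS](expect_cst P0 1).
have sq1 w : centered_bit (T w) i ^+ 2 <= 1.
  by rewrite -(real_normK (num_real (centered_bit _ _))) expr_le1// centered_bit_le1.
apply: le_Rintegral => //; apply: (@bounded_integrable _ _ _ _ _ 1) => //.
- by apply: measurable_funX; exact: (measurableT_comp (measurable_centered_bit i)).
- by move=> w; rewrite ger0_norm ?sqr_ge0.
- by move=> w; rewrite normr1.
Qed.

End tree_samples.

Theorem theorem5p3 (R : realType) (m : nat) (hm : (1 <= m)%N) (z : R)
    (hz : 0 < z < m%:R `^ (- (3 / 2)))
    (d0 : measure_display) (Omega0 : measurableType d0)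
    (P0 : probability Omega0 R) (T : {RV P0 >-> tree m})
    (d : measure_display) (Omega : measurableType d)
    (P : probability Omega R) (T_ : nat -> {RV P >-> tree m})
    (T_indep : mutually_independent T_)
    (T_law : forall i, same_law (T_ i) T) :
  exists Y : nat -> Omega -> continuous_space R (tree_space_compact hz),
    (forall n w (t : tree m), csfun (Y n w) t =
      Num.sqrt n%:R * (empirical_dist z T_ n w t - mean_dist z T t)) /\
    exists (d' : measure_display) (S : measurableType d')
        (Q : probability S R)
        (W : S -> continuous_space R (tree_space_compact hz)),
      [/\ cvg_in_distribution P Q Y W,
          gaussian_element Q W,
          gaussian_process Q (fun (t : tree m) w => csfun (W w) t),
          (forall t : tree m, 'E_Q[fun w => csfun (W w) t] = 0)%E &
          forall s t : tree m,
            covariance Q (fun w => csfun (W w) s) (fun w => csfun (W w) t) =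
            covariance P0 (centered_dist z T s) (centered_dist z T t)].
Proof.
have [B [wB wle]] := weight_series hz; have w0 := weight_ge0 hz.
pose tau i w : R := centered_bit T (T w) i.
have mtau i : measurable_fun setT (tau i).
  exact: (measurableT_comp (measurable_centered_bit T i)).
have tau1 i w : `|tau i w| <= 1 by exact: centered_bit_le1.
have [d' [S [Q [Z [mZ iZ Zcos Zsum]]]]] := gaussian_family_summable P0 mtau tau1 w0 wle.
have Z1 := family_second_moment mtau tau1 mZ iZ Zcos.
have /choice[W ZW] := fun w => coordinate_series hz (Zsum w).
(* U is d(T, .) - E d(T, .) as an element of C(T), by [UE] below. *)
have /choice[U tauU] := fun w => bounded_coordinate_series hz (tau1 ^~ w).
have /choice[Y XY] := fun nw : nat * Omega =>
  bounded_coordinate_series hz (normalized_sum_le T T_ nw.1 nw.2).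
have UE (t : tree_space hz) w : csfun (U w) t = centered_dist z T t w.
  apply: (cvg_unique (@Rhausdorff R) (csfun_series_cvg (t := t) (@tauU w))).
  exact: centered_bit_series.
exists (fun n w => Y (n, w)); split.
  move=> n w t; have := csfun_series_cvg (t := t : tree_space hz) (@XY (n, w)).
  move=> /(cvg_unique (@Rhausdorff R)); apply.
  exact: normalized_sum_series.
exists d', S, Q, W.
have cvgYW : cvg_in_distribution P Q (fun n w => Y (n, w)) W.
  apply: (random_series_cvg_in_distribution (norm_coordinate hz) wB
    (X := normalized_sum T T_) (Z := Z)) => //.
  - exact: measurable_normalized_sum.
  - by move=> n i; have [] := normalized_sum_second_moment T_indep T_law n i.
  - by move=> n i; have [] := normalized_sum_second_moment T_indep T_law n i.
  - by move=> n w; exact: (@XY (n, w)).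
  - by move=> k u b; rewrite Zcos; exact: (normalized_sum_cos T_indep T_law).
have functional := gaussian_functional mtau tau1 mZ iZ Zcos (norm_coordinate hz) wle ZW tauU.
(* Evaluation at t is linear and bounded by the norm, with K = 1. *)
have mean0 (t : tree_space hz) := functional (fun f => csfun f t) 1 (fun _ _ _ => erefl)
  (fun f => le_trans (norm_csfun f t) (eq_ind_r (fun x => `|f| <= x) (lexx _) (mul1r _))).
split=> //.
- split=> [|l cl]; first by case: cvgYW.
  have /linear_boundedP/pinfty_ex_gt0[K K0 lK] := continuous_linear_bounded (0 : _) (cl 0).
  have [] // := functional l K _ lK.
  by move=> a f g; rewrite linearP.
- move=> k t c.
  have [] // := functional (fun f => \sum_(i < k) c i * csfun f (t i)) (\sum_(i < k) `|c i|).
    move=> a f g; rewrite mulr_sumr -big_split; apply: eq_bigr => i _.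
    by rewrite csfun_linear /=; ring.
  move=> f; rewrite mulr_suml; apply: le_trans (ler_norm_sum _ _ _) _.
  by apply: ler_sum => i _; rewrite normrM ler_wpM2l// norm_csfun.
- by move=> t; have [[mW _] iW _ W0] := mean0 t; rewrite expectation_of_sqr// W0.
move=> s t.
have [[mWs _] iWs Es Ws0] := mean0 s; have [[mWt _] iWt Et Wt0] := mean0 t.
(* The functional f s + f t supplies the remaining second moment for polarization; its bound is
   2. *)
have [a f g|f|_ _ Est _] := functional (fun f => csfun f s + csfun f t) 2.
- by rewrite !csfun_linear; ring.
- have := norm_csfun f s; have := norm_csfun f t.
  by have := ler_normD (csfun f s) (csfun f t); lra.
have [ms is2 s0] := centered_dist_moments hz T s; have [mt it2 t0] := centered_dist_moments hz T t.
rewrite !covariance_polarization// Est Es Et.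
by congr (((_ - _ - _) / 2)%:E); apply: eq_Rintegral => w _; rewrite !UE.
Qed.
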